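(* Assume that the physical constants and the control parameters $\epsilon_1,\epsilon_2$ satisfy the structural assumption (S) given in the context. Then the energy decays exponentially to zero, at the same rate $\Lambda$ as the augmented energy: there exist $\Lambda>0$ and $K_E>0$ such that for every $X_0\in D(\mathcal{A})$ and all $t\ge0$, with $X(t)=T(t)X_0$, $\mathcal{E}(t)=\frac12\|X(t)\|_{\mathcal{H},2}^2$ and $E(t)=\frac12\|X(t)\|_{\mathcal{H},1}^2$, one has $\mathcal{E}(t)\le\mathcal{E}(0)\exp(-\Lambda t)$ and $$E(t)\le K_E\,E(0)\exp(-\Lambda t).$$ Furthermore, $T(t)$ is an exponentially stable $C_0$-semigroup for $\|\cdot\|_{\mathcal{H},1}$.
   Context: Constants: $l,\rho,I_w,m_s,J_s,c_\omega,c_\phi,\eta_\omega,\eta_\phi,k_1,k_2,\epsilon_1,\epsilon_2$ are positive real numbers, $x_c\in\mathbb{R}$, and $\alpha_\omega,\beta_\omega,\gamma_\omega,\alpha_\phi,\beta_\phi,\gamma_\phi\ge 0$. Put $I_w^*=I_w+\rho x_c^2$, $J_s^*=J_s+m_sx_c^2$, and define the symmetric positive definite matrices $M=\begin{bmatrix}\rho&\rho x_c\\ \rho x_c&I_w^*\end{bmatrix}$, $M_s=\begin{bmatrix}m_s&m_sx_c\\ m_sx_c&J_s^*\end{bmatrix}$. $\lambda_m(\cdot)$ denotes the smallest eigenvalue. Spaces: $H^m(0,l)$ is the usual real Sobolev space of functions in $L^2(0,l)$ with $m$ weak derivatives in $L^2(0,l)$, $\mathrm{AC}[0,l]$ is the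 set of absolutely continuous functions on $[0,l]$, and $H_L^m(0,l)=\{f\in H^m(0,l): f(0)=f'(0)=\dots=f^{(m-1)}(0)=0\}$ (elements of $H^1(0,l)$ are identified with their absolutely continuous representatives). Let $\mathcal{H}=H_L^2(0,l)\times L^2(0,l)\times H_L^1(0,l)\times L^2(0,l)\times\mathbb{R}\times\mathbb{R}$. For $X_i=(f_i,g_i,h_i,z_i,\zeta_{\omega,i},\zeta_{\phi,i})\in\mathcal{H}$ define $$\langle X_1,X_2\rangle_{\mathcal{H},1}=\int_0^l\big[\rho c_\omega^2f_1''f_2''+I_wc_\phi^2h_1'h_2'\big]dy+\int_0^l\begin{bmatrix}g_1\\ z_1\end{bmatrix}^\top M\begin{bmatrix}g_2\\ z_2\end{bmatrix}dy+\begin{bmatrix}\zeta_{\omega,1}\\ \zeta_{\phi,1}\end{bmatrix}^\top M_s\begin{bmatrix}\zeta_{\omega,2}\\ \zeta_{\phi,2}\end{bmatrix},$$ $$\Psi(X_1,X_2)=\int_0^l\Big(\begin{bmatrix}g_1\\ z_1\end{bmatrix}^\top M\begin{bmatrix}\epsilon_1f_2\\ \epsilon_2h_2\end{bmatrix}+\begin{bmatrix}g_2\\ z_2\end{bmatrix}^\top M\begin{bmatrix}\epsilon_1f_1\\ \epsilon_2h_1\end{bmatrix}\Big)dy+\begin{bmatrix}\zeta_{\omega,1}\\ \zeta_{\phi,1}\end{bmatrix}^\top M_s\begin{bmatrix}\epsilon_1f_2(l)\\ \epsilon_2h_2(l)\end{bmatrix}+\begin{bmatrix}\zeta_{\omega,2}\\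 \zeta_{\phi,2}\end{bmatrix}^\top M_s\begin{bmatrix}\epsilon_1f_1(l)\\ \epsilon_2h_1(l)\end{bmatrix},$$ and $\langle X_1,X_2\rangle_{\mathcal{H},2}=\langle X_1,X_2\rangle_{\mathcal{H},1}+\Psi(X_1,X_2)$ (for $\epsilon_i\in(0,K_{m,i})$ this is an inner product on $\mathcal{H}$ whose norm $\|\cdot\|_{\mathcal{H},2}$ is equivalent to $\|\cdot\|_{\mathcal{H},1}$). Thresholds (if $x_c=0$, terms with $|x_c|$ as a factor of the denominator are read as $+\infty$, i.e. omitted): $$K_{m,1}=\min\Big(\tfrac{\pi^4\rho c_\omega^2}{4l^3(1+|x_c|)\{4l\rho^{3/2}c_\omega+\pi^2m_s\}},\tfrac{c_\omega\lambda_m(M)}{2\sqrt\rho},\tfrac{c_\omega\lambda_m(M)}{2\sqrt\rho|x_c|},\tfrac{\lambda_m(M_s)}{2m_s},\tfrac{\lambda_m(M_s)}{2m_s|x_c|}\Big),$$ $$K_{m,2}=\min\Big(\tfrac{\pi^2I_wc_\phi^2}{4l^2(I_w^*+\rho|x_c|)\sqrt{I_w}c_\phi+\pi^2l(J_s^*+m_s|x_c|)},\tfrac{\sqrt{I_w}c_\phi\lambda_m(M)}{2\rho|x_c|},\tfrac{\sqrt{I_w}c_\phi\lambda_m(M)}{2I_w^*},\tfrac{\lambda_m(M_s)}{2m_s|x_c|},\tfrac{\lambda_m(M_s)}{2J_s^*}\Big),$$ $$\epsilon_1^*=\min\Big(\tfrac{\pi^2I_w\eta_\phi c_\phi^2}{l|x_c|(4l\rho+\pi^2m_s)},\tfrac{2\pi^4\rho\eta_\omega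 c_\omega^2}{32l^4(2+|x_c|)\rho+8\pi^2l^3(2+|x_c|)m_s+\pi^4\rho\eta_\omega^2c_\omega^2}\Big),$$ $$\epsilon_2^*=\min\Big(\tfrac{\pi^4\rho\eta_\omega c_\omega^2}{4l^3|x_c|(4l\rho+\pi^2m_s)},\tfrac{2\pi^2I_w\eta_\phi c_\phi^2}{8l^2(2I_w^*+|x_c|\rho)+2\pi^2l(2J_s^*+|x_c|m_s)+\pi^2I_w\eta_\phi^2c_\phi^2}\Big).$$ Operators: $D(\mathcal{A})=D(\mathcal{A}_1)$ is the set of $(f,g,h,z,\zeta_\omega,\zeta_\phi)\in\mathcal{H}$ such that $g\in H_L^2(0,l)$, $z\in H_L^1(0,l)$, $f''+\eta_\omega g''\in H^2(0,l)$, $h'+\eta_\phi z'\in H^1(0,l)$, $(f''+\eta_\omega g'')(l)=0$, $\zeta_\omega=g(l)$, $\zeta_\phi=z(l)$, and $f,f',g,g',h,z,(f''+\eta_\omega g''),(f''+\eta_\omega g'')',(h'+\eta_\phi z')\in\mathrm{AC}[0,l]$. On it, $\mathcal{A}=\mathcal{A}_1+\mathcal{A}_2$, where $\mathcal{A}_1(f,g,h,z,\zeta_\omega,\zeta_\phi)=(g,\tilde g,z,\tilde z,\tilde\zeta_\omega,\tilde\zeta_\phi)$ with $$\begin{bmatrix}\tilde g\\ \tilde z\end{bmatrix}=-M^{-1}\begin{bmatrix}\rho c_\omega^2(f''+\eta_\omega g'')''\\ -I_wc_\phi^2(h'+\eta_\phi z')'\end{bmatrix},\qquad \begin{bmatrix}\tilde\zeta_\omega\\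 \tilde\zeta_\phi\end{bmatrix}=M_s^{-1}\begin{bmatrix}\rho c_\omega^2(f''+\eta_\omega g'')'(l)-k_1(g(l)+\epsilon_1f(l))\\ -I_wc_\phi^2(h'+\eta_\phi z')(l)-k_2(z(l)+\epsilon_2h(l))\end{bmatrix},$$ and $\mathcal{A}_2(f,g,h,z,\zeta_\omega,\zeta_\phi)=(0,\tilde F_a,0,\tilde M_a,0,0)$ with $$\begin{bmatrix}\tilde F_a\\ \tilde M_a\end{bmatrix}=M^{-1}\begin{bmatrix}\alpha_\omega h+\beta_\omega z+\gamma_\omega g\\ \alpha_\phi h+\beta_\phi z+\gamma_\phi g\end{bmatrix}.$$ When $0<\epsilon_i<\min(\epsilon_i^*,K_{m,i})$, $i=1,2$, the operator $\mathcal{A}$ generates a $C_0$-semigroup on $\mathcal{H}$, denoted $T(t)$; for $X_0\in D(\mathcal{A})$, $X(t)=T(t)X_0\in D(\mathcal{A})$ is the unique solution of $\dot X=\mathcal{A}X$, $X(0)=X_0$. Writing $X(t)=(\omega(\cdot,t),\omega_t(\cdot,t),\phi(\cdot,t),\phi_t(\cdot,t),\omega_t(l,t),\phi_t(l,t))$ (bending displacement $\omega$, twisting displacement $\phi$), the energy is $$E(t)=\tfrac12\int_0^l\Big(\rho c_\omega^2\omega_{yy}^2+I_wc_\phi^2\phi_y^2+\begin{bmatrix}\omega_t\\ \phi_t\end{bmatrix}^\top M\begin{bmatrix}\omega_t\\ \phi_t\end{bmatrix}\Big)dy+\tfrac12\begin{bmatrix}\omega_t(l,t)\\ \phi_t(l,t)\end{bmatrix}^\top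 M_s\begin{bmatrix}\omega_t(l,t)\\ \phi_t(l,t)\end{bmatrix}=\tfrac12\|X(t)\|_{\mathcal{H},1}^2.$$ Exponentially stable means $\|T(t)\|\le Ce^{-\delta t}$ for all $t\ge 0$, for some $C,\delta>0$. Structural assumption (S): $0<\epsilon_1<\min(\epsilon_1^*,K_{m,1})$, $0<\epsilon_2<\min(\epsilon_2^*,K_{m,2})$, and there exist $r_1,\dots,r_8>0$ such that the quantities $$\lambda_1=\epsilon_1\Big(1-\tfrac{\eta_\omega}{2r_1}-\tfrac{8l^4}{\pi^4\rho c_\omega^2}\big(\tfrac{\alpha_\omega}{r_4}+\tfrac{\beta_\omega}{r_5}+\tfrac{\gamma_\omega}{r_3}\big)\Big),$$ $$\lambda_2=\gamma_\omega+\tfrac{\alpha_\omega+\epsilon_2\gamma_\phi}{2r_6}+\tfrac{\epsilon_1\gamma_\omega r_3}{2}+\tfrac{\beta_\omega+\gamma_\phi}{2r_7}\ (\ge0),$$ $$\lambda_3=\rho\Big\{\eta_\omega c_\omega^2-\epsilon_2\tfrac{2l^3|x_c|}{\pi^2}\big(\tfrac{4l}{\pi^2}+\tfrac{m_s}{\rho}\big)-\epsilon_1\big(\tfrac{8l^4(2+|x_c|)}{\pi^4}+\tfrac{\eta_\omega c_\omega^2r_1}{2}+\tfrac{2l^3(2+|x_c|)m_s}{\pi^2\rho}\big)\Big\},$$ $$\lambda_4=\epsilon_2\big(1-\tfrac{\eta_\phi}{2r_2}\big)-\tfrac{4l^2}{\pi^2I_wc_\phi^2}\Big(\tfrac{(\alpha_\omega+\epsilon_2\gamma_\phi)r_6}{2}+\tfrac{\alpha_\phi+\epsilon_2\beta_\phi}{2r_8}+\tfrac{\epsilon_1\alpha_\omega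 r_4}{2}+\epsilon_2\alpha_\phi\Big),$$ $$\lambda_5=\beta_\phi+\tfrac{(\beta_\omega+\gamma_\phi)r_7}{2}+\tfrac{(\alpha_\phi+\epsilon_2\beta_\phi)r_8}{2}+\tfrac{\epsilon_1\beta_\omega r_5}{2}\ (\ge0),$$ $$\lambda_6=I_w\Big\{\eta_\phi c_\phi^2-\epsilon_1\tfrac{l|x_c|}{I_w}\big(\tfrac{2l\rho}{\pi^2}+\tfrac{m_s}{2}\big)-\epsilon_2\big(2l^2\tfrac{2I_w^*+|x_c|\rho}{\pi^2I_w}+\tfrac{\eta_\phi c_\phi^2r_2}{2}+\tfrac{l(2J_s^*+|x_c|m_s)}{2I_w}\big)\Big\}$$ satisfy $\lambda_1,\lambda_3,\lambda_4,\lambda_6>0$, $\mu_3=\pi^4\lambda_3/(16l^4)-\lambda_2>0$ and $\mu_6=\pi^2\lambda_6/(4l^2)-\lambda_5>0$. *)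

(* Defs.v *)
From HB Require Import structures.
From mathcomp Require Import all_boot all_order all_algebra generic_quotient.
From mathcomp Require Import all_classical all_reals all_analysis.
Import Order.TTheory GRing.Theory Num.Theory.
Import numFieldNormedType.Exports.

Set Implicit Arguments.
Unset Strict Implicit.
Unset Printing Implicit Defensive.

Local Open Scope classical_set_scope.
Local Open Scope ring_scope.
Local Open Scope quotient_scope.

(* The library has the L^p functions as a module [LfunType mu p1], but its
quotient by equality almost everywhere carries no module structure; it is
supplied here for p = 2. *)

Section Lebesgue2.
Context {d} {T : measurableType d} {R : realType}.
Variable mu : {measure set T -> \bar R}.

Definition fun2 := LfunType mu (lee1n 2).

Lemma fun2_addE (f g : fun2) x : (f + g) x = f x + g x. Proof. by []. Qed.

Lemma fun2_oppE (f : fun2) x : (- f) x = - f x. Proof. by []. Qed.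

Lemma fun2_scaleE a (f : fun2) x : (a *: f) x = a * f x. Proof. by []. Qed.

Definition fun2_ae (f g : fun2) := `[< f = g %[ae mu] >].

Lemma fun2_ae_equiv : equiv_class_of fun2_ae.
Proof.
split=> [f|f g|g f h].
- exact/asboolP/ae_eq_refl.
- by apply/idP/idP => /asboolP h; apply/asboolP/ae_eq_sym.
- by move=> /asboolP fg /asboolP gh; apply/asboolP/(ae_eq_trans fg gh).
Qed.

Canonical fun2_ae_equiv_rel := EquivRelPack fun2_ae_equiv.

Definition L2 : Type := {eq_quot fun2_ae}.

HB.instance Definition _ := Choice.on L2.
HB.instance Definition _ := EqQuotient.on L2.


Definition L2_zero : L2 := lift_cst L2 (0 : fun2).
Definition L2_add := lift_op2 L2 (+%R : fun2 -> fun2 -> fun2).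
Definition L2_opp := lift_op1 L2 (-%R : fun2 -> fun2).
Definition L2_scale (a : R) := lift_op1 L2 (fun f : fun2 => a *: f).

Lemma L2_reprK (f : fun2) : repr (\pi_L2 f) = f %[ae mu].
Proof. by apply/asboolP; rewrite -/(fun2_ae _ _) -eqmodE/= reprK. Qed.

Lemma L2_eqP (f g : fun2) : f = g %[ae mu] -> \pi_L2 f = \pi_L2 g.
Proof. by move=> fg; apply/eqmodP/asboolP. Qed.

Canonical pi_L2_zero := PiConst L2_zero.

Lemma pi_L2_add : {morph \pi_L2 : f g / f + g >-> L2_add f g}.
Proof.
move=> f g; unlock L2_add; apply: L2_eqP; apply: ae_eq_sym.
have := L2_reprK g; apply: filterS2 (L2_reprK f) => x fx gx I.
by rewrite !fun2_addE fx// gx.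
Qed.
Canonical pi_L2_add_morph := PiMorph2 pi_L2_add.

Lemma pi_L2_opp : {morph \pi_L2 : f / - f >-> L2_opp f}.
Proof.
move=> f; unlock L2_opp; apply: L2_eqP; apply: ae_eq_sym.
by apply: filterS (L2_reprK f) => x fx I; rewrite !fun2_oppE fx.
Qed.
Canonical pi_L2_opp_morph := PiMorph1 pi_L2_opp.

Lemma pi_L2_scale a : {morph \pi_L2 : f / a *: f >-> L2_scale a f}.
Proof.
move=> f; unlock L2_scale; apply: L2_eqP; apply: ae_eq_sym.
by apply: filterS (L2_reprK f) => x fx I; rewrite !fun2_scaleE fx.
Qed.
Canonical pi_L2_scale_morph a := PiMorph1 (pi_L2_scale a).

Lemma L2_addA : associative L2_add.
Proof.
move=> f g h; rewrite -[f]reprK -[g]reprK -[h]reprK.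
by rewrite -!pi_L2_add addrA.
Qed.

Lemma L2_addC : commutative L2_add.
Proof.
by move=> f g; rewrite -[f]reprK -[g]reprK -!pi_L2_add addrC.
Qed.

Lemma L2_add0 : left_id L2_zero L2_add.
Proof.
move=> f; rewrite -[f]reprK; unlock L2_zero.
by rewrite -!pi_L2_add add0r.
Qed.

Lemma L2_addN : left_inverse L2_zero L2_opp L2_add.
Proof.
move=> f; rewrite -[f]reprK; unlock L2_zero.
by rewrite -pi_L2_opp -!pi_L2_add addNr.
Qed.

HB.instance Definition _ :=
  GRing.isZmodule.Build L2 L2_addA L2_addC L2_add0 L2_addN.

Lemma L2_scaleA a b (f : L2) : L2_scale a (L2_scale b f) = L2_scale (a * b) f.
Proof. by rewrite -[f]reprK -!pi_L2_scale scalerA. Qed.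

Lemma L2_scale1 : left_id 1 L2_scale.
Proof. by move=> f; rewrite -[f]reprK -pi_L2_scale scale1r. Qed.

Lemma L2_scaleDr : right_distributive L2_scale +%R.
Proof.
move=> a f g; change (L2_scale a (L2_add f g) =
  L2_add (L2_scale a f) (L2_scale a g)).
rewrite -[f]reprK -[g]reprK -!pi_L2_add -!pi_L2_scale scalerDr.
exact: pi_L2_add.
Qed.

Lemma L2_scaleDl (f : L2) : {morph L2_scale^~ f : a b / a + b}.
Proof.
move=> a b; rewrite -[f]reprK -!pi_L2_scale scalerDl.
exact: pi_L2_add.
Qed.

HB.instance Definition _ := GRing.Zmodule_isLmodule.Build R L2
  L2_scaleA L2_scale1 L2_scaleDr L2_scaleDl.

(* Pointwise expressions in u involve an arbitrary representative. *)
Definition L2_fun (u : L2) : T -> R := repr u.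

End Lebesgue2.

Coercion L2_fun : L2 >-> Funclass.

Section Matrices.
Context {R : realType}.

Definition col2 (a b : R) : 'cV[R]_2 := \col_(i < 2) [:: a; b]`_i.

Definition mx2 (a b c d : R) : 'M[R]_2 :=
  \matrix_(i < 2, j < 2) (nth [::] [:: [:: a; b]; [:: c; d]] i)`_j.

Definition bilin (A : 'M[R]_2) (u v : 'cV[R]_2) : R := (u^T *m A *m v) 0 0.

(* [lambda_min] is only used for symmetric matrices, whose set of eigenvalues
   is finite and nonempty, so that the infimum is a minimum. *)
Definition lambda_min n (A : 'M[R]_n) : R := inf [set a | eigenvalue A a].

(* The product of [A] with the column whose entries are the vectors u and v. *)
Definition mx2_act (V : lmodType R) (A : 'M[R]_2) (u v : V) : V * V :=
  (A 0 0 *: u + A 0 1 *: v, A 1 0 *: u + A 1 1 *: v).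

End Matrices.

Section Sobolev.
Context {R : realType}.
Variable l : R.

Definition mu_itv : {measure set (measurableTypeR R) -> \bar R} :=
  mrestr (@lebesgue_measure R) (measurable_itv `]0, l[).

Local Notation L2_itv := (L2 mu_itv).

Definition test_function (phi : R -> R) : Prop :=
  (forall n x, derivable (derive1n n phi) x 1) /\
  (exists a b, [/\ 0 < a, b < l & forall x, phi x != 0 -> a <= x <= b]).

Definition is_weak_derivative (u v : L2_itv) : Prop :=
  forall phi, test_function phi ->
    \int[mu_itv]_x (u x * derive1 phi x) = - \int[mu_itv]_x (v x * phi x).

(* The weak derivative; meaningful when there is one in L^2, else 0. *)
Definition wD (u : L2_itv) : L2_itv := xget 0 [set v | is_weak_derivative u v].

Fixpoint sobolev (m : nat) (u : L2_itv) : Prop :=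
  if m is m'.+1 then (exists v, is_weak_derivative u v) /\ sobolev m' (wD u)
  else True.

Definition abs_continuous (f : R -> R) : Prop :=
  forall e, 0 < e -> exists2 d, 0 < d &
    forall n (a b : 'I_n -> R),
      (forall i, [/\ 0 <= a i, a i <= b i & b i <= l]) ->
      trivIset setT (fun i => `]a i, b i[%classic) ->
      \sum_i (b i - a i) < d -> \sum_i `|f (b i) - f (a i)| < e.

Definition is_AC_rep (u : L2_itv) (w : R -> R) : Prop :=
  abs_continuous w /\ w = u %[ae mu_itv].

Definition AC (u : L2_itv) : Prop := exists w, is_AC_rep u w.

(* The absolutely continuous representative, determined on [0, l] only; by
   convention the zero function if there is none. *)
Definition AC_rep (u : L2_itv) : R -> R := xget (cst 0) [set w | is_AC_rep u w].

Definition sobolevL (m : nat) (u : L2_itv) : Prop :=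
  sobolev m u /\ forall k, (k < m)%N -> AC_rep (iter k wD u) 0 = 0.

End Sobolev.

(* The space is a linear subspace [H] of a module, with a norm [N] on it; the
   operators [T t] are constrained only on [H] and for t >= 0. *)

Section Semigroups.
Context {R : realType} {V : lmodType R}.
Variables (H : set V) (N : V -> R).

Record C0_semigroup (T : R -> V -> V) : Prop := {
  semigroup_stable : forall (t : R) x, 0 <= t -> H x -> H (T t x) ;
  semigroup_linear : forall (t a : R) x y, 0 <= t -> H x -> H y ->
    T t (a *: x + y) = a *: T t x + T t y ;
  semigroup_bounded : forall t : R, 0 <= t ->
    exists C, forall x, H x -> N (T t x) <= C * N x ;
  semigroup0 : forall x, H x -> T 0 x = x ;
  semigroupD : forall (s t : R) x, 0 <= s -> 0 <= t -> H x ->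
    T (s + t) x = T s (T t x) ;
  semigroup_cvg : forall x, H x -> N (T t x - x) @[t --> 0^'+] --> (0 : R) }.

(* The operator [A], with domain [DA], is the infinitesimal generator of [T]:
   the two sides are the graphs of [A] and of the generator. *)
Definition generates (DA : set V) (A : V -> V) (T : R -> V -> V) : Prop :=
  C0_semigroup T /\
  forall x y, (DA x /\ y = A x) <->
    [/\ H x, H y & N (t^-1 *: (T t x - x) - y) @[t --> 0^'+] --> (0 : R)].

(* The bound on the operator norm, written out pointwise. *)
Definition exponentially_stable (T : R -> V -> V) : Prop :=
  exists C delta, [/\ 0 < C, 0 < delta & forall (t : R) x, 0 <= t -> H x ->
    N (T t x) <= C * expR (- delta * t) * N x].

End Semigroups.

(* The suffixes [_w] and [_p] stand for the indices omega (bending) and phi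
(twisting). *)

Record parameters (R : realType) := MkParameters {
  len : R ; rho : R ; Iw : R ; ms : R ; Js : R ; xc : R ;
  c_w : R ; c_p : R ; eta_w : R ; eta_p : R ;
  k1 : R ; k2 : R ; eps1 : R ; eps2 : R ;
  alpha_w : R ; beta_w : R ; gamma_w : R ;
  alpha_p : R ; beta_p : R ; gamma_p : R }.

Section Model.
Context {R : realType}.
Variable P : parameters R.

Local Notation l := (len P).
Local Notation rho := (rho P).
Local Notation Iw := (Iw P).
Local Notation ms := (ms P).
Local Notation Js := (Js P).
Local Notation xc := (xc P).
Local Notation c_w := (c_w P).
Local Notation c_p := (c_p P).
Local Notation eta_w := (eta_w P).
Local Notation eta_p := (eta_p P).
Local Notation k1 := (k1 P).
Local Notation k2 := (k2 P).
Local Notation eps1 := (eps1 P).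
Local Notation eps2 := (eps2 P).
Local Notation alpha_w := (alpha_w P).
Local Notation beta_w := (beta_w P).
Local Notation gamma_w := (gamma_w P).
Local Notation alpha_p := (alpha_p P).
Local Notation beta_p := (beta_p P).
Local Notation gamma_p := (gamma_p P).
Local Notation pi := (pi : R).

Definition standing_assumptions : Prop :=
  [/\ [/\ 0 < l, 0 < rho, 0 < Iw, 0 < ms & 0 < Js],
      [/\ 0 < c_w, 0 < c_p, 0 < eta_w & 0 < eta_p],
      [/\ 0 < k1, 0 < k2, 0 < eps1 & 0 < eps2],
      [/\ 0 <= alpha_w, 0 <= beta_w & 0 <= gamma_w] &
      [/\ 0 <= alpha_p, 0 <= beta_p & 0 <= gamma_p]].

Definition Iws : R := Iw + rho * xc ^+ 2.
Definition Jss : R := Js + ms * xc ^+ 2.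
Definition M : 'M[R]_2 := mx2 rho (rho * xc) (rho * xc) Iws.
Definition Ms : 'M[R]_2 := mx2 ms (ms * xc) (ms * xc) Jss.

Local Notation L2l := (L2 (mu_itv l)).

(* (f, g, h, z, zeta_omega, zeta_phi) *)
Definition state : Type := (L2l * L2l * L2l * L2l * R^o * R^o)%type.

Definition Hspace : set state := [set X |
  let: (f, g, h, z, zw, zp) := X in sobolevL 2 f /\ sobolevL 1 h].

Definition inner1 (X1 X2 : state) : R :=
  let: (f1, g1, h1, z1, zw1, zp1) := X1 in
  let: (f2, g2, h2, z2, zw2, zp2) := X2 in
  \int[mu_itv l]_y (rho * c_w ^+ 2 * wD (wD f1) y * wD (wD f2) y
                    + Iw * c_p ^+ 2 * wD h1 y * wD h2 y)
  + \int[mu_itv l]_y bilin M (col2 (g1 y) (z1 y)) (col2 (g2 y) (z2 y))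
  + bilin Ms (col2 zw1 zp1) (col2 zw2 zp2).

Definition Psi (X1 X2 : state) : R :=
  let: (f1, g1, h1, z1, zw1, zp1) := X1 in
  let: (f2, g2, h2, z2, zw2, zp2) := X2 in
  \int[mu_itv l]_y
    (bilin M (col2 (g1 y) (z1 y)) (col2 (eps1 * f2 y) (eps2 * h2 y))
     + bilin M (col2 (g2 y) (z2 y)) (col2 (eps1 * f1 y) (eps2 * h1 y)))
  + bilin Ms (col2 zw1 zp1) (col2 (eps1 * AC_rep f2 l) (eps2 * AC_rep h2 l))
  + bilin Ms (col2 zw2 zp2) (col2 (eps1 * AC_rep f1 l) (eps2 * AC_rep h1 l)).

Definition inner2 (X1 X2 : state) : R := inner1 X1 X2 + Psi X1 X2.

Definition norm1 (X : state) : R := Num.sqrt (inner1 X X).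
Definition norm2 (X : state) : R := Num.sqrt (inner2 X X).

Definition energy (X : state) : R := 2^-1 * norm1 X ^+ 2.
Definition aug_energy (X : state) : R := 2^-1 * norm2 X ^+ 2.

Definition bend (f g : L2l) : L2l := wD (wD f) + eta_w *: wD (wD g).
Definition twist (h z : L2l) : L2l := wD h + eta_p *: wD z.

Definition domA : set state := [set X |
  let: (f, g, h, z, zw, zp) := X in
  Hspace X /\
  [/\ sobolevL 2 g, sobolevL 1 z, sobolev 2 (bend f g), sobolev 1 (twist h z)
    & AC_rep (bend f g) l = 0] /\
  [/\ zw = AC_rep g l & zp = AC_rep z l] /\
  [/\ AC f, AC (wD f), AC g & AC (wD g)] /\
  [/\ AC h, AC z, AC (bend f g), AC (wD (bend f g)) & AC (twist h z)]].

Definition opA1 (X : state) : state :=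
  let: (f, g, h, z, zw, zp) := X in
  let gz := mx2_act (- invmx M)
    (rho * c_w ^+ 2 *: wD (wD (bend f g)))
    (- (Iw * c_p ^+ 2) *: wD (twist h z)) in
  let zeta := invmx Ms *m col2
    (rho * c_w ^+ 2 * AC_rep (wD (bend f g)) l
     - k1 * (AC_rep g l + eps1 * AC_rep f l))
    (- (Iw * c_p ^+ 2 * AC_rep (twist h z) l)
     - k2 * (AC_rep z l + eps2 * AC_rep h l)) in
  (g, gz.1, z, gz.2, zeta 0 0, zeta 1 0).

Definition opA2 (X : state) : state :=
  let: (f, g, h, z, zw, zp) := X in
  let FM := mx2_act (invmx M)
    (alpha_w *: h + beta_w *: z + gamma_w *: g)
    (alpha_p *: h + beta_p *: z + gamma_p *: g) in
  (0, FM.1, 0, FM.2, 0, 0).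

Definition opA (X : state) : state := opA1 X + opA2 X.

(* Quotient with the convention a / 0 = +oo: under the standing assumptions a
   denominator below vanishes only if it has |xc| as a factor and xc = 0. *)
Definition ediv (a b : R) : \bar R := if b == 0 then +oo%E else (a / b)%:E.

Definition Km1 : \bar R := \big[Order.min/+oo%E]_(q <- [::
  ediv (pi ^+ 4 * rho * c_w ^+ 2)
       (4 * l ^+ 3 * (1 + `|xc|)
        * (4 * l * rho `^ (3 / 2) * c_w + pi ^+ 2 * ms)) ;
  ediv (c_w * lambda_min M) (2 * Num.sqrt rho) ;
  ediv (c_w * lambda_min M) (2 * Num.sqrt rho * `|xc|) ;
  ediv (lambda_min Ms) (2 * ms) ;
  ediv (lambda_min Ms) (2 * ms * `|xc|)]) q.

Definition Km2 : \bar R := \big[Order.min/+oo%E]_(q <- [::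
  ediv (pi ^+ 2 * Iw * c_p ^+ 2)
       (4 * l ^+ 2 * (Iws + rho * `|xc|) * Num.sqrt Iw * c_p
        + pi ^+ 2 * l * (Jss + ms * `|xc|)) ;
  ediv (Num.sqrt Iw * c_p * lambda_min M) (2 * rho * `|xc|) ;
  ediv (Num.sqrt Iw * c_p * lambda_min M) (2 * Iws) ;
  ediv (lambda_min Ms) (2 * ms * `|xc|) ;
  ediv (lambda_min Ms) (2 * Jss)]) q.

Definition eps1_star : \bar R := Order.min
  (ediv (pi ^+ 2 * Iw * eta_p * c_p ^+ 2)
        (l * `|xc| * (4 * l * rho + pi ^+ 2 * ms)))
  (ediv (2 * pi ^+ 4 * rho * eta_w * c_w ^+ 2)
        (32 * l ^+ 4 * (2 + `|xc|) * rho
         + 8 * pi ^+ 2 * l ^+ 3 * (2 + `|xc|) * ms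
         + pi ^+ 4 * rho * eta_w ^+ 2 * c_w ^+ 2)).

Definition eps2_star : \bar R := Order.min
  (ediv (pi ^+ 4 * rho * eta_w * c_w ^+ 2)
        (4 * l ^+ 3 * `|xc| * (4 * l * rho + pi ^+ 2 * ms)))
  (ediv (2 * pi ^+ 2 * Iw * eta_p * c_p ^+ 2)
        (8 * l ^+ 2 * (2 * Iws + `|xc| * rho)
         + 2 * pi ^+ 2 * l * (2 * Jss + `|xc| * ms)
         + pi ^+ 2 * Iw * eta_p ^+ 2 * c_p ^+ 2)).

Definition lambda1 (r1 r3 r4 r5 : R) : R :=
  eps1 * (1 - eta_w / (2 * r1)
          - 8 * l ^+ 4 / (pi ^+ 4 * rho * c_w ^+ 2)
            * (alpha_w / r4 + beta_w / r5 + gamma_w / r3)).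

Definition lambda2 (r3 r6 r7 : R) : R :=
  gamma_w + (alpha_w + eps2 * gamma_p) / (2 * r6) + eps1 * gamma_w * r3 / 2
  + (beta_w + gamma_p) / (2 * r7).

Definition lambda3 (r1 : R) : R :=
  rho * (eta_w * c_w ^+ 2
         - eps2 * (2 * l ^+ 3 * `|xc| / pi ^+ 2)
           * (4 * l / pi ^+ 2 + ms / rho)
         - eps1 * (8 * l ^+ 4 * (2 + `|xc|) / pi ^+ 4
                   + eta_w * c_w ^+ 2 * r1 / 2
                   + 2 * l ^+ 3 * (2 + `|xc|) * ms / (pi ^+ 2 * rho))).

Definition lambda4 (r2 r4 r6 r8 : R) : R :=
  eps2 * (1 - eta_p / (2 * r2))
  - 4 * l ^+ 2 / (pi ^+ 2 * Iw * c_p ^+ 2)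
    * ((alpha_w + eps2 * gamma_p) * r6 / 2
       + (alpha_p + eps2 * beta_p) / (2 * r8)
       + eps1 * alpha_w * r4 / 2 + eps2 * alpha_p).

Definition lambda5 (r5 r7 r8 : R) : R :=
  beta_p + (beta_w + gamma_p) * r7 / 2 + (alpha_p + eps2 * beta_p) * r8 / 2
  + eps1 * beta_w * r5 / 2.

Definition lambda6 (r2 : R) : R :=
  Iw * (eta_p * c_p ^+ 2
        - eps1 * (l * `|xc| / Iw) * (2 * l * rho / pi ^+ 2 + ms / 2)
        - eps2 * (2 * l ^+ 2 * ((2 * Iws + `|xc| * rho) / (pi ^+ 2 * Iw))
                  + eta_p * c_p ^+ 2 * r2 / 2
                  + l * (2 * Jss + `|xc| * ms) / (2 * Iw))).

Definition structural_assumption : Prop :=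
  [/\ 0 < eps1, (eps1%:E < Order.min eps1_star Km1)%E,
      0 < eps2, (eps2%:E < Order.min eps2_star Km2)%E &
   exists r1 r2 r3 r4 r5 r6 r7 r8 : R,
   [/\ [/\ 0 < r1, 0 < r2, 0 < r3 & 0 < r4],
       [/\ 0 < r5, 0 < r6, 0 < r7 & 0 < r8],
       [/\ 0 < lambda1 r1 r3 r4 r5, 0 < lambda3 r1,
           0 < lambda4 r2 r4 r6 r8 & 0 < lambda6 r2],
       0 < pi ^+ 4 * lambda3 r1 / (16 * l ^+ 4) - lambda2 r3 r6 r7 &
       0 < pi ^+ 2 * lambda6 r2 / (4 * l ^+ 2) - lambda5 r5 r7 r8]].

End Model.

Arguments Hspace {R} P.
Arguments domA {R} P.
Arguments opA {R} P.
Arguments norm1 {R} P.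
Arguments norm2 {R} P.

(* Main.v *)
(* Testing the generator against the state in the augmented inner product,
integrating by parts and bounding the products by Young's, Wirtinger's and the
trace inequalities gives B (A X) X <= - w * B X X on the domain, with w > 0 by the
structural assumption.  The map t |-> B (T t X) (T t X) has the right derivative
2 * B (A (T t X)) (T t X), and is left continuous because Baire's argument bounds
[T] uniformly on compact subintervals of ]0, +oo[, so that it decays like
exp (- 2 w t).  The thresholds Km1 and Km2 make both norms equivalent to the same
sum of squares, which transfers the decay to the energy; as the test functions are
dense in L^2(0, l), the domain is dense, and the estimate extends to the whole
space.

Wirtinger's inequality with the sharp constant 4 l^2 / pi^2 comes from the Riccati
function k tan (k (l - x)), k < pi / (2 l).  The weak derivative is unique and
u = u(0) + int u' because u minus the primitive of u' is orthogonal to the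
derivatives of all test functions. *)

(* The energy form alone dissipates only the strain rates g'' and z': its derivative along the flow
   has no negative multiple of |f''|^2 or |h'|^2. The cross term [Psi] pairs each velocity with eps
   times a displacement, so that the equations are also tested against the displacements, which
   supplies the missing - eps |f''|^2 and - eps |h'|^2. The price is a number of indefinite
   products; Km1 and Km2 keep the form comparable with the energy, and the positive numbers of (S)
   say what is left of the dissipation once these products are absorbed.

   On the semigroup side, each [T t] is bounded separately and continuity is known only at 0+. Left
   continuity of an orbit at t compares [T s] with [T t] for s < t and so requires a bound uniform
   in s. That bound is drawn from the completeness of the time axis, by nested intervals, and not
   from completeness of the state space.

   Identities for weak derivatives are bounded bilinear identities, checked on test functions and
   extended by density. *)
From HB Require Import structures.
From mathcomp Require Import all_boot all_order all_algebra generic_quotient.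
From mathcomp Require Import all_classical all_reals all_analysis.
From mathcomp Require Import ring lra measurable_realfun.
Import Order.TTheory GRing.Theory Num.Theory.
Import numFieldNormedType.Exports.
Require Import Defs.
Set Implicit Arguments.
Unset Strict Implicit.
Unset Printing Implicit Defensive.
Local Open Scope classical_set_scope.
Local Open Scope ring_scope.
Local Open Scope quotient_scope.

(** * Semigroups with a dissipative generator *)

Section RightDerivative.
Context {R : realType}.
Implicit Types (u g : R -> R).

(** The upper right Dini derivative is nonpositive. The set of times at which u lies below a line of
    slope c > 0 contains its supremum by left continuity, and the right estimate would carry a
    supremum smaller than t further. *)
Lemma right_noninc u :
  (forall t e, 0 <= t -> 0 < e -> exists2 d, 0 < d &
     forall h, 0 < h < d -> u (t + h) <= u t + e * h) ->
  (forall t, 0 < t -> u x @[x --> t^'-] --> u t) ->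
  forall t, 0 <= t -> u t <= u 0.
Proof.
move=> right_le left_cvg t t0; apply/ler_addgt0Pr => e e0.
have [->|tN0] := eqVneq t 0; first by lra.
have {tN0 t0}t0 : 0 < t by rewrite lt_neqAle eq_sym tN0.
(* This slope makes the total slack at time t equal to e. *)
pose c := e / t; have c0 : 0 < c by rewrite divr_gt0.
pose S := [set s | 0 <= s <= t /\ u s <= u 0 + c * s].
have S0 : S 0 by split; [lra|rewrite mulr0 addr0].
have S_sup : has_sup S.
  by split; [exists 0|exists t => s [/andP[]]].
pose m := sup S.
have m_ge s : S s -> s <= m by move=> Ss; apply: sup_upper_bound.
have m0 : 0 <= m by exact: m_ge.
have mt : m <= t by apply: ge_sup; [exists 0|move=> s [/andP[]]].
have Sm : S m.
  split; first by apply/andP.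
  have [->|mN0] := eqVneq m 0; first by rewrite mulr0 addr0.
  have {mN0 m0}m0 : 0 < m by rewrite lt_neqAle eq_sym mN0.
  apply/ler_addgt0Pr => e' e'0.
  have /cvgrPdist_lt /(_ e' e'0) := left_cvg _ m0.
  rewrite near_withinE near_simpl => /nbhs_ballP[d /= d0 near_m].
  have [s Ss ms] := sup_adherent d0 S_sup.
  have := m_ge _ Ss; rewrite le_eqVlt => /orP[/eqP <-|sm].
    by case: Ss => _; lra.
  have := near_m s; rewrite /ball /= gtr0_norm; last by lra.
  rewrite -/m in ms => /(_ _ sm); case: Ss => _ us.
  have cs : c * s <= c * m by rewrite ler_pM2l// ltW.
  by move=> /(_ ltac:(lra)); rewrite ltr_norml; lra.
move: mt; rewrite le_eqVlt => /orP[/eqP mt|mt].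
  by case: Sm => _; rewrite mt /c divfK// gt_eqF.
have [d d0 /(_ (Num.min (d / 2) (t - m))) dP] := right_le _ _ m0 c0.
set h := Num.min _ _ in dP.
have [h0 hd hm] : [/\ 0 < h, h < d & h <= t - m].
  split; first by rewrite lt_min; lra.
  - by rewrite gt_min; lra.
  - by rewrite ge_min lexx orbT.
suff /m_ge : S (m + h) by lra.
split; first lra.
have {}dP := dP ltac:(lra).
by case: Sm => _ um; rewrite mulrDr; lra.
Qed.

(** The product of g with exp (a t) has nonpositive right derivative, because 1 - a h <= exp (- a
    h). *)
Lemma right_decay g a : 0 < a -> (forall t, 0 <= t -> 0 <= g t) ->
  (forall t e, 0 <= t -> 0 < e -> exists2 d, 0 < d &
     forall h, 0 < h < d -> g (t + h) <= g t - a * g t * h + e * h) ->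
  (forall t, 0 < t -> g x @[x --> t^'-] --> g t) ->
  forall t, 0 <= t -> g t <= g 0 * expR (- a * t).
Proof.
move=> a0 g0 right_le left_cvg t t0.
suff: g t * expR (a * t) <= g 0 * expR (a * 0).
  by rewrite mulr0 expR0 mulr1 mulNr expRN -ler_pdivlMr ?invr_gt0 ?expR_gt0// invrK.
apply: (@right_noninc (fun s => g s * expR (a * s))) => // {t0}{}t.
  (* [E] bounds the exponential factor for h <= 1, so that a slack e / E for g becomes a slack e for
     the product. *)
  move=> e t0 e0; pose E := expR (a * (t + 1)).
  have E0 : 0 < E := expR_gt0 _.
  have [d d0 dP] := right_le t (e / E) t0 (divr_gt0 e0 E0).
  exists (Num.min d 1); first by rewrite lt_min d0 ltr01.
  move=> h /andP[h0]; rewrite lt_min => /andP[hd h1].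
  have := dP h; rewrite h0 hd => /(_ isT) gh.
  have le_E : expR (a * (t + h)) <= E by rewrite ler_expR ler_pM2l//; lra.
  apply: (@le_trans _ _ ((g t * (1 - a * h) + e / E * h) * expR (a * (t + h)))).
    by rewrite ler_pM2r ?expR_gt0//; lra.
  rewrite mulrDl; apply: lerD.
    rewrite -mulrA ler_wpM2l ?g0// mulrDr expRD mulrCA -[leRHS]mulr1.
    rewrite ler_pM2l ?expR_gt0// -ler_pdivlMr ?expR_gt0// mul1r -expRN.
    by have := expR_ge1Dx (- (a * h)); lra.
  rewrite mulrAC ler_pM2r// -mulrA -[leRHS]mulr1 ler_pM2l//.
  by rewrite mulrC ler_pdivrMr// mul1r.
move=> t0; apply: cvgM; first exact: left_cvg.
apply: cvg_at_left_filter; apply: (@continuous_comp _ _ _ (fun x => a * x) expR).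
  exact: mulrl_continuous.
exact: continuous_expR.
Qed.

End RightDerivative.

(** * Semi-inner products on a subspace *)

Section SemiInner.
Context {R : realType} {V : lmodType R}.
Variables (H : set V) (B : V -> V -> R).

(** The laws are restricted to H because [inner2] is linear only where the weak derivatives exist:
    elsewhere [wD] and [AC_rep] may take default values. *)
Record semi_inner : Prop := {
  sub0 : H 0 ;
  sub_lin : forall a x y, H x -> H y -> H (a *: x + y) ;
  form_lin : forall a x y z, H x -> H y -> H z ->
    B (a *: x + y) z = a * B x z + B y z ;
  form_sym : forall x y, H x -> H y -> B x y = B y x ;
  form_ge0 : forall x, H x -> 0 <= B x x }.

Hypothesis B_inner : semi_inner.

Definition form_norm x := Num.sqrt (B x x).

Lemma subZ a x : H x -> H (a *: x).
Proof. by move=> Hx; rewrite -[_ *: _]addr0; apply: sub_lin => //; apply: sub0. Qed.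

Lemma subD x y : H x -> H y -> H (x + y).
Proof. by rewrite -{2}[x]scale1r; exact: sub_lin. Qed.

Lemma subB x y : H x -> H y -> H (x - y).
Proof. by move=> Hx Hy; rewrite addrC -scaleN1r; exact: sub_lin. Qed.

Lemma form_addl x y z : H x -> H y -> H z -> B (x + y) z = B x z + B y z.
Proof. by move=> ? ? ?; rewrite -[x]scale1r form_lin// scale1r mul1r. Qed.

Lemma form0l z : H z -> B 0 z = 0.
Proof.
move=> Hz; have H0 := sub0 B_inner; have := form_addl H0 H0 Hz.
by rewrite addr0 => e; lra.
Qed.

Lemma form_scalel a x z : H x -> H z -> B (a *: x) z = a * B x z.
Proof.
move=> ? ?; have H0 := sub0 B_inner.
by rewrite -[_ *: _]addr0 form_lin// form0l// addr0.
Qed.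

Lemma form_sqr a x y : H x -> H y ->
  B (a *: x + y) (a *: x + y) = a ^+ 2 * B x x + 2 * a * B x y + B y y.
Proof.
move=> Hx Hy; have Hxy := sub_lin B_inner a Hx Hy.
rewrite form_lin// (form_sym B_inner Hx)// (form_sym B_inner Hy)// !form_lin//.
by rewrite (form_sym B_inner Hy Hx); ring.
Qed.

Lemma form_norm_ge0 x : 0 <= form_norm x. Proof. exact: sqrtr_ge0. Qed.

Lemma form_norm_sqr x : H x -> form_norm x ^+ 2 = B x x.
Proof. by move=> Hx; rewrite sqr_sqrtr// form_ge0. Qed.

Lemma form_CS x y : H x -> H y -> B x y <= form_norm x * form_norm y.
Proof.
move=> Hx Hy; rewrite -sqrtrM ?form_ge0//.
apply: le_trans (ler_norm _) _; rewrite -sqrtr_sqr; apply: ler_wsqrtr.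
have := form_ge0 B_inner Hx; rewrite le_eqVlt => /orP[/eqP Bx0|Bx0].
  have [->|Bxy0] := eqVneq (B x y) 0; first by rewrite expr0n -Bx0 mul0r.
  (* If x has length 0 but B x y does not vanish, this combination of x and y would have squared
     length -1. *)
  have := form_ge0 B_inner (sub_lin B_inner (- ((B y y + 1) / (2 * B x y))) Hx Hy).
  rewrite form_sqr// -Bx0 mulr0 add0r.
  rewrite (_ : 2 * _ * _ = - (B y y + 1)); last by field.
  lra.
have := form_ge0 B_inner (sub_lin B_inner (- (B x y / B x x)) Hx Hy).
rewrite form_sqr// (_ : _ + _ + _ = (B x x * B y y - B x y ^+ 2) / B x x).
  by rewrite pmulr_lge0 ?invr_gt0// subr_ge0.
by field; rewrite gt_eqF.
Qed.

Lemma form_normD x y : H x -> H y ->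
  form_norm (x + y) <= form_norm x + form_norm y.
Proof.
move=> Hx Hy; rewrite -(@ler_pXn2r _ 2) ?nnegrE ?addr_ge0 ?form_norm_ge0//.
rewrite form_norm_sqr; last exact: subD.
rewrite -[x]scale1r form_sqr// scale1r sqrrD !form_norm_sqr//.
by have := form_CS Hx Hy; lra.
Qed.

Lemma form_normZ a x : H x -> form_norm (a *: x) = `|a| * form_norm x.
Proof.
move=> Hx; rewrite /form_norm form_scalel//; last exact: subZ.
rewrite (form_sym B_inner Hx); last exact: subZ.
by rewrite form_scalel// mulrA -expr2 sqrtrM ?sqr_ge0// sqrtr_sqr.
Qed.

Lemma form_normN x y : H x -> H y -> form_norm (x - y) = form_norm (y - x).
Proof.
move=> Hx Hy; rewrite -(opprB y x) -[- (y - x)]scaleN1r form_normZ ?normrN1 ?mul1r//.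
exact: subB.
Qed.

Lemma form_norm_dist x y : H x -> H y ->
  `|form_norm x - form_norm y| <= form_norm (x - y).
Proof.
move=> Hx Hy; have Hxy := subB Hx Hy; have Hyx := subB Hy Hx.
rewrite ler_norml; have := form_normD Hxy Hy; have := form_normD Hyx Hx.
by rewrite !subrK (form_normN Hy Hx); lra.
Qed.

End SemiInner.

(** * Decay of orbits under a form whose norm is equivalent to [N] *)

Section SemigroupDecay.
Context {R : realType} {V : lmodType R}.
Variables (H : set V) (N : V -> R) (B : V -> V -> R) (c C : R).
Variables (D : set V) (A : V -> V) (T : R -> V -> V).
Hypothesis B_inner : semi_inner H B.
Hypotheses (N_ge0 : forall x, 0 <= N x) (c_gt0 : 0 < c) (C_gt0 : 0 < C).
Hypothesis N_le : forall x, H x -> c * N x <= form_norm B x.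
Hypothesis N_ge : forall x, H x -> form_norm B x <= C * N x.
Hypothesis T_gen : generates H N D A T.

Local Notation n := (form_norm B).
Let T_C0 : C0_semigroup H N T := T_gen.1.
Let T_H t x : 0 <= t -> H x -> H (T t x) := @semigroup_stable _ _ _ _ _ T_C0 t x.

(** The semigroup laws speak of [N], the estimates of the form norm; limits at 0+ are transferred
    between the two by the equivalence constants. *)
Lemma norm_cvg0P (f : R -> V) : (forall t, 0 < t -> H (f t)) ->
  (N (f t) @[t --> 0^'+] --> (0 : R)) <->
  (forall e, 0 < e -> exists2 d, 0 < d & forall t, 0 < t < d -> n (f t) < e).
Proof.
move=> Hf; split=> [/cvgrPdist_lt f_cvg e e0|f_cvg].
  have := f_cvg (e / C) (divr_gt0 e0 C_gt0).
  rewrite near_withinE near_simpl => /nbhs_ballP[d /= d0 near0].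
  exists d => // t /andP[t0 td]; have := near0 t.
  rewrite /ball /= sub0r normrN gtr0_norm// => /(_ td t0).
  rewrite sub0r normrN ger0_norm// ltr_pdivlMr// mulrC.
  exact/le_lt_trans/N_ge/Hf.
apply/cvgrPdist_lt => e e0; have [d d0 dP] := f_cvg _ (mulr_gt0 c_gt0 e0).
rewrite near_withinE near_simpl; apply/nbhs_ballP; exists d => //= t.
rewrite /ball /= sub0r normrN => td t0; rewrite gtr0_norm// in td.
rewrite sub0r normrN ger0_norm// -(ltr_pM2l c_gt0).
by apply: le_lt_trans (N_le (Hf _ t0)) (dP _ _); rewrite t0.
Qed.

Lemma T_sub t x y : 0 <= t -> H x -> H y -> T t (x - y) = T t x - T t y.
Proof.
move=> t0 Hx Hy; rewrite addrC -scaleN1r (semigroup_linear T_C0)//.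
by rewrite scaleN1r addrC.
Qed.

Lemma T_scale t a x : 0 <= t -> H x -> T t (a *: x) = a *: T t x.
Proof.
move=> t0 Hx; have H0 := sub0 B_inner; have T0 := T_sub t0 H0 H0.
by rewrite -[a *: x]addr0 (semigroup_linear T_C0)// -(subrr 0) T0 subrr addr0.
Qed.

Lemma T_orbit_cvg x e : H x -> 0 < e ->
  exists2 d, 0 < d & forall h, 0 < h < d -> n (T h x - x) < e.
Proof.
move=> Hx; have Hd t : 0 < t -> H (T t x - x).
  by move=> t0; apply: (subB B_inner) => //; apply: T_H => //; exact: ltW.
by have [cvgP _] := norm_cvg0P Hd; apply: cvgP; exact: (semigroup_cvg T_C0).
Qed.

Lemma T_bounded t : 0 <= t ->
  exists2 K, 1 <= K & forall x, H x -> n (T t x) <= K * n x.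
Proof.
move=> t0; have [K0 KP] := semigroup_bounded T_C0 t0.
exists (1 + C * `|K0| / c).
  by rewrite lerDl divr_ge0 ?mulr_ge0 ?normr_ge0// ltW.
move=> x Hx; apply: le_trans (N_ge (T_H t0 Hx)) _.
apply: (@le_trans _ _ (C * (`|K0| * N x))).
  rewrite ler_pM2l//; apply: le_trans (KP _ Hx) _.
  by rewrite ler_wpM2r// ler_norm.
rewrite mulrDl mul1r; apply: ler_wpDl; first exact: form_norm_ge0.
rewrite -!mulrA ler_pM2l//; apply: ler_wpM2l => //.
by rewrite ler_pdivlMl// N_le.
Qed.

(* Baire's argument: the orbits being right continuous, if the operators were
   unbounded on every interval, nested intervals would yield a time [s] at which
   [T s] is unbounded. *)
Lemma T_bounded_somewhere d : 0 < d -> exists a b K : R,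
  [/\ 0 < a, a < b, b < d &
    forall t x, a <= t < b -> H x -> n (T t x) <= K * n x].
Proof.
move=> d0; apply: contrapT => unbounded.
pose ok (p : R * R) := [/\ 0 < p.1, p.1 < p.2 & p.2 < d].
pose big k (q : R * R) := exists2 x, H x &
  forall s, q.1 <= s <= q.2 -> k%:R * n x < n (T s x).
have step (kp : nat * (R * R)) : exists q, ok kp.2 ->
    [/\ ok q, kp.2.1 <= q.1, q.2 <= kp.2.2 & big kp.1 q].
  case: kp => k [a b] /=.
  have [[a0 ab bd]|] := pselect (ok (a, b)); last by exists (0, 0).
  have [t [x [/andP[ta tb] Hx nx]]] : exists t x,
      [/\ a <= t < b, H x & k%:R * n x < n (T t x)].
    apply: contrapT => none; apply: unbounded; exists a, b, k%:R; split=> //.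
    move=> t x tab Hx; rewrite leNgt; apply/negP => ?; apply: none.
    by exists t, x.
  have t0 : 0 < t by apply: lt_le_trans ta.
  have Hy := T_H (ltW t0) Hx.
  (* The excess over the bound persists, by right continuity of the orbit through [T t x], on a
     whole closed interval to the right of t. *)
  have e0 : 0 < n (T t x) - k%:R * n x by lra.
  have [d1 d10 dP] := T_orbit_cvg Hy e0.
  pose m := Num.min (d1 / 2) ((b - t) / 2); exists (t, t + m) => _ /=.
  have [m0 m1 m2] : [/\ 0 < m, m <= d1 / 2 & m <= (b - t) / 2].
    by split; [rewrite lt_min; lra|rewrite ge_min lexx..]; rewrite ?orbT.
  move: m m0 m1 m2 => m m0 m1 m2; simpl in *.
  split=> //; first by split=> /=; lra.
    by lra.
  exists x => //= s /andP[ts st].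
  have [->//|tNs] := eqVneq s t.
  have {}ts : t < s by rewrite lt_neqAle eq_sym tNs.
  have := dP (s - t) ltac:(lra).
  rewrite -(semigroupD T_C0) ?subrK ?subr_ge0 ?ltW//.
  have Hs : H (T s x) by apply: T_H => //; lra.
  by have := form_norm_dist B_inner Hs Hy; rewrite ler_norml; lra.
have [f fP] := choice step.
pose q := fix q k := if k is k'.+1 then f (k, q k') else (d / 3, d / 2).
have q_ok k : ok (q k).
  elim: k => [|k IH]; first by split=> /=; lra.
  by case: (fP (k.+1, q k) IH).
have q_mono k : [/\ (q k).1 <= (q k.+1).1, (q k.+1).2 <= (q k).2 &
    big k.+1 (q k.+1)] by case: (fP (k.+1, q k) (q_ok k)).
have q1_le i j : (i <= j)%N -> (q i).1 <= (q j).1.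
  move=> /subnK <-; elim: (j - i)%N => // k IH.
  by apply: le_trans IH _; rewrite addSn; case: (q_mono (k + i)%N).
have q2_le i j : (i <= j)%N -> (q j).2 <= (q i).2.
  move=> /subnK <-; elim: (j - i)%N => // k IH.
  by apply: le_trans IH; rewrite addSn; case: (q_mono (k + i)%N).
have q12 i j : (q i).1 <= (q j).2.
  apply: le_trans (q1_le _ _ (leq_maxl i j)) _.
  apply: le_trans (q2_le _ _ (leq_maxr i j)).
  by case: (q_ok (maxn i j)) => _ /ltW.
pose s := sup (range (fun i => (q i).1)).
have s_ge i : (q i).1 <= s.
  apply: sup_upper_bound; last by exists i.
  by split; [exists (q 0%N).1; exists 0%N|exists (q 0%N).2 => _ [j _ <-]].
have s_le i : s <= (q i).2.
  by apply: ge_sup; [exists (q 0%N).1; exists 0%N|move=> _ [j _ <-]].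
have s0 : 0 <= s by apply: le_trans (s_ge 0%N) => /=; lra.
(* The single operator at the common point s has a finite bound, which the interval of index
   exceeding [K] contradicts. *)
have [K K1 KP] := T_bounded s0.
pose k := Num.truncn K.
have [_ _ [x Hx /(_ s)]] := q_mono k.
rewrite s_ge s_le => /(_ isT); apply/negP; rewrite -leNgt.
apply: le_trans (KP _ Hx) _; rewrite ler_wpM2r ?form_norm_ge0//.
by apply/ltW/truncnS_gt.
Qed.

(** The bound on one interval [a, b[ with b < d spreads to the right: a shift by half its length
    costs a factor [Kp], and finitely many shifts reach r. *)
Lemma T_locally_bounded d r : 0 < d -> exists2 K, 0 <= K &
  forall t x, d <= t <= r -> H x -> n (T t x) <= K * n x.
Proof.
move=> d0; have [a [b [K0 [a0 ab bd K0P]]]] := T_bounded_somewhere d0.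
pose p := (b - a) / 2; have p0 : 0 < p by rewrite /p; lra.
have [Kp Kp1 KpP] := T_bounded (ltW p0).
have bounded_upto j : exists2 K, 0 <= K &
    forall t x, a <= t < b + p *+ j -> H x -> n (T t x) <= K * n x.
  elim: j => [|j [K K_ge0 KP]].
    exists `|K0| => // t x; rewrite mulr0n addr0 => tab Hx.
    apply: le_trans (K0P _ _ tab Hx) _.
    by rewrite ler_wpM2r ?form_norm_ge0// ler_norm.
  exists (Kp * K) => [|t x /andP[ta]]; first by rewrite mulr_ge0//; lra.
  rewrite mulrSr => tb Hx; have [tbj|tbj] := ltP t (b + p *+ j).
    rewrite (le_trans (KP t x _ Hx)) ?ta//.
    by rewrite ler_wpM2r ?form_norm_ge0// ler_peMl.
  have pj : 0 <= p *+ j by rewrite mulrn_wge0// ltW.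
  have tp : a <= t - p by rewrite /p; rewrite /p in pj tbj; lra.
  have tp0 : 0 <= t - p by lra.
  rewrite -(subrKC p t) (semigroupD T_C0)//; last exact: ltW.
  apply: le_trans (KpP _ (T_H tp0 Hx)) _.
  rewrite -mulrA ler_wpM2l//; first by lra.
  by apply: KP => //; lra.
have [K K0' KP] := bounded_upto (Num.truncn (`|r| / p)).+1.
exists K => // t x /andP[dt tr] Hx; apply: KP => //; apply/andP; split; first lra.
have := truncnS_gt (`|r| / p); rewrite ltr_pdivrMr// -mulr_natl => ?.
by have := ler_norm r; lra.
Qed.

(** For s < t, T t x - T s x = T s (T (t - s) x - x). The argument is small by right continuity at
    0, and [T s] is bounded uniformly for s between t / 2 and t. *)
Lemma T_left_cvg x t : H x -> 0 < t ->
  n (T s x) @[s --> t^'-] --> n (T t x).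
Proof.
move=> Hx t0; have t2 : 0 < t / 2 by lra.
have [K K0 KP] := T_locally_bounded t t2.
apply/cvgrPdist_le => e e0.
have K1 : 0 < K + 1 by lra.
have [d d0 dP] := T_orbit_cvg Hx (divr_gt0 e0 K1).
rewrite near_withinE near_simpl; apply/nbhs_ballP.
exists (Num.min d (t / 2)); first by rewrite /= lt_min d0.
move=> s /=; rewrite /ball /= lt_min => /andP[sd st2] st.
have ts0 : 0 < t - s by lra.
rewrite (gtr0_norm ts0) in sd st2.
have Hd : H (T (t - s) x) by apply: T_H => //; lra.
have [Ht Hs] : H (T t x) /\ H (T s x) by split; apply: T_H => //; lra.
apply: le_trans (form_norm_dist B_inner Ht Hs) _.
have -> : T t x = T s (T (t - s) x).
  by rewrite -(semigroupD T_C0) ?subrKC//; lra.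
rewrite -T_sub//; last by lra.
apply: le_trans (KP _ _ _ (subB B_inner Hd Hx)) _; first by lra.
have := dP (t - s) ltac:(lra); rewrite ltr_pdivlMr// => lt_e.
have := form_norm_ge0 B (T (t - s) x - x); rewrite mulrDr mulr1 in lt_e.
by rewrite mulrC; lra.
Qed.

Lemma domain_graph x : D x -> [/\ H x, H (A x) &
  N (t^-1 *: (T t x - x) - A x) @[t --> 0^'+] --> (0 : R)].
Proof. by move=> Dx; apply: (T_gen.2 x (A x)).1. Qed.

(** The difference quotient of [T t x] is the image under [T t] of that of x, and [T t] is bounded;
    so it converges to [T t (A x)], and the graph of the generator is that of [A]. *)
Lemma T_domain x t : D x -> 0 <= t -> D (T t x).
Proof.
move=> /domain_graph[Hx HA x_cvg] t0.
suff : [/\ H (T t x), H (T t (A x)) &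
    N (h^-1 *: (T h (T t x) - T t x) - T t (A x)) @[h --> 0^'+] --> (0 : R)] by move=> /(T_gen.2 _ _).2[].
split; [exact: T_H..|].
have Hd h : 0 < h -> H (h^-1 *: (T h x - x) - A x).
  move=> h0; apply: (subB B_inner) => //; apply: (subZ B_inner).
  by apply: (subB B_inner) => //; apply: T_H => //; exact: ltW.
have TE h : 0 < h -> h^-1 *: (T h (T t x) - T t x) - T t (A x) =
    T t (h^-1 *: (T h x - x) - A x).
  move=> h0; have h_ge0 := ltW h0; have HTh := T_H h_ge0 Hx.
  have HB := subB B_inner HTh Hx.
  rewrite (T_sub t0 (subZ B_inner _ HB) HA) T_scale// T_sub//.
  by rewrite -!(semigroupD T_C0)// [h + t]addrC.
have [K K1 KP] := T_bounded t0; have K0 : 0 < K by lra.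
have [/(_ x_cvg) nP _] := norm_cvg0P Hd.
apply/norm_cvg0P => [h h0|e e0]; first by rewrite TE//; apply/T_H/Hd.
have [d d0 dP] := nP _ (divr_gt0 e0 K0).
exists d => // h hd; have [h0 _] := andP hd; rewrite TE//.
apply: le_lt_trans (KP _ (Hd _ h0)) _.
by have := dP h hd; rewrite ltr_pdivlMr// mulrC.
Qed.

Lemma domain_sub x : D x -> H x /\ H (A x).
Proof. by move=> /domain_graph[]. Qed.

Lemma T_right_derivative x e : D x -> 0 < e -> exists2 d, 0 < d &
  forall h, 0 < h < d ->
    B (T h x) (T h x) <= B x x + 2 * B (A x) x * h + e * h.
Proof.
move=> Dx e0; have [Hx HA x_cvg] := domain_graph Dx.
pose k h := h^-1 *: (T h x - x) - A x.
have Hk h : 0 < h -> H (k h).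
  move=> h0; apply: (subB B_inner) => //; apply: (subZ B_inner).
  by apply: (subB B_inner) => //; apply: T_H => //; exact: ltW.
have [/(_ x_cvg) nP _] := norm_cvg0P Hk.
have nx0 := form_norm_ge0 B x; have nA0 := form_norm_ge0 B (A x).
(* With T h x = x + h (A x + k h), [q] bounds the remainder [k h] so that its product with x stays
   below e / 4, and [m] below bounds the quadratic term; together they contribute at most e h. *)
pose q := e / (4 * (n x + 1)).
have q0 : 0 < q by rewrite divr_gt0//; lra.
have [d d0 dP] := nP _ q0.
pose m := (n (A x) + q) ^+ 2 + 1.
have m0 : 0 < m by rewrite ltr_pwDr// sqr_ge0.
exists (Num.min d (e / (2 * m))).
  by rewrite lt_min d0 divr_gt0//; lra.
move=> h; rewrite lt_min => /and3P[h0 hd hm].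
have {}dP : n (k h) < q by apply: dP; rewrite h0.
have {Hk}Hk := Hk h h0.
have TE : T h x = h *: (A x + k h) + x.
  by rewrite /k subrKC scalerA divff ?gt_eqF// scale1r subrK.
have HAk := subD B_inner HA Hk.
rewrite TE (form_sqr B_inner)// (form_addl B_inner HA Hk Hx).
have Bk := form_CS B_inner Hk Hx.
have nk0 := form_norm_ge0 B (k h).
have e1 : B (k h) x <= e / 4.
  apply: le_trans Bk _; apply: (@le_trans _ _ (q * (n x + 1))).
    by apply: ler_pM => //; lra.
  by rewrite /q le_eqVlt; apply/orP; left; apply/eqP; field; lra.
have e2 : h * B (A x + k h) (A x + k h) <= e / 2.
  rewrite -(form_norm_sqr B_inner)//.
  apply: (@le_trans _ _ (h * m)).
    rewrite ler_pM2l// /m; have := form_normD B_inner HA Hk => nAk.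
    have : n (A x + k h) ^+ 2 <= (n (A x) + q) ^+ 2.
      by rewrite lerXn2r ?nnegrE ?form_norm_ge0//; lra.
    lra.
  by move: hm; rewrite ltr_pdivlMr ?mulr_gt0//; lra.
have h_ge0 := ltW h0.
have {}e1 := ler_wpM2l h_ge0 e1; have {}e2 := ler_wpM2l h_ge0 e2.
move: (B (A x) x) (B (k h) x) (B x x) (B _ _) e1 e2 => a b y z e1 e2.
by lra.
Qed.

Variable w : R.
Hypothesis w_gt0 : 0 < w.
Hypothesis A_dissipative : forall x, D x -> B (A x) x <= - w * B x x.

Lemma semigroup_decay x t : D x -> 0 <= t ->
  B (T t x) (T t x) <= B x x * expR (- (2 * w) * t).
Proof.
move=> Dx t0; have [Hx _] := domain_sub Dx.
rewrite -[X in B X X * _](semigroup0 T_C0 Hx).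
apply: (@right_decay _ (fun s => B (T s x) (T s x))) => //.
- by rewrite mulr_gt0.
- by move=> s s0; apply: (form_ge0 B_inner); exact: T_H.
- move=> s e s0 e0; have Ds := T_domain Dx s0.
  have [d d0 dP] := T_right_derivative Ds e0.
  exists d => // h hd; have [h0 _] := andP hd.
  rewrite addrC (semigroupD T_C0)//; last exact: ltW.
  apply: le_trans (dP h hd) _; rewrite lerD2r.
  have := ler_wpM2r (ltW h0) (A_dissipative Ds); lra.
- move=> s s0; have Hs r : 0 <= r -> B (T r x) (T r x) = n (T r x) ^+ 2.
    by move=> r0; rewrite (form_norm_sqr B_inner)//; exact: T_H.
  rewrite Hs ?ltW//.
  have : n (T r x) ^+ 2 @[r --> s^'-] --> n (T s x) ^+ 2.
    by rewrite !expr2; apply: cvgM; exact: T_left_cvg.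
  apply: cvg_trans; apply: near_eq_cvg; near=> r; rewrite Hs//.
  by near: r; apply: (@nbhs_left_ge _ s 0).
Unshelve. all: by end_near. Qed.

Hypothesis D_dense : forall x e, H x -> 0 < e ->
  exists2 y, D y & N (x - y) < e.

(** Decay passes from the domain to H by density. The bound [K] of [T t] may grow with t, since it
    only multiplies the approximation error at that fixed t. *)
Lemma semigroup_exponentially_stable : exponentially_stable H N T.
Proof.
exists (C / c), w; split=> //; first exact: divr_gt0.
move=> t x t0 Hx.
have [K K1 KP] := T_bounded t0.
pose E := expR (- w * t); have E0 : 0 < E := expR_gt0 _.
suff le_n : n (T t x) <= E * n x.
  rewrite -/E (_ : _ * N x = c^-1 * (E * (C * N x))); last by ring.
  rewrite ler_pdivlMl//; apply: le_trans (N_le (T_H t0 Hx)) _.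
  by apply: le_trans le_n _; rewrite ler_pM2l// N_ge.
apply/ler_addgt0Pr => e e0.
(* The error x - y enters twice, through [T t] with factor [K] and through the norm of y with factor
   [E]; [C] converts the form norm to [N]. *)
have r0 : 0 < e / (C * (K + E)) by rewrite divr_gt0// mulr_gt0//; lra.
have [y Dy Nxy] := D_dense Hx r0.
have [Hy _] := domain_sub Dy.
have Hxy := subB B_inner Hx Hy.
have nxy : n (x - y) < e / (K + E).
  apply: le_lt_trans (N_ge Hxy) _.
  by rewrite -ltr_pdivlMl// [C^-1 * _]mulrC -mulrA -invfM [_ * C]mulrC.
have ny : n (T t y) <= E * n y.
  rewrite -(@ler_pXn2r _ 2) ?nnegrE ?mulr_ge0 ?form_norm_ge0 ?(ltW E0)//.
  rewrite exprMn !(form_norm_sqr B_inner)//; last exact: T_H.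
  rewrite mulrC (_ : E ^+ 2 = expR (- (2 * w) * t)); first exact: semigroup_decay.
  by rewrite /E -expRM_natl; apply: f_equal; lra.
have HTy := T_H t0 Hy; have HTx := T_H t0 Hx.
have := form_normD B_inner (subB B_inner HTx HTy) HTy; rewrite subrK.
have := KP _ Hxy; rewrite T_sub// => le1 le2.
have := form_norm_dist B_inner Hy Hx; rewrite (form_normN B_inner Hy Hx) ler_norml.
move=> /andP[_ le3].
have {}le3 : E * (n y - n x) <= E * n (x - y) by rewrite ler_pM2l.
have : (K + E) * n (x - y) < e by rewrite mulrC -ltr_pdivlMr//; lra.
lra.
Qed.

End SemigroupDecay.

(** * Test functions *)

Section Smooth.
Context {R : realType}.
Implicit Types (f g : R -> R) (a b x : R) (n k : nat).

(** The derivative is peeled off at the head, so that each closure property is an induction on n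
    over all functions, its step being a differentiation rule. *)
Fixpoint Cn n f : Prop :=
  if n is n'.+1 then (forall x, derivable f x 1) /\ Cn n' (derive1 f) else True.

Definition smooth f := forall n, Cn n f.

Lemma smoothP f : smooth f <-> forall n x, derivable (derive1n n f) x 1.
Proof.
split=> [sf n|sf n]; last first.
  elim: n f sf => //= n IH f sf; split; first exact: (sf 0%N).
  by apply: IH => m x; rewrite -derive1Sn.
have := sf n.+1; elim: n f {sf} => [|n IH] f [df] // Cf x.
by rewrite derive1Sn; apply: IH.
Qed.

Lemma CnS n f : Cn n.+1 f -> Cn n f.
Proof.
elim: n f => // n IH f [df Cf]; split=> //.
by apply: IH; case: Cf.
Qed.

Lemma Cn_derive n f df :
  (forall x, is_derive x 1 f (df x)) -> Cn n df -> Cn n.+1 f.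
Proof.
move=> fE Cdf; split=> [x|]; first by have [] := fE x.
by rewrite (_ : derive1 f = df)//; apply/funext => x; rewrite derive1E derive_val.
Qed.

Lemma is_derive_derive1 f x : derivable f x 1 -> is_derive x 1 f (derive1 f x).
Proof. by move=> df; apply: DeriveDef => //; rewrite derive1E. Qed.

Lemma Cn_cst n a : Cn n (cst a).
Proof.
elim: n a => // n IH a; apply: (@Cn_derive _ _ (cst 0)); exact: IH.
Qed.

Lemma Cn_lin n a f g : Cn n f -> Cn n g -> Cn n (fun x => a * f x + g x).
Proof.
elim: n f g => // n IH f g [df Cf] [dg Cg].
apply: (@Cn_derive _ _ (fun x => a * derive1 f x + derive1 g x)); last exact: IH.
move=> x; have := is_derive_derive1 (df x); have := is_derive_derive1 (dg x).
move=> g' f'; exact: (@is_deriveD _ _ _ (a \*: f) g).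
Qed.

Lemma Cn_mul n f g : Cn n f -> Cn n g -> Cn n (fun x => f x * g x).
Proof.
elim: n f g => // n IH f g [df Cf] [dg Cg].
apply: (@Cn_derive _ _ (fun x => 1 * (f x * derive1 g x) + g x * derive1 f x)).
  move=> x; have f' := is_derive_derive1 (df x); have g' := is_derive_derive1 (dg x).
  rewrite mul1r; exact: (@is_deriveM _ _ f g).
by apply: Cn_lin; apply: IH => //; apply: CnS.
Qed.

Lemma Cn_exp n f : Cn n f -> Cn n (fun x => expR (f x)).
Proof.
elim: n f => // n IH f [df Cf].
apply: (@Cn_derive _ _ (fun x => expR (f x) * derive1 f x)).
  move=> x; have f' := is_derive_derive1 (df x).
  exact: (@is_derive1_comp _ expR f).
by apply: Cn_mul => //; apply: IH; apply: CnS.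
Qed.

Lemma Cn_affine n f a b : Cn n f -> Cn n (fun x => f (a * x + b)).
Proof.
elim: n f => // n IH f [df Cf].
apply: (@Cn_derive _ _ (fun x => derive1 f (a * x + b) * cst a x)); last first.
  by apply: Cn_mul; [apply: IH|apply: Cn_cst].
move=> x; have f' := is_derive_derive1 (df (a * x + b)).
apply: (@is_derive1_comp _ f (fun x => a * x + b)).
have -> : cst a x = a *: 1 + 0 by rewrite /= addr0 [a *: _]mulr1.
exact: (@is_deriveD _ _ _ (a \*: id) (cst b)).
Qed.

(* [flat 0] is the classical smooth function that vanishes on the negative
   half-line, and the family is closed under derivatives. *)
Definition flat k x := if 0 < x then x^-1 ^+ k * expR (- x^-1) else 0.

(** From exp (y / m) >= y / m with m = k + 2 follows exp y >= (y / m)^m, applied to y = 1 / x. The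
    order x^2 is what makes every member of the family differentiable at 0 with derivative 0. *)
Lemma flat_le k : exists2 C, 0 <= C & forall x, `|flat k x| <= C * x ^+ 2.
Proof.
exists (k.+2%:R ^+ k.+2) => [|x]; first by rewrite exprn_ge0.
rewrite /flat; case: ltP => [x0|_]; last first.
  by rewrite normr0 mulr_ge0 ?sqr_ge0 ?exprn_ge0.
rewrite ger0_norm; last first.
  by rewrite mulr_ge0 ?expR_ge0 ?exprn_ge0 ?invr_ge0 ?ltW.
rewrite expRN -ler_pdivlMr ?invr_gt0 ?expR_gt0// invrK.
rewrite exprVn -div1r ler_pdivrMr ?exprn_gt0//.
have Ex : (k.+2%:R^-1 * x^-1) ^+ k.+2 <= expR x^-1.
  rewrite [in leRHS](_ : x^-1 = k.+2%:R * (k.+2%:R^-1 * x^-1)); last first.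
    by rewrite mulrA mulfV// mul1r.
  rewrite expRM_natl.
  rewrite lerXn2r ?nnegrE ?mulr_ge0 ?invr_ge0 ?(ltW x0) ?expR_ge0//.
  by apply: le_trans (expR_ge1Dx _); rewrite lerDr.
apply: (@le_trans _ _ (k.+2%:R ^+ k.+2 * x ^+ 2 * (k.+2%:R^-1 * x^-1) ^+ k.+2 * x ^+ k)).
  rewrite exprMn !exprVn -[in (x ^+ k.+2)^-1]addn2 exprD.
  have K0 : k.+2%:R ^+ k.+2 != 0 :> R by rewrite expf_neq0.
  have xk0 : x ^+ k != 0 by rewrite expf_neq0// gt_eqF.
  move: (_ ^+ k.+2) (x ^+ k) K0 xk0 => K y K0 y0.
  rewrite le_eqVlt; apply/orP; left; apply/eqP; field.
  by rewrite K0 y0 gt_eqF.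
rewrite ler_wpM2r ?exprn_ge0 ?(ltW x0)// ler_wpM2l// mulr_ge0 ?exprn_ge0//.
exact: ltW.
Qed.

Lemma flat_ge0 k x : 0 <= flat k x.
Proof.
rewrite /flat; case: ltP => // x0.
by rewrite mulr_ge0 ?expR_ge0 ?exprn_ge0 ?invr_ge0 ?ltW.
Qed.

Lemma flat_derive k x : is_derive x 1 (flat k) (- k%:R * flat k.+1 x + flat k.+2 x).
Proof.
have [x0|x0|->] := ltgtP x 0.
- rewrite {2 3}/flat ltNge (ltW x0) /= mulr0 addr0.
  apply: (@near_eq_is_derive _ _ _ (cst 0)).
    near=> y; rewrite /flat ltNge.
    suff /ltW -> : y < 0 by []; near: y; exact: lt_nbhsl.
- pose F y : R := y^-1 ^+ k * expR (- y^-1).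
  apply: (@near_eq_is_derive _ _ _ F).
    near=> y; rewrite /flat.
    suff -> : 0 < y by []; near: y; exact: lt_nbhsr.
  rewrite /flat x0.
  have xN0 : x != 0 by rewrite gt_eqF.
  have iV : is_derive x (1 : R) (fun y : R => y^-1) (- x^-1 ^+ 2).
    apply: DeriveDef; first exact: derivableV.
    by rewrite deriveV// derive_id exprVn [LHS]mulr1.
  have iX := is_deriveX k iV.
  have iN := is_deriveN iV.
  have iE := @is_derive1_comp _ expR _ x _ _ (is_derive_expR _) iN.
  have := is_deriveM iX iE; rewrite exprfctE opprfctE => dF.
  rewrite (_ : F = (fun y => y^-1 ^+ k) * (expR \o (fun y => - y^-1)))//.
  apply: (is_derive_eq dF).
  rewrite /GRing.scale /=; case: (k) => [|k'] /=.
    by rewrite !exprS !expr0; ring.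
  by rewrite !exprS; ring.
- have [C C0 CP] := flat_le k.
  rewrite {2 3}/flat ltxx mulr0 addr0.
  have cv : h^-1 *: (flat k (h *: 1 + 0) - flat k 0) @[h --> (0 : R)^'] --> (0 : R).
    apply/cvgrPdist_lt => e e0; rewrite near_withinE near_simpl; apply/nbhs_ballP.
    have C1 : 0 < C + 1 by lra.
    exists (e / (C + 1)) => /=; first by rewrite divr_gt0.
    move=> h; rewrite /ball /= sub0r normrN => he h0.
    rewrite sub0r normrN addr0 {2}/flat ltxx subr0 /GRing.scale /= mulr1.
    rewrite normrM normfV; have h0' : 0 < `|h| by rewrite normr_gt0.
    rewrite ltr_pdivrMl//; apply: le_lt_trans (CP h) _.
    rewrite -real_normK ?num_real// expr2 mulrCA ltr_pM2l//.
    move: he; rewrite ltr_pdivlMr// mulrDr mulr1 mulrC; lra.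
  apply: DeriveDef; last by apply: cvg_lim.
  by apply/cvg_ex; exists 0.
Unshelve. all: by end_near. Qed.

Lemma smooth_flat k : smooth (flat k).
Proof.
move=> n; elim: n k => // n IH k; apply: Cn_derive (flat_derive k) _.
exact: Cn_lin.
Qed.

(** A smooth function with values in [0, 1], zero outside ]a, b[, that tends to the indicator of ]a,
    b[ as n grows; it approximates indicators without convolution. *)
Definition cutoff a b n x :=
  1 - expR (- (n%:R * (flat 0 (x - a) * flat 0 (b - x)))).

Lemma smooth_cutoff a b n : smooth (cutoff a b n).
Proof.
move=> m; rewrite (_ : cutoff a b n = fun x => -1 * expR (- n%:R *
   (flat 0 (1 * x + - a) * flat 0 (-1 * x + b)) + cst 0 x) + cst 1 x).
  apply: Cn_lin; last exact: Cn_cst.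
  apply: Cn_exp; apply: Cn_lin; last exact: Cn_cst.
  by apply: Cn_mul; apply: (@Cn_affine _ (flat 0)); apply: smooth_flat.
apply/funext => x; rewrite /cutoff mulN1r addr0 mulNr mul1r mulN1r.
by rewrite addrC [- x + b]addrC.
Qed.

Lemma cutoff_ge0 a b n x : 0 <= cutoff a b n x.
Proof.
rewrite /cutoff subr_ge0 -[leRHS]expR0 ler_expR oppr_le0.
by rewrite !mulr_ge0 ?flat_ge0.
Qed.

Lemma cutoff_le1 a b n x : cutoff a b n x <= 1.
Proof. by rewrite /cutoff lerBlDr lerDl expR_ge0. Qed.

Lemma cutoff_out a b n x : ~~ (a < x < b) -> cutoff a b n x = 0.
Proof.
rewrite negb_and /cutoff /flat !subr_gt0.
by case/orP => /negbTE ->; rewrite ?(mul0r, mulr0) oppr0 expR0 subrr.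
Qed.

Lemma cutoff_cvg a b x : a < x < b -> cutoff a b n x @[n --> \oo] --> (1 : R).
Proof.
move=> /andP[ax xb]; rewrite -[X in _ --> X]subr0.
apply: cvgB; first exact: cvg_cst.
pose c := flat 0 (x - a) * flat 0 (b - x).
have c0 : 0 < c.
  by rewrite /c /flat !subr_gt0 ax xb !mulr_gt0 ?expR_gt0.
have -> : (fun n => expR (- (n%:R * c))) = geometric 1 (expR (- c)).
  by apply/funext => n; rewrite /geometric /= mul1r -expRM_natl mulrN.
apply: cvg_geometric.
by rewrite ger0_norm ?expR_ge0// -[ltRHS]expR0 ltr_expR oppr_lt0.
Qed.

End Smooth.

Section TestFunctions.
Context {R : realType}.
Variable l : R.
Hypothesis l0 : 0 < l.
Local Notation test := (test_function l).

Lemma testP (phi : R -> R) : test phi <-> smooth phi /\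
  exists a b, [/\ 0 < a, b < l & forall x, ~~ (a <= x <= b) -> phi x = 0].
Proof.
rewrite /test_function -smoothP; split=> -[sphi [a [b [a0 bl phi0]]]].
all: split=> //; exists a, b; split=> // x.
- by move=> xab; apply/eqP; apply: contraNT xab => /phi0.
- by move=> phix; apply/negPn; apply: contra phix => /phi0/eqP.
Qed.

Lemma test_cutoff a b n : 0 < a -> b < l -> test (cutoff a b n).
Proof.
move=> a0 bl; apply/testP; split; first exact: smooth_cutoff.
exists a, b; split=> // x xab; apply: cutoff_out.
by apply: contra xab => /andP[/ltW -> /ltW ->].
Qed.

Lemma test_lin c (phi psi : R -> R) : test phi -> test psi ->
  test (fun x => c * phi x + psi x).
Proof.
move=> /testP[s1 [a1 [b1 [a10 b1l o1]]]] /testP[s2 [a2 [b2 [a20 b2l o2]]]].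
apply/testP; split=> [n|]; first exact: Cn_lin.
exists (Num.min a1 a2), (Num.max b1 b2); split.
- by rewrite lt_min a10.
- by rewrite gt_max b1l.
- move=> x xab; rewrite o1 ?o2 ?mulr0 ?addr0//; apply: contra xab => /andP[ax xb];
  by rewrite ge_min le_max ax xb ?orbT.
Qed.

Lemma test_derive1 (phi : R -> R) : test phi -> test (derive1 phi).
Proof.
move=> /testP[s [a [b [a0 bl o]]]]; apply/testP; split=> [n|].
  by case: (s n.+1).
exists a, b; split=> // x xab; rewrite derive1E.
rewrite (@near_eq_derive _ _ _ _ (cst 0)) ?derive_cst//.
move: xab; rewrite negb_and -!ltNge => /orP[xa|bx]; near=> y.
  apply: o; rewrite negb_and -!ltNge; apply/orP; left.
  by near: y; exact: lt_nbhsl.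
apply: o; rewrite negb_and -!ltNge; apply/orP; right.
by near: y; exact: lt_nbhsr.
Unshelve. all: by end_near. Qed.

Lemma test_out (phi : R -> R) x : test phi -> ~~ (0 < x < l) -> phi x = 0.
Proof.
move=> /testP[s [a [b [a0 bl o]]]] xl; apply: o; apply: contra xl => /andP[ax xb].
by rewrite (lt_le_trans a0)// (le_lt_trans xb).
Qed.

Lemma test_derivable (phi : R -> R) x : test phi -> derivable phi x 1.
Proof. by move=> [s _]; exact: (s 0%N). Qed.

Lemma test_continuous (phi : R -> R) : test phi -> continuous phi.
Proof.
by move=> tphi x; apply/differentiable_continuous/derivable1_diffP/test_derivable.
Qed.

End TestFunctions.

(** * The space L^2 *)

Section L2Inner.
Context {d} {T : measurableType d} {R : realType}.
Variable mu : {measure set T -> \bar R}.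
Local Notation L2m := (L2 mu).
Local Notation Lfun2 := (Lfun mu 2%:E).
Implicit Types (u v w : L2m) (f g h : T -> R).

Lemma Lfun2P f : measurable_fun setT f ->
  mu.-integrable setT (EFin \o (fun x => f x ^+ 2)) -> f \in Lfun2.
Proof.
move=> mf /integrableP[_ intf]; rewrite inE; apply/andP; split; rewrite inE//=.
rewrite /finite_norm unlock /= poweR_lty//; apply: le_lt_trans intf.
rewrite le_eqVlt; apply/orP; left; apply/eqP/eq_integral => x _ /=.
by rewrite powR_mulrn ?normr_ge0// normrX.
Qed.

Lemma Lfun2_measurable f : f \in Lfun2 -> measurable_fun setT f.
Proof. by rewrite inE => /andP[]; rewrite inE. Qed.

Lemma L2_Lfun u : (u : T -> R) \in Lfun2.
Proof. exact: (@LfunP _ _ _ mu _ (lee1n 2) (repr u)). Qed.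

Lemma Lfun_mul_integrable f g : f \in Lfun2 -> g \in Lfun2 ->
  mu.-integrable setT (EFin \o (fun x => f x * g x)).
Proof. by move=> Lf Lg; apply/Lfun1_integrable/Lfun2_mul_Lfun1. Qed.

Lemma Lfun_lin a f g : f \in Lfun2 -> g \in Lfun2 ->
  (fun x => a * f x + g x) \in Lfun2.
Proof.
move=> Lf Lg.
have [_ Lin] := @Lfun_submod_closed _ T R mu 2%:E (lee1n 2).
exact: (Lin a f g Lf Lg).
Qed.

Lemma Lfun_le f g : measurable_fun setT f -> (forall x, `|f x| <= `|g x|) ->
  g \in Lfun2 -> f \in Lfun2.
Proof.
move=> mf fg Lg; apply: Lfun2P => //.
apply: le_integrable (Lfun2_integrable_sqr Lg) => //.
  by apply/measurable_EFinP; exact: measurable_funX.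
by move=> x _; rewrite /= lee_fin !normrX lerXn2r ?nnegrE.
Qed.

(* The value is 0 on the functions that are not square integrable. *)
Definition toL2 f : L2m := \pi_L2m (insubd (0 : fun2 mu) f).

Lemma toL2E f : f \in Lfun2 -> toL2 f = f %[ae mu].
Proof.
move=> Lf; pose g : fun2 mu := insubd (0 : fun2 mu) f.
have gf : (g : T -> R) = f by exact: (insubdK (0 : fun2 mu) Lf).
by rewrite -[in X in _ = X %[ae mu]]gf; exact: L2_reprK.
Qed.

Lemma L2_eq u v : u = v %[ae mu] -> u = v.
Proof. by move=> uv; rewrite -[u]reprK -[v]reprK; exact: L2_eqP. Qed.

Lemma toL2K u : toL2 u = u.
Proof. by apply: L2_eq; apply: toL2E; exact: L2_Lfun. Qed.

Lemma L2_addE u v : (u + v : L2m) = (fun x => u x + v x) %[ae mu].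
Proof.
have -> : u + v = \pi_L2m ((repr u : fun2 mu) + repr v).
  by rewrite pi_L2_add !reprK.
exact: L2_reprK.
Qed.

Lemma L2_scaleE a u : (a *: u : L2m) = (fun x => a * u x) %[ae mu].
Proof.
have -> : a *: u = \pi_L2m (a *: (repr u : fun2 mu)).
  by rewrite pi_L2_scale reprK.
exact: L2_reprK.
Qed.

Lemma L2_linE a u v : (a *: u + v : L2m) = (fun x => a * u x + v x) %[ae mu].
Proof.
apply: (ae_eq_trans (L2_addE _ _)); apply: filterS (L2_scaleE a u) => x ux Dx.
by rewrite ux.
Qed.

Lemma L2_zeroE : (0 : L2m) = (fun=> 0) %[ae mu].
Proof.
apply: (ae_eq_trans (g := fun x => 0 * (0 : L2m) x)).
  by have := L2_scaleE 0 (0 : L2m); rewrite scale0r.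
by apply: aeW => x _; rewrite mul0r.
Qed.

Lemma toL2_eq f g : f \in Lfun2 -> g \in Lfun2 -> f = g %[ae mu] ->
  toL2 f = toL2 g.
Proof.
move=> Lf Lg fg; apply: L2_eq; apply: (ae_eq_trans (toL2E Lf)).
by apply: (ae_eq_trans fg); apply: ae_eq_sym; exact: toL2E.
Qed.

Lemma toL2_lin a f g : f \in Lfun2 -> g \in Lfun2 ->
  toL2 (fun x => a * f x + g x) = a *: toL2 f + toL2 g.
Proof.
move=> Lf Lg; apply: L2_eq; apply: (ae_eq_trans (toL2E (Lfun_lin a Lf Lg))).
apply: ae_eq_sym; apply: (ae_eq_trans (L2_linE _ _ _)).
by apply: filterS2 (toL2E Lf) (toL2E Lg) => x fx gx Dx; rewrite fx// gx.
Qed.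

Lemma Lfun_ae f g : measurable_fun setT g -> f = g %[ae mu] ->
  f \in Lfun2 -> g \in Lfun2.
Proof.
move=> mg fg Lf; apply: Lfun2P => //.
have mf := Lfun2_measurable Lf.
have /integrableP[_ intf] := Lfun2_integrable_sqr Lf.
apply/integrableP; split; first by apply/measurable_EFinP; exact: measurable_funX.
apply: le_lt_trans intf; rewrite le_eqVlt; apply/orP; left; apply/eqP.
apply: ae_eq_integral => //.
- by apply: measurableT_comp => //; apply/measurable_EFinP; exact: measurable_funX.
- by apply: measurableT_comp => //; apply/measurable_EFinP; exact: measurable_funX.
- by apply: filterS fg => x fx Dx /=; rewrite fx.
Qed.

Lemma ae_Rintegral f g : measurable_fun setT f -> measurable_fun setT g ->
  f = g %[ae mu] -> \int[mu]_x f x = \int[mu]_x g x.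
Proof.
move=> mf mg fg; congr fine; apply: ae_eq_integral => //.
- exact/measurable_EFinP.
- exact/measurable_EFinP.
- by apply: filterS fg => x fx Dx; rewrite fx.
Qed.

Definition ip u v := \int[mu]_x (u x * v x).

Lemma ipE' f g : f \in Lfun2 -> g \in Lfun2 ->
  ip (toL2 f) (toL2 g) = \int[mu]_x (f x * g x).
Proof.
move=> Lf Lg; apply: ae_Rintegral.
- by apply: measurable_funM; apply/Lfun2_measurable/L2_Lfun.
- by apply: measurable_funM; apply: Lfun2_measurable.
- by apply: filterS2 (toL2E Lf) (toL2E Lg) => x fx gx Dx; rewrite fx// gx.
Qed.

Lemma ipE u g : g \in Lfun2 -> ip u (toL2 g) = \int[mu]_x (u x * g x).
Proof. by move=> Lg; rewrite -[in LHS](toL2K u) ipE'//; exact: L2_Lfun. Qed.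

Lemma ip_inner : semi_inner setT ip.
Proof.
have Ru u := L2_Lfun u.
have int_mul u v := Lfun_mul_integrable (Ru u) (Ru v).
split=> // [a u v w _ _ _|u v _ _|u _].
- rewrite /ip -RintegralZl// -RintegralD//; last first.
    have := integrableZl measurableT a (int_mul u w).
    by apply: eq_integrable => // x _.
  apply: ae_Rintegral.
  + by apply: measurable_funM; apply: Lfun2_measurable.
  + apply: measurable_funD; first apply: measurable_funM => //.
      by apply: measurable_funM; apply: Lfun2_measurable.
    by apply: measurable_funM; apply: Lfun2_measurable.
  + by apply: filterS (L2_linE a u v) => x ux Dx; rewrite ux// mulrDl mulrA.
- by apply: eq_Rintegral => x _; rewrite mulrC.
- by apply: Rintegral_ge0 => x _; rewrite -expr2 sqr_ge0.
Qed.

Lemma ip_linl a u v w : ip (a *: u + v) w = a * ip u w + ip v w.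
Proof. exact: (form_lin ip_inner). Qed.

Lemma ip_sym u v : ip u v = ip v u.
Proof. exact: (form_sym ip_inner). Qed.

Lemma ip_linr a u v w : ip w (a *: u + v) = a * ip w u + ip w v.
Proof. by rewrite ip_sym ip_linl !(ip_sym w). Qed.

Lemma ip_ge0 u : 0 <= ip u u. Proof. exact: (form_ge0 ip_inner). Qed.

Lemma ip0l v : ip 0 v = 0. Proof. exact: (form0l ip_inner). Qed.

Lemma ip0r v : ip v 0 = 0. Proof. by rewrite ip_sym ip0l. Qed.

Lemma ipDl u v w : ip (u + v) w = ip u w + ip v w.
Proof. exact: (form_addl ip_inner). Qed.

Lemma ipZl a u w : ip (a *: u) w = a * ip u w.
Proof. exact: (form_scalel ip_inner). Qed.

Lemma ipDr u v w : ip w (u + v) = ip w u + ip w v.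
Proof. by rewrite ip_sym ipDl !(ip_sym w). Qed.

Lemma ipZr a u w : ip w (a *: u) = a * ip w u.
Proof. by rewrite ip_sym ipZl (ip_sym w). Qed.

Lemma ipNl u w : ip (- u) w = - ip u w.
Proof. by rewrite -scaleN1r ipZl mulN1r. Qed.

Lemma ipNr u w : ip w (- u) = - ip w u.
Proof. by rewrite -scaleN1r ipZr mulN1r. Qed.

Lemma ip_eq0 u : ip u u = 0 -> u = 0.
Proof.
move=> u0; apply: L2_eq; apply: (ae_eq_trans (g := fun=> 0)); last first.
  by apply: ae_eq_sym; exact: L2_zeroE.
have Ru := L2_Lfun u; have mu2 := Lfun2_measurable Ru.
have m2 : measurable_fun setT (EFin \o (fun x => u x ^+ 2)).
  by apply/measurable_EFinP; exact: measurable_funX.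
have : (\int[mu]_x `|(EFin \o (fun x => u x ^+ 2)%R) x| = 0)%E.
  have ufin := integrable_fin_num measurableT (Lfun2_integrable_sqr Ru).
  rewrite (eq_integral (EFin \o (fun x => u x ^+ 2))); last first.
    by move=> x _; rewrite /= ger0_norm ?sqr_ge0.
  by rewrite -[LHS](fineK ufin); congr (_%:E); exact: u0.
move/(ae_eq_integral_abs mu measurableT m2) => u2.
by apply: filterS u2 => x ux Dx; have /= := ux I; case=> /eqP; rewrite sqrf_eq0 => /eqP.
Qed.

Lemma ip_young c u v : 0 < c -> 2 * `|ip u v| <= c * ip u u + c^-1 * ip v v.
Proof.
move=> c0; have young w : 2 * ip u w <= c * ip u u + c^-1 * ip w w.
  have := ip_ge0 (c *: u + (- 1) *: w); rewrite (form_sqr ip_inner)//.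
  rewrite ipZr [ip (_ *: w) _]ipZl ipZr.
  have c'0 : 0 < c^-1 by rewrite invr_gt0.
  move=> /(ler_wpM2l (ltW c'0)); move: (ip u u) (ip u w) (ip w w) => x y z.
  rewrite mulr0 (_ : c^-1 * (_ + _) = c * x - 2 * y + c^-1 * z); first by move=> ?; lra.
  by field; rewrite gt_eqF.
have := young v; have := young (- v); rewrite !(ipNl, ipNr) opprK.
by case: (ger0P (ip u v)) => _; lra.
Qed.

End L2Inner.

(** * Density of the test functions in L^2(0, l) *)

Section TestDensity.
Context {R : realType}.
Variable l : R.
Hypothesis l0 : 0 < l.
Local Notation mu := (mu_itv l).
Local Notation RT := (measurableTypeR R).
Local Notation test := (test_function l).
Local Notation Lfun2 := (Lfun mu 2%:E).
Local Notation nrm := (form_norm (@ip _ _ _ mu)).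
Implicit Types (f g : RT -> R) (u v : L2 mu).

Lemma ae_imp (P Q : RT -> Prop) : (forall x, P x -> Q x) ->
  {ae mu, forall x, P x} -> {ae mu, forall x, Q x}.
Proof. by move=> PQ; apply: (@filterS _ _ (ae_filter_ringOfSetsType mu)). Qed.

Lemma ae_imp2 (P Q S : RT -> Prop) : (forall x, P x -> Q x -> S x) ->
  {ae mu, forall x, P x} -> {ae mu, forall x, Q x} -> {ae mu, forall x, S x}.
Proof. by move=> PQ; apply: (@filterS2 _ _ (ae_filter_ringOfSetsType mu)). Qed.

Lemma mu_itvT : mu setT = l%:E.
Proof.
have -> : mu setT = lebesgue_measure (setT `&` `]0, l[%classic : set R) by [].
rewrite setTI lebesgue_measure_itv /= lte_fin l0.
by rewrite oppr0 adde0.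
Qed.

Lemma mu_itv_in : {ae mu, forall x, 0 < x < l}.
Proof.
exists (~` `]0, l[%classic); split=> [||x].
- exact: measurableC.
- by rewrite -[LHS]/(lebesgue_measure (_ `&` _ : set R)) setICl measure0.
- by rewrite /= in_itv.
Qed.

Lemma eq_itv_ae f g : (forall x, 0 < x < l -> f x = g x) -> f = g %[ae mu].
Proof. by move=> fg; apply: ae_imp mu_itv_in => x xl _; exact: fg. Qed.

Lemma bounded_Lfun f M : measurable_fun setT f -> (forall x, `|f x| <= M) ->
  f \in Lfun2.
Proof.
move=> mf fM; apply: (@Lfun_le _ _ _ _ _ (cst M)) => //.
  by move=> x; apply: le_trans (fM x) _; exact: ler_norm.
apply: Lfun2P; first exact: measurable_cst.
apply/integrableP; split.
  by apply/measurable_EFinP; apply: measurable_funX; exact: measurable_cst.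
rewrite (eq_integral (cst (`|M ^+ 2|%R)%:E))//.
by rewrite integral_cst//= mu_itvT -EFinM ltry.
Qed.

Lemma indic_Lfun (A : set RT) : measurable A -> \1_A \in Lfun2.
Proof.
move=> mA; apply: (@bounded_Lfun _ 1); first exact: measurable_indic.
by move=> x; rewrite indicE; case: (_ \in _); rewrite ?normr1 ?normr0.
Qed.

Lemma continuous_Lfun f : {within `[0, l], continuous f} ->
  (forall x, ~~ (0 <= x <= l) -> f x = 0) -> measurable_fun setT f -> f \in Lfun2.
Proof.
move=> cf f0 mf; have cf' : {within `[0, l], continuous (fun x => `|f x|)}.
  by move=> x; apply: (cvg_comp _ _ (cf x)); exact: norm_continuous.
have [c cl fc] := EVT_max (ltW l0) cf'.
apply: (@bounded_Lfun _ `|f c|) => // x.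
have [xl|/f0 ->] := boolP (0 <= x <= l); last by rewrite normr0.
by apply: fc; rewrite in_itv.
Qed.

Lemma test_Lfun f : test f -> f \in Lfun2.
Proof.
move=> tf; have cf := test_continuous tf; apply: continuous_Lfun.
- exact: continuous_subspaceT.
- move=> x xl; apply: (test_out tf); apply: contra xl => /andP[].
  by move=> /ltW -> /ltW ->.
- exact: continuous_measurable_fun.
Qed.

Lemma ip_eps u e : 0 < e -> ip u u < e ^+ 2 -> nrm (u) < e.
Proof.
move=> e0 ue; rewrite /form_norm -(@ltr_pXn2r _ 2) ?nnegrE ?sqrtr_ge0 ?(ltW e0)//.
by rewrite sqr_sqrtr ?ip_ge0.
Qed.

(** Dominated convergence for the squares: |f_n - f| <= 2 |g|, hence the majorant 4 g^2. *)
Lemma L2_dominated (f_ : nat -> RT -> R) f g : (forall n, measurable_fun setT (f_ n)) ->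
  measurable_fun setT f -> g \in Lfun2 -> (forall n x, `|f_ n x| <= `|g x|) ->
  (forall x, f_ n x @[n --> \oo] --> f x) ->
  forall e, 0 < e -> exists n, nrm (toL2 mu f - toL2 mu (f_ n)) < e.
Proof.
move=> mf_ mf Lg f_le f_cvg e e0.
have f_le' x : `|f x| <= `|g x|.
  apply: (cvgr_to_le (cvg_norm (f_cvg x))).
  by apply: nearW => n; exact: f_le.
have Lf_ n : f_ n \in Lfun2 by apply: Lfun_le Lg.
have Lf : f \in Lfun2 by apply: Lfun_le Lg.
pose d n x := -1 * f_ n x + f x.
have Ld n : d n \in Lfun2 by exact: Lfun_lin.
have md n : measurable_fun setT (fun x => (d n x) ^+ 2).
  by apply: measurable_funX; exact: Lfun2_measurable (Ld n).
have [|||||_ + _] := @dominated_convergence _ _ _ mu setT measurableT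
  (fun n x => ((d n x) ^+ 2)%:E) (cst 0%E) (fun x => (4 * g x ^+ 2)%:E).
- by move=> n; exact/measurable_EFinP.
- exact: measurable_cst.
- apply: aeW => x _; apply: cvg_EFin; first exact: nearW.
  suff d0 : d n x @[n --> \oo] --> (0 : R).
    have : (d^~ x \* d^~ x) n @[n --> \oo] --> (0 * 0 : R) by exact: cvgM.
    by rewrite mulr0.
  have -> : (fun n => d n x) = (fun n => cst (f x) n - f_ n x).
    by apply/funext => n; rewrite /d mulN1r addrC.
  by rewrite -[X in _ --> X](subrr (f x)); apply: cvgB (f_cvg x); exact: cvg_cst.
- have := integrableZl measurableT 4 (Lfun2_integrable_sqr Lg).
  by apply: eq_integrable.
- apply: aeW => x n _; rewrite /= lee_fin ger0_norm ?sqr_ge0//.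
  rewrite -[d n x ^+ 2]real_normK ?num_real// -[g x ^+ 2]real_normK ?num_real//.
  rewrite (_ : 4 = 2 ^+ 2) -?exprMn ?lerXn2r ?nnegrE ?mulr_ge0//; last by ring.
  by apply: le_trans (ler_normD _ _) _; rewrite mulN1r normrN; have := f_le n x;
    have := f_le' x; lra.
- move=> /fine_cvgP[fin_d cvg_d].
  have e20 : 0 < e ^+ 2 by rewrite exprn_gt0.
  have /cvgrPdist_lt /(_ _ e20)[N _ /(_ N (leqnn N))] := cvg_d.
  rewrite /= sub0r normrN => dN; exists N; apply: ip_eps => //.
  rewrite addrC -scaleN1r -toL2_lin// (ipE' (Ld N) (Ld N)).
  apply: le_lt_trans dN; apply: le_trans (ler_norm _).
  rewrite le_eqVlt; apply/orP; left; apply/eqP.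
  congr fine; apply: eq_integral => x _ /=.
  by rewrite subr0 ger0_norm ?sqr_ge0// expr2.
Qed.

Definition test_closure u :=
  forall e, 0 < e -> exists2 phi, test phi & nrm (u - toL2 mu phi) < e.

Lemma test_closure_closed u :
  (forall e, 0 < e -> exists2 v, test_closure v & nrm (u - v) < e) -> test_closure u.
Proof.
move=> u_lim e e0; have e20 : 0 < e / 2 by lra.
have [v /(_ _ e20)[phi tphi vphi] uv] := u_lim _ e20.
exists phi => //; rewrite -(subrKA v).
by apply: le_lt_trans (form_normD (ip_inner mu) _ _) _ => //; lra.
Qed.

Lemma test_closure_lin a u v : test_closure u -> test_closure v ->
  test_closure (a *: u + v).
Proof.
move=> uP vP e e0; have e20 : 0 < e / 2 by lra.
have a0 : 0 < `|a| + 1 by have := normr_ge0 a; lra.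
have [phi tphi uphi] := uP _ (divr_gt0 e20 a0).
have [psi tpsi vpsi] := vP _ e20.
exists (fun x => a * phi x + psi x); first exact: test_lin.
rewrite toL2_lin ?test_Lfun// opprD addrACA -scalerBr.
apply: le_lt_trans (form_normD (ip_inner mu) _ _) _ => //.
rewrite (form_normZ (ip_inner mu))//.
move: uphi; rewrite ltr_pdivlMr// mulrDr mulr1 mulrC => uphi.
have := form_norm_ge0 (@ip _ _ _ mu) (u - toL2 mu phi); lra.
Qed.

Lemma test_closure_test phi : test phi -> test_closure (toL2 mu phi).
Proof.
move=> tphi e e0; exists phi => //; rewrite subrr /form_norm ip0l sqrtr0//.
Qed.

Lemma test_closure_dominated (f_ : nat -> RT -> R) f g :
  (forall n, measurable_fun setT (f_ n)) ->
  measurable_fun setT f -> g \in Lfun2 -> (forall n x, `|f_ n x| <= `|g x|) ->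
  (forall x, f_ n x @[n --> \oo] --> f x) ->
  (forall n, test_closure (toL2 mu (f_ n))) -> test_closure (toL2 mu f).
Proof.
move=> mf_ mf Lg f_le f_cvg f_P; apply: test_closure_closed => e e0.
have [n fn] := L2_dominated mf_ mf Lg f_le f_cvg e0.
by exists (toL2 mu (f_ n)).
Qed.

Lemma norm_indic_le1 (A : set RT) x : `|\1_A x : R| <= `|cst 1 x|.
Proof. by rewrite /= indicE; case: (_ \in _); rewrite ?normr1 ?normr0. Qed.

Lemma cst1_Lfun : cst 1 \in Lfun2.
Proof. by apply: (@bounded_Lfun _ 1) => [|x]; rewrite /= ?normr1. Qed.

(** A cutoff is a test function only when its interval stays away from 0 and l, so ]a, l[ is
    exhausted by intervals shrunk at both ends. *)
Lemma test_closure_itv a : 0 <= a -> a < l -> test_closure (toL2 mu \1_`]a, l[%classic).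
Proof.
move=> a0 al; have open_itv c b : 0 < c -> b < l ->
    test_closure (toL2 mu \1_`]c, b[%classic).
  move=> c0 bl; apply: (@test_closure_dominated (cutoff c b) _ (cst 1)).
  - move=> n; apply: continuous_measurable_fun.
    by apply: (@test_continuous _ l); exact: test_cutoff.
  - exact: measurable_indic.
  - exact: cst1_Lfun.
  - by move=> n x; rewrite /= normr1 ger0_norm ?cutoff_ge0 ?cutoff_le1.
  - move=> x; rewrite indicE mem_setE in_itv.
    have [xcb|xcb] := boolP (c < x < b); first exact: cutoff_cvg.
    under eq_fun do rewrite (cutoff_out _ xcb).
    exact: cvg_cst.
  - by move=> n; apply: test_closure_test; exact: test_cutoff.
pose d n : R := n.+1%:R^-1.
have d0 n : 0 < d n by rewrite invr_gt0.
apply: (@test_closure_dominated (fun n => \1_`](a + d n), (l - d n)[%classic) _ (cst 1)).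
- by move=> n; exact: measurable_indic.
- exact: measurable_indic.
- exact: cst1_Lfun.
- by move=> n x; exact: norm_indic_le1.
- move=> x; apply/cvgrPdist_le => e e0; rewrite !indicE mem_setE in_itv.
  have [/andP[ax xl]|xal] := boolP (a < x < l); last first.
    apply: nearW => n; rewrite indicE mem_setE in_itv/=.
    case: (boolP (_ && _)) => [/andP[h1 h2]|_]; last by rewrite subrr normr0 ltW.
    by have := d0 n; move: xal; rewrite negb_and -!leNgt => /orP[]; lra.
  near=> n; rewrite indicE mem_setE in_itv/=.
  have dn : d n < Num.min (x - a) (l - x).
    near: n; apply: (near_infty_natSinv_lt (PosNum _)).
    by rewrite lt_min !subr_gt0 ax.
  move: dn; rewrite lt_min => /andP[d1 d2].
  by rewrite (_ : (_ < x) && _ = true) ?subrr ?normr0 ?ltW//; lra.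
- by move=> n; apply: open_itv; have := d0 n; lra.
Unshelve. all: by end_near. Qed.

Lemma test_closure0 : test_closure (toL2 mu (fun=> 0)).
Proof.
pose phi : R -> R := cutoff (l / 3) (l / 2) 1.
have tphi : test phi by apply: test_cutoff; move: l0; lra.
have := test_closure_test (test_lin (-1) tphi tphi).
by congr test_closure; congr toL2; apply/funext => x; rewrite mulN1r addNr.
Qed.

(** Dynkin's lemma. The half-lines ]a, +oo[ generate the measurable sets and are stable under
    intersection; inside ]0, l[ they leave nothing, everything or ]a, l[. Complements are linear
    combinations, and countable disjoint unions are dominated limits of finite sums. *)
Lemma test_closure_indic (A : set RT) : measurable A -> test_closure (toL2 mu \1_A).
Proof.
have indicT : test_closure (toL2 mu \1_setT).
  have := test_closure_itv (lexx 0) l0; congr test_closure.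
  apply: toL2_eq; [exact: indic_Lfun..|].
  by apply: eq_itv_ae => x xl; rewrite !indicE in_setT mem_setE in_itv /= xl.
move=> mA; rewrite -[measurable A]/((R.-ocitv.-measurable).-sigma.-measurable A) in mA.
move: mA; rewrite RGenOInfty.measurableE; move: A.
apply: (dynkin_induction (T := RT)) => //.
- exact: RGenOInfty.measurableE.
- move=> _ _ [a ->] [b ->]; exists (Num.max a b).
  by apply/seteqP; split=> x; rewrite /= !in_itv /= !andbT gt_max => /andP.
- move=> _ [a ->]; have [la|al] := leP l a.
    have := test_closure0; congr test_closure; apply: toL2_eq.
    + by apply: (@bounded_Lfun _ 0) => // x; rewrite normr0.
    + exact: indic_Lfun.
    + apply: eq_itv_ae => x /andP[_ xl]; rewrite indicE mem_setE in_itv /= andbT.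
      by rewrite ltNge (le_trans (ltW xl) la).
  have [a0|a0] := leP 0 a.
    have := test_closure_itv a0 al; congr test_closure.
    apply: toL2_eq; [exact: indic_Lfun..|].
    apply: eq_itv_ae => x /andP[_ xl]; rewrite !indicE !mem_setE !in_itv /=.
    by rewrite xl.
  move: indicT; congr test_closure; apply: toL2_eq; [exact: indic_Lfun..|].
  apply: eq_itv_ae => x /andP[x0 _]; rewrite !indicE in_setT mem_setE in_itv /=.
  by rewrite andbT (lt_trans a0 x0).
- move=> S mS SP; have := test_closure_lin (-1) SP indicT.
  rewrite -toL2_lin ?indic_Lfun//; congr test_closure; congr toL2.
  apply/funext => x; rewrite !indicE in_setC; case: (x \in S) => /=.
    by rewrite in_setT mulr1 addNr.
  by rewrite in_setT mulr0 add0r.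
- move=> F mF tF FP; pose U n := \big[setU/set0]_(k < n) F k.
  have mU n : measurable (U n) by apply: bigsetU_measurable => k _; exact: mF.
  have UP n : test_closure (toL2 mu \1_(U n)).
    elim: n => [|n IH].
      by rewrite /U big_ord0 (_ : \1_set0 = fun=> 0) ?indic0//; exact: test_closure0.
    have := test_closure_lin 1 IH (FP n).
    rewrite -toL2_lin ?indic_Lfun//; congr test_closure; congr toL2.
    apply/funext => x; rewrite /U big_ord_recr /= !indicE mul1r in_setU.
    have [xU|xU] := boolP (x \in \big[setU/set0]_(k < n) F k); last first.
      by rewrite add0r orFb.
    rewrite (_ : x \in F n = false) ?addr0//; apply/negbTE/negP => /set_mem xFn.
    move: xU => /set_mem; rewrite -bigcup_mkord => -[k /= kn xFk].
    have := tF k n I I; move/(_ (ex_intro _ x (conj xFk xFn))) => kE.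
    by move: kn; rewrite kE ltnn.
  apply: (@test_closure_dominated (fun n => \1_(U n)) _ (cst 1)) => //.
  + by apply: measurable_indic; exact: bigcup_measurable.
  + exact: cst1_Lfun.
  + by move=> n x; exact: norm_indic_le1.
  + move=> x; have [|xF] := pselect ((\bigcup_k F k) x).
      move=> [k _ xFk]; rewrite indicE mem_set; last by exists k.
      apply: cvg_near_cst; exists k.+1 => // n /= kn.
      by rewrite indicE mem_set// /U -bigcup_mkord; exists k.
    rewrite indicE memNset//; apply: cvg_near_cst; apply: nearW => n.
    rewrite indicE memNset// /U -bigcup_mkord => -[k _ xFk].
    by apply: xF; exists k.
Qed.

Import HBNNSimple.

Lemma test_closure_nnsfun (f : {nnsfun RT >-> R}) : test_closure (toL2 mu f).
Proof.
rewrite (_ : toL2 mu f = toL2 mu (fun x =>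
    \sum_(y <- finmap.enum_fset (fset_set (range f))) y * \1_(f @^-1` [set y]) x)); last first.
  by congr toL2; apply/funext => x; rewrite fimfunE fsbig_finite.
elim: (finmap.enum_fset _) => [|y s IH].
  by under eq_fun do rewrite big_nil; exact: test_closure0.
have mA : measurable (f @^-1` [set y]) by exact: measurable_sfunP.
have mS (r : seq R) : measurable_fun setT
    (fun x => \sum_(z <- r) z * \1_(f @^-1` [set z]) x).
  apply: measurable_sum => z; apply: measurable_funM; first exact: measurable_cst.
  by apply: measurable_indic; exact: measurable_sfunP.
have LS (r : seq R) : (fun x => \sum_(z <- r) z * \1_(f @^-1` [set z]) x) \in Lfun2.
  apply: (@bounded_Lfun _ (\sum_(z <- r) `|z|)) => // x.
  apply: le_trans (ler_norm_sum _ _ _) _; apply: ler_sum => z _.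
  by rewrite normrM ler_piMr// indicE; case: (_ \in _); rewrite ?normr1 ?normr0.
have := test_closure_lin y (test_closure_indic mA) IH.
rewrite -toL2_lin ?indic_Lfun//; congr test_closure; congr toL2.
by apply/funext => x; rewrite big_cons.
Qed.

Lemma test_closure_ge0 (f : RT -> R) : f \in Lfun2 -> (forall x, 0 <= f x) ->
  test_closure (toL2 mu f).
Proof.
move=> Lf f0; have mf := Lfun2_measurable Lf.
have mEf : measurable_fun setT (EFin \o f) by exact/measurable_EFinP.
have f0' x : setT x -> (0 <= (EFin \o f) x)%E by rewrite /= lee_fin.
pose f_ n := nnsfun_approx measurableT mEf n.
apply: (@test_closure_dominated (fun n => f_ n : RT -> R) _ f) => //.
- move=> n x; rewrite !ger0_norm//.
  by have := le_approx n f0' (I : setT x); rewrite lee_fin /f_ nnsfun_approxE.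
- move=> x; have /fine_cvgP[_] := cvg_nnsfun_approx measurableT mEf f0' (I : setT x).
  by apply: cvg_trans.
- by move=> n; exact: test_closure_nnsfun.
Qed.

Lemma test_dense u : test_closure u.
Proof.
have Lu := L2_Lfun u; have mu' := Lfun2_measurable Lu.
pose p x := Num.max (u x) 0; pose q x := Num.max (- u x) 0.
have p0 x : 0 <= p x by rewrite le_max lexx orbT.
have q0 x : 0 <= q x by rewrite le_max lexx orbT.
have Lp : p \in Lfun2.
  apply: (Lfun_le _ _ Lu); first exact: measurable_maxr.
  by move=> x; rewrite ger0_norm// /p ge_max ler_norm normr_ge0.
have Lq : q \in Lfun2.
  apply: (Lfun_le _ _ Lu).
    by apply: measurable_maxr => //; exact: measurableT_comp.
  by move=> x; rewrite ger0_norm// /q ge_max -normrN ler_norm normr_ge0.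
have := test_closure_lin (-1) (test_closure_ge0 Lq q0) (test_closure_ge0 Lp p0).
rewrite -toL2_lin// -[u in X in _ -> X]toL2K; congr test_closure; congr toL2.
apply/funext => x; rewrite /p /q mulN1r.
have [u0|u0] := leP (u x) 0.
  by rewrite max_l ?oppr_ge0// opprK addr0.
by rewrite max_r ?oppr_le0 ?ltW// oppr0 add0r.
Qed.

(** If u is orthogonal to phi, then ip u u = ip u (u - phi), which is arbitrarily small by density
    and Cauchy-Schwarz. *)
Lemma test_ortho u : (forall phi, test phi -> ip u (toL2 mu phi) = 0) -> u = 0.
Proof.
move=> u0; apply: ip_eq0; apply/eqP; rewrite eq_le ip_ge0 andbT.
apply/ler_addgt0Pr => e e0; rewrite add0r.
have n0 : 0 < nrm u + 1 by have := form_norm_ge0 (@ip _ _ _ mu) u; lra.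
have [phi tphi uphi] := test_dense u (divr_gt0 e0 n0).
have := form_CS (ip_inner mu) (x := u) (y := u - toL2 mu phi) I I.
rewrite ipDr ipNr u0// subr0 => /le_trans; apply.
move: uphi; rewrite ltr_pdivlMr// => uphi.
have := form_norm_ge0 (@ip _ _ _ mu) (u - toL2 mu phi).
by move: uphi; rewrite mulrDr mulr1 mulrC; lra.
Qed.

End TestDensity.

(** * Primitives and weak derivatives *)

Section Primitive.
Context {R : realType}.
Variable l : R.
Hypothesis l0 : 0 < l.
Local Notation mu := (mu_itv l).
Local Notation leb := (@lebesgue_measure R).
Local Notation RT := (measurableTypeR R).
Local Notation test := (test_function l).
Local Notation Lfun2 := (Lfun mu 2%:E).
Local Notation nrm := (form_norm (@ip _ _ _ mu)).
Implicit Types (f g phi psi : RT -> R) (u v : L2 mu) (x y : R).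

(** Bridge from the restricted measure on the whole line to integrals over an interval, to which the
    fundamental theorem of calculus applies. *)
Lemma Rint_itv f : measurable_fun setT f ->
  \int[mu]_x f x = \int[leb]_(x in `]0, l[) f x.
Proof.
move=> mf; pose D := (`]0, l[%classic : set RT).
have mD : measurable D by exact: measurable_itv.
transitivity (\int[mu]_(x in D) f x).
  rewrite [RHS]Rintegral_mkcond; apply: ae_Rintegral => //.
    by apply/(measurable_restrictT _ _).1 => //; exact: measurable_funTS.
  apply: (eq_itv_ae) => x xl; rewrite patchE mem_set//.
congr fine; apply: eq_measure_integral => A mA AD.
by rewrite -[LHS]/(leb (A `&` _ : set R)); congr leb; exact: setIidl.
Qed.

(** The primitive of v that vanishes at 0. Written as an inner product with an indicator, it
    inherits linearity and Cauchy-Schwarz; it is constant on either side of ]0, l[. *)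
Definition prm v x : R := ip v (toL2 mu \1_(`]0, x[%classic : set RT)).

Definition one : L2 mu := toL2 mu (cst 1).

Lemma prm_lin a u v x : prm (a *: u + v) x = a * prm u x + prm v x.
Proof. exact: ip_linl. Qed.

Lemma prm_out v x : x <= 0 -> prm v x = 0.
Proof.
move=> x0; rewrite /prm set_itv_ge; last by rewrite bnd_simp -leNgt.
rewrite indic0 (_ : toL2 mu (cst 0) = 0) ?ip0r//.
have L0 : (cst 0 : RT -> R) \in Lfun2.
  by apply: (@bounded_Lfun _ _ l0 _ 0) => //= y; rewrite normr0.
have := toL2_lin (-1) L0 L0; rewrite scaleN1r addNr => <-.
by congr toL2; apply/funext => y /=; rewrite mulr0 addr0.
Qed.

Lemma prm_indic_diff x y : x <= y ->
  toL2 mu \1_(`]0, y[%classic : set RT) - toL2 mu \1_(`]0, x[%classic : set RT) =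
  toL2 mu \1_(`]0, y[%classic `\` `]0, x[%classic : set RT).
Proof.
move=> xy; rewrite addrC -scaleN1r -toL2_lin ?indic_Lfun//.
congr toL2; apply/funext => z; rewrite !indicE in_setD !mem_setE !in_itv /=.
have [z0|] := boolP (0 < z) => /=; last by rewrite mulr0 add0r.
have [zx|xz] := ltP z x; last by rewrite mulr0 add0r andbT.
by rewrite (lt_le_trans zx xy) mulr1 addNr.
Qed.

Lemma ip_indic (A : set RT) : measurable A ->
  ip (toL2 mu \1_A) (toL2 mu \1_A) = fine (mu A).
Proof.
move=> mA; rewrite ipE' ?indic_Lfun//.
rewrite (@eq_Rintegral _ _ _ _ _ \1_A) ?Rintegral_indic//; last first.
  by move=> z _; rewrite indicE; case: (_ \in _); rewrite ?mulr1 ?mulr0.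
by rewrite /Rintegral integral_indic// setIT.
Qed.

(** Cauchy-Schwarz against the indicator of the difference set, of measure at most y - x: a
    primitive is Hölder continuous of exponent 1/2. *)
Lemma prm_dist_sqr v x y : x <= y -> (prm v y - prm v x) ^+ 2 <= (y - x) * ip v v.
Proof.
move=> xy; rewrite /prm -ipNr -ipDr prm_indic_diff//.
set A := _ `\` _; have mA : measurable A by exact: measurableD.
have CS : (ip v (toL2 mu \1_A)) ^+ 2 <= ip v v * ip (toL2 mu \1_A) (toL2 mu \1_A).
  have := form_CS (ip_inner mu) (x := v) (y := toL2 mu \1_A) I I.
  have := form_CS (ip_inner mu) (x := - v) (y := toL2 mu \1_A) I I.
  have -> : nrm (- v) = nrm v.
    by rewrite -scaleN1r (form_normZ (ip_inner mu))// normrN1 mul1r.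
  rewrite ipNl => h1 h2.
  rewrite -!(form_norm_sqr (ip_inner mu))// -exprMn -real_normK ?num_real//.
  by rewrite lerXn2r ?nnegrE ?mulr_ge0 ?form_norm_ge0// ler_norml; lra.
apply: le_trans CS _; rewrite mulrC ler_wpM2r ?ip_ge0// ip_indic//.
have A_sub : A `<=` (`[x, y[%classic : set RT).
  move=> z [] /=; rewrite !in_itv /= => /andP[z0 zy] /negP.
  by rewrite z0 /= -leNgt zy andbT.
apply: (@le_trans _ _ (fine (leb (`[x, y[%classic : set R)))); last first.
  rewrite lebesgue_measure_itv /= lte_fin; case: ltP => //= yx; lra.
apply: fine_le.
- rewrite ge0_fin_numE//; apply: le_lt_trans (_ : mu setT < +oo)%E.
    by apply: le_measure; rewrite ?inE.
  by rewrite mu_itvT// ltry.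
- by rewrite lebesgue_measure_itv; case: ifP.
- rewrite -[leLHS]/(leb (A `&` _ : set R)); apply: le_measure; rewrite ?inE//.
    exact: measurableI.
  by move=> z [/A_sub].
Qed.

Lemma prm_sqr_le v x : 0 <= x -> (prm v x) ^+ 2 <= x * ip v v.
Proof.
by move=> x0; have := prm_dist_sqr v x0; rewrite (prm_out v (lexx 0)) !subr0.
Qed.

Lemma prm_ge v x : l <= x -> prm v x = prm v l.
Proof.
move=> lx; rewrite /prm; congr ip; apply: toL2_eq; [exact: indic_Lfun..|].
apply: eq_itv_ae => z /andP[z0 zl]; rewrite !indicE !mem_setE !in_itv /= z0 zl.
by rewrite (lt_le_trans zl lx).
Qed.

Lemma prm_l v : prm v l = ip v one.
Proof.
rewrite /prm; congr ip; apply: toL2_eq; [exact: indic_Lfun|exact: cst1_Lfun|].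
by apply: eq_itv_ae => z zl; rewrite !indicE !mem_setE !in_itv /= zl.
Qed.

Lemma prm_continuous v : continuous (prm v).
Proof.
move=> x; apply/cvgrPdist_lt => e e0.
have c0 : 0 < ip v v + 1 by have := ip_ge0 v; lra.
near=> y.
have xy : `|x - y| < e ^+ 2 / (ip v v + 1).
  near: y; apply/nbhs_ballP; exists (e ^+ 2 / (ip v v + 1)) => //=.
  by rewrite divr_gt0 ?exprn_gt0.
rewrite -(@ltr_pXn2r _ 2) ?nnegrE ?(ltW e0)// real_normK ?num_real//.
apply: (@le_lt_trans _ _ (`|x - y| * ip v v)).
  have [le_xy|/ltW le_yx] := leP x y.
    by rewrite distrC ger0_norm ?subr_ge0// -sqrrN opprB prm_dist_sqr.
  by rewrite ger0_norm ?subr_ge0// prm_dist_sqr.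
move: xy; rewrite ltr_pdivlMr// mulrDr mulr1; have := normr_ge0 (x - y); lra.
Unshelve. all: by end_near. Qed.

Lemma prm_bound v x : `|prm v x| <= Num.sqrt (l * ip v v).
Proof.
have l_ge0 := ltW l0; have l1 : 0 <= l * ip v v by rewrite mulr_ge0 ?ip_ge0.
have bound y : 0 <= y -> y <= l -> `|prm v y| <= Num.sqrt (l * ip v v).
  move=> y0 yl; rewrite -sqrtr_sqr ler_wsqrtr//.
  by apply: le_trans (prm_sqr_le v y0) _; rewrite ler_wpM2r ?ip_ge0.
have [x0|x0] := leP x 0; first by rewrite prm_out// normr0 sqrtr_ge0.
have [xl|lx] := leP x l; first by apply: bound => //; exact: ltW.
by rewrite (prm_ge _ (ltW lx)) bound.
Qed.

Lemma prm_Lfun v : (prm v : RT -> R) \in Lfun2.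
Proof.
apply: (@bounded_Lfun _ _ l0 _ (Num.sqrt (l * ip v v))); last exact: prm_bound.
exact: continuous_measurable_fun (@prm_continuous v).
Qed.

Lemma ip_bound f c : f \in Lfun2 -> (forall x, `|f x| <= c) ->
  ip (toL2 mu f) (toL2 mu f) <= c ^+ 2 * l.
Proof.
move=> Lf fc; have Lc : cst c \in Lfun2.
  by apply: (@bounded_Lfun _ _ l0 _ `|c|) => // x.
rewrite ipE'//; apply: (@le_trans _ _ (\int[mu]_x (cst c x * cst c x))).
  apply: le_Rintegral => //; [exact: Lfun_mul_integrable..|].
  move=> x _; rewrite /= -!expr2 -real_normK ?num_real// lerXn2r ?nnegrE//.
  exact: le_trans (fc x).
rewrite (@eq_Rintegral _ _ _ _ _ (cst (c ^+ 2))); last by move=> x _; rewrite /= expr2.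
by rewrite Rintegral_cst// mu_itvT.
Qed.

Definition Prm v : L2 mu := toL2 mu (prm v).

Lemma Prm_lin a u v : Prm (a *: u + v) = a *: Prm u + Prm v.
Proof.
rewrite /Prm -toL2_lin ?prm_Lfun//; congr toL2; apply/funext => x.
exact: prm_lin.
Qed.

Lemma Prm_le v : ip (Prm v) (Prm v) <= l ^+ 2 * ip v v.
Proof.
apply: le_trans (ip_bound (prm_Lfun v) (prm_bound v)) _.
rewrite sqr_sqrtr ?mulr_ge0 ?ip_ge0 ?(ltW l0)//.
by rewrite le_eqVlt; apply/orP; left; apply/eqP; ring.
Qed.

Lemma prmE f x : f \in Lfun2 -> x <= l ->
  prm (toL2 mu f) x = \int[leb]_(y in `]0, x[) f y.
Proof.
move=> Lf xl; have mf := Lfun2_measurable Lf.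
rewrite /prm ipE' ?indic_Lfun// Rint_itv; last first.
  by apply: measurable_funM => //; exact: measurable_indic.
rewrite (@eq_Rintegral _ _ _ _ _ (f \_ (`]0, x[%classic : set RT))); last first.
  move=> y _; rewrite patchE indicE; case: (_ \in _); by rewrite ?mulr1 ?mulr0.
rewrite -Rintegral_mkcondr; congr Rintegral; apply/seteqP; split=> y /=.
  by case.
rewrite !in_itv /= => /andP[y0 yx]; rewrite y0 yx; split=> //.
exact: lt_le_trans xl.
Qed.

Lemma prm_FTC (F f : R -> R) : (forall x, is_derive x 1 F (f x)) -> continuous f ->
  (f : RT -> R) \in Lfun2 ->
  forall x, 0 <= x <= l -> prm (toL2 mu f) x = F x - F 0.
Proof.
move=> dF cf Lf x /andP[x0 xl].
have [->|xN0] := eqVneq x 0; first by rewrite prm_out// subrr.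
have {xN0}x0' : 0 < x by rewrite lt_neqAle eq_sym xN0.
have cF : continuous F.
  move=> y; apply/differentiable_continuous/derivable1_diffP.
  by have [] := dF y.
have cW : {within `[0, x], continuous f} by exact: continuous_subspaceT.
have iab : leb.-integrable `[0, x] (EFin \o f).
  by apply: continuous_compact_integrable => //; exact: segment_compact.
rewrite prmE// Rintegral_itv_bndo_bndc; last first.
  by apply: integrableS iab => //; exact: subset_itv_oo_cc.
rewrite Rintegral_itv_obnd_cbnd; last first.
  by apply: integrableS iab => //; exact: subset_itv_oc_cc.
rewrite /Rintegral (continuous_FTC2 x0' cW (F := F))//.
  split; first by move=> y _; have [] := dF y.
    by apply: cvg_at_right_filter; exact: cF.
  by apply: cvg_at_left_filter; exact: cF.
by move=> y _; rewrite derive1E derive_val.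
Qed.

Section TestPrimitive.
Variable phi : R -> R.
Hypothesis tphi : test phi.

(** Integrating from -oo makes every real x a point where the integral can be differentiated, so the
    primitive is smooth on the whole line; on [0, l] it agrees with [prm]. *)
Definition test_prim x : R := \int[leb]_(y in `]-oo, x]) phi y.

Lemma test_integrable : leb.-integrable setT (EFin \o phi).
Proof.
have cphi := test_continuous tphi.
have : leb.-integrable `[0, l] (EFin \o phi).
  apply: continuous_compact_integrable; first exact: segment_compact.
  exact: continuous_subspaceT.
move=> h; have := proj1 (integrable_mkcond (mu := leb) (EFin \o phi) (measurable_itv `[0, l])) h.
congr integrable.
apply/funext => x; rewrite patchE; case: ifPn => // xl.
rewrite /= (test_out tphi)//; apply: contra xl => /andP[x0 xl].
by rewrite mem_setE in_itv /= !ltW.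
Qed.

Lemma test_prim_derive x : is_derive x 1 test_prim (phi x).
Proof.
have [||||dF F'] := @continuous_FTC1 R phi -oo%O x (x + 1).
- by rewrite ltrDl.
- exact: integrableS test_integrable.
- exact: ltNyr.
- exact: test_continuous tphi x.
by apply: DeriveDef; [exact: dF|rewrite -derive1E; exact: F'].
Qed.

Lemma test_prim_smooth : smooth test_prim.
Proof.
case/(testP l): tphi => sphi _ [//|n].
exact: Cn_derive test_prim_derive (sphi n).
Qed.

Lemma test_primE x : 0 <= x <= l -> test_prim x = prm (toL2 mu phi) x.
Proof.
move=> xl; rewrite (prm_FTC test_prim_derive) ?test_Lfun//; last first.
  exact: test_continuous tphi.
suff -> : test_prim 0 = 0 by rewrite subr0.
rewrite /test_prim Rintegral_mkcond /Rintegral integral0_eq// => y _.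
rewrite patchE; case: ifPn => // /set_mem; rewrite /= in_itv /= => y0.
by rewrite (test_out tphi)// negb_and -leNgt y0.
Qed.

(** To the left of the support of phi the primitive is 0, and to the right it equals the total
    integral, here assumed to vanish. *)
Lemma test_prim_test : ip (toL2 mu phi) one = 0 -> test test_prim.
Proof.
move=> phi0; apply/testP; split; first exact: test_prim_smooth.
case/(testP l): tphi => _ [a [b [a0 bl out]]]; exists a, b; split=> // x xab.
have [xa|ax] := ltP x a.
  rewrite /test_prim Rintegral_mkcond /Rintegral integral0_eq// => y _.
  rewrite patchE; case: ifPn => // /set_mem; rewrite /= in_itv /= => yx.
  by rewrite out// negb_and -ltNge (le_lt_trans yx xa).
have bx : b < x by move: xab; rewrite ax /= -ltNge.
transitivity (test_prim l); last first.
  by rewrite test_primE ?(ltW l0) ?lexx// prm_l.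
rewrite /test_prim Rintegral_mkcond [RHS]Rintegral_mkcond; apply: eq_Rintegral => y _.
rewrite !patchE !mem_setE !in_itv /=.
have [yb|yb] := leP y b; first by rewrite !(le_trans yb) ?ltW.
rewrite out; first by do 2 case: ifP.
by rewrite negb_and -!ltNge yb orbT.
Qed.

End TestPrimitive.

(** Approximation in the second argument, then in the first. It reduces integration by parts in L^2
    to the product rule for smooth functions. *)
Lemma test_bilinear (B : L2 mu -> L2 mu -> R) C :
  (forall a u v w, B (a *: u + v) w = a * B u w + B v w) ->
  (forall a u v w, B w (a *: u + v) = a * B w u + B w v) ->
  (forall u v, `|B u v| <= C * (nrm u * nrm v)) ->
  (forall phi psi, test phi -> test psi -> B (toL2 mu phi) (toL2 mu psi) = 0) ->
  forall u v, B u v = 0.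
Proof.
move=> Bl Br B_le B0 u v.
have C0 : 0 <= `|C| + 1 by have := normr_ge0 C; lra.
have {}B_le a b : `|B a b| <= (`|C| + 1) * (nrm a * nrm b).
  apply: le_trans (B_le _ _) _; rewrite ler_wpM2r ?mulr_ge0 ?form_norm_ge0//.
  by have := ler_norm C; lra.
have {}C0 : 0 < `|C| + 1 by have := normr_ge0 C; lra.
move: (`|C| + 1) C0 B_le => {}C C0 B_le.
have half phi w : test phi -> B (toL2 mu phi) w = 0.
  move=> tphi; apply/eqP; rewrite -normr_eq0 eq_le normr_ge0 andbT.
  apply/ler_addgt0Pr => e e0; rewrite add0r.
  have n0 : 0 < C * (nrm (toL2 mu phi) + 1).
    by rewrite mulr_gt0//; have := form_norm_ge0 (@ip _ _ _ mu) (toL2 mu phi); lra.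
  have [psi tpsi wpsi] := test_dense l0 w (divr_gt0 e0 n0).
  have -> : B (toL2 mu phi) w = B (toL2 mu phi) (w - toL2 mu psi).
    by rewrite addrC -scaleN1r Br B0// mulr0 add0r.
  apply: le_trans (B_le _ _) _; move: wpsi; rewrite ltr_pdivlMr//.
  have := form_norm_ge0 (@ip _ _ _ mu) (w - toL2 mu psi).
  move: (nrm (w - _)) (nrm (toL2 mu phi)) => y x y0 xy; have : 0 <= C * y by rewrite mulr_ge0// ltW.
  have : y * (C * (x + 1)) = C * (x * y) + C * y by ring.
  by lra.
apply/eqP; rewrite -normr_eq0 eq_le normr_ge0 andbT.
apply/ler_addgt0Pr => e e0; rewrite add0r.
have n0 : 0 < C * (nrm v + 1).
  by rewrite mulr_gt0//; have := form_norm_ge0 (@ip _ _ _ mu) v; lra.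
have [psi tpsi wpsi] := test_dense l0 u (divr_gt0 e0 n0).
have -> : B u v = B (u - toL2 mu psi) v.
  by rewrite addrC -scaleN1r Bl half// mulr0 add0r.
apply: le_trans (B_le _ _) _; move: wpsi; rewrite ltr_pdivlMr//.
have := form_norm_ge0 (@ip _ _ _ mu) (u - toL2 mu psi).
move: (nrm (u - _)) (nrm v) => y x y0 xy; have : 0 <= C * y by rewrite mulr_ge0// ltW.
have : y * (C * (x + 1)) = C * (y * x) + C * y by ring.
by lra.
Qed.

Lemma Prm_test phi : test phi -> Prm (toL2 mu phi) = toL2 mu (test_prim phi).
Proof.
move=> tphi; have eq_prim : (prm (toL2 mu phi) : RT -> R) = test_prim phi %[ae mu].
  by apply: eq_itv_ae => x /andP[x0 xl]; rewrite test_primE// !ltW.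
apply: toL2_eq => //; first exact: prm_Lfun.
apply: Lfun_ae eq_prim (prm_Lfun _).
apply: continuous_measurable_fun => x.
apply/differentiable_continuous/derivable1_diffP.
by have [] := test_prim_derive tphi x.
Qed.

Lemma abs_form_CS u v : `|ip u v| <= nrm u * nrm v.
Proof.
have nN : nrm (- u) = nrm u.
  by rewrite -scaleN1r (form_normZ (ip_inner mu))// normrN1 mul1r.
have := form_CS (ip_inner mu) (x := u) (y := v) I I.
have := form_CS (ip_inner mu) (x := - u) (y := v) I I.
by rewrite nN ipNl ler_norml; lra.
Qed.

Lemma nrm_Prm v : nrm (Prm v) <= l * nrm v.
Proof.
have l_ge0 := ltW l0; have l1 : 0 <= l * nrm v by rewrite mulr_ge0 ?form_norm_ge0.
rewrite -(@ler_pXn2r _ 2) ?nnegrE ?form_norm_ge0// exprMn.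
by rewrite !(form_norm_sqr (ip_inner mu))//; exact: Prm_le.
Qed.

Lemma nrm_one : nrm one = Num.sqrt l.
Proof.
rewrite /form_norm; congr Num.sqrt; rewrite /one ipE' ?cst1_Lfun//.
rewrite (@eq_Rintegral _ _ _ _ _ (cst 1)); last by move=> z _ /=; rewrite mulr1.
by rewrite Rintegral_cst// mul1r mu_itvT.
Qed.

(** The difference of the two sides is bounded and bilinear; for test functions the identity is the
    fundamental theorem of calculus for the product of the two primitives. *)
Lemma prm_ibp u v : prm u l * prm v l = ip u (Prm v) + ip (Prm u) v.
Proof.
apply/eqP; rewrite -subr_eq0; apply/eqP.
(* Each of the three terms is at most l times the product of the norms. *)
apply: (@test_bilinear (fun u v => prm u l * prm v l - (ip u (Prm v) + ip (Prm u) v))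
  (3 * l)) => {u v} [a u v w|a u v w|u v|phi psi tphi tpsi].
- rewrite prm_lin Prm_lin !ip_linl.
  move: (prm _ _) (prm _ _) (prm _ _) (ip _ _) (ip _ _) (ip _ _) (ip _ _) => *.
  by ring.
- rewrite prm_lin Prm_lin !ip_linr.
  move: (prm _ _) (prm _ _) (prm _ _) (ip _ _) (ip _ _) (ip _ _) (ip _ _) => *.
  by ring.
- have b1 w : `|prm w l| <= Num.sqrt l * nrm w.
    by rewrite prm_l; apply: le_trans (abs_form_CS _ _) _; rewrite nrm_one mulrC.
  have nu := form_norm_ge0 (@ip _ _ _ mu) u.
  have nv := form_norm_ge0 (@ip _ _ _ mu) v.
  apply: le_trans (ler_normB _ _) _.
  have h1 : `|prm u l * prm v l| <= l * (nrm u * nrm v).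
    rewrite normrM; apply: (@le_trans _ _ ((Num.sqrt l * nrm u) * (Num.sqrt l * nrm v))).
      by apply: ler_pM => //; exact: b1.
    by rewrite mulrACA -expr2 sqr_sqrtr// ltW.
  have h2 : `|ip u (Prm v)| <= l * (nrm u * nrm v).
    apply: le_trans (abs_form_CS _ _) _; rewrite mulrCA ler_wpM2l//.
    exact: nrm_Prm.
  have h3 : `|ip (Prm u) v| <= l * (nrm u * nrm v).
    apply: le_trans (abs_form_CS _ _) _; rewrite mulrA ler_wpM2r//.
    exact: nrm_Prm.
  have := ler_normD (ip u (Prm v)) (ip (Prm u) v).
  by rewrite -mulrA; move: (l * (_ * _)) h1 h2 h3 => c; lra.
- rewrite !Prm_test//.
  pose F x := test_prim phi x * test_prim psi x.
  pose f x := test_prim phi x * psi x + test_prim psi x * phi x.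
  have dF x : is_derive x 1 F (f x).
    have d1 := test_prim_derive tphi x; have d2 := test_prim_derive tpsi x.
    exact: (is_deriveM d1 d2).
  have cp g : test g -> continuous (test_prim g).
    move=> tg x; apply/differentiable_continuous/derivable1_diffP.
    by have [] := test_prim_derive tg x.
  have cphi := test_continuous tphi; have cpsi := test_continuous tpsi.
  have cf : continuous f.
    move=> x; apply: cvgD.
      by apply: cvgM; [exact: (cp _ tphi)|exact: cpsi].
    by apply: cvgM; [exact: (cp _ tpsi)|exact: cphi].
  have mf g : continuous g -> measurable_fun setT (g : RT -> R).
    exact: continuous_measurable_fun.
  have LP g : test g -> (test_prim g : RT -> R) \in Lfun2.
    move=> tg; apply: Lfun_ae (prm_Lfun (toL2 mu g)); first by apply: mf; exact: (cp _ tg).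
    by apply: eq_itv_ae => x /andP[x0 xl]; rewrite test_primE// !ltW.
  have LM g h : test g -> test h ->
      ((fun x => test_prim g x * h x) : RT -> R) \in Lfun2.
    move=> tg th; pose c := Num.sqrt (l * ip (toL2 mu g) (toL2 mu g)).
    have Lh := test_Lfun l0 th.
    have L' : ((fun x => prm (toL2 mu g) x * h x) : RT -> R) \in Lfun2.
      apply: (@Lfun_le _ _ _ _ _ ((c \o* h) : RT -> R)).
      + apply: measurable_funM; last exact: (Lfun2_measurable Lh).
        exact: (Lfun2_measurable (prm_Lfun _)).
      + move=> x; rewrite /= mulrC !normrM ler_wpM2l// (le_trans (prm_bound _ _))//.
        exact: ler_norm.
      + by apply: (Lfun_scale c (_ : (1 <= (2 : R))%R) Lh); rewrite ler1n.
    refine (Lfun_ae _ _ L').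
      by apply: mf => x; apply: cvgM; [exact: (cp _ tg)|exact: (test_continuous th)].
    by apply: eq_itv_ae => x /andP[x0 xl]; rewrite test_primE// !ltW.
  have ip_one g h : g \in Lfun2 -> h \in Lfun2 -> (fun x => g x * h x) \in Lfun2 ->
      ip (toL2 mu (fun x => g x * h x)) one = ip (toL2 mu g) (toL2 mu h).
    move=> Lg Lh Lgh; rewrite /one !ipE' ?cst1_Lfun//.
    by apply: eq_Rintegral => x _ /=; rewrite mulr1.
  have fE : f = fun x => 1 * (test_prim phi x * psi x) + test_prim psi x * phi x.
    by apply/funext => x; rewrite mul1r.
  have Lf : (f : RT -> R) \in Lfun2 by rewrite fE; apply: Lfun_lin; exact: LM.
  have l_ge0 : 0 <= (0 : R) <= l by rewrite lexx ltW.
  have ll : 0 <= l <= l by rewrite lexx ltW.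
  have := prm_FTC dF cf Lf ll; rewrite prm_l /F !test_primE//.
  rewrite (prm_out _ (lexx 0)) mul0r subr0 => <-.
  rewrite fE toL2_lin ?LM// ip_linl mul1r !ip_one ?LM ?LP ?test_Lfun//.
  by rewrite [ip (toL2 mu (test_prim psi)) _]ip_sym; apply/eqP; rewrite subr_eq0 addrC.
Qed.

End Primitive.

Section WeakDerivative.
Context {R : realType}.
Variable l : R.
Hypothesis l0 : 0 < l.
Local Notation mu := (mu_itv l).
Local Notation leb := (@lebesgue_measure R).
Local Notation RT := (measurableTypeR R).
Local Notation test := (test_function l).
Local Notation Lfun2 := (Lfun mu 2%:E).
Local Notation nrm := (form_norm (@ip _ _ _ mu)).
Local Notation one := (@one R l).
Implicit Types (phi psi : R -> R) (u v w : L2 mu) (x y : R).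

Lemma weak_derivativeP u v : is_weak_derivative u v <-> forall phi, test phi ->
  ip u (toL2 mu (derive1 phi)) = - ip v (toL2 mu phi).
Proof.
split=> uv phi tphi; have := uv phi tphi; have tphi' := test_derive1 tphi.
  by rewrite !ipE ?test_Lfun.
by rewrite !ipE ?test_Lfun.
Qed.

Lemma weak_derivative_unique u v w :
  is_weak_derivative u v -> is_weak_derivative u w -> v = w.
Proof.
move=> /weak_derivativeP uv /weak_derivativeP uw; apply/eqP; rewrite -subr_eq0.
apply/eqP; apply: (test_ortho l0) => phi tphi.
by rewrite ipDl ipNl -[ip v _]opprK -uv// -[ip w _]opprK -uw// subrr.
Qed.

Lemma wDE u v : is_weak_derivative u v -> wD u = v.
Proof. by move=> uv; apply: xget_unique => // w uw; exact: weak_derivative_unique uw uv. Qed.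

Definition weakly_derivable u := exists v, is_weak_derivative u v.

Lemma wDP u : weakly_derivable u -> is_weak_derivative u (wD u).
Proof. by case=> v uv; rewrite (wDE uv). Qed.

Lemma weak_derivative_lin a u v u' v' :
  is_weak_derivative u u' -> is_weak_derivative v v' ->
  is_weak_derivative (a *: u + v) (a *: u' + v').
Proof.
move=> /weak_derivativeP uu' /weak_derivativeP vv'; apply/weak_derivativeP.
by move=> phi tphi; rewrite !ip_linl uu'// vv'// mulrN opprD.
Qed.

Lemma wD_lin a u v : weakly_derivable u -> weakly_derivable v ->
  wD (a *: u + v) = a *: wD u + wD v.
Proof. by move=> /wDP uu' /wDP vv'; apply: wDE; exact: weak_derivative_lin. Qed.

Lemma weakly_derivable_lin a u v : weakly_derivable u -> weakly_derivable v ->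
  weakly_derivable (a *: u + v).
Proof.
by move=> /wDP uu' /wDP vv'; exists (a *: wD u + wD v); exact: weak_derivative_lin.
Qed.

Lemma prm_derive1 phi x : test phi -> 0 <= x <= l ->
  prm (toL2 mu (derive1 phi)) x = phi x.
Proof.
move=> tphi xl; have t' := test_derive1 tphi.
have d1 y : is_derive y 1 phi (derive1 phi y).
  by apply: is_derive_derive1; exact: (@test_derivable _ l).
rewrite (prm_FTC l0 d1) ?test_Lfun//; last exact: test_continuous t'.
by rewrite (test_out (x := 0) tphi) ?ltxx// subr0.
Qed.

Lemma Prm_derive1 phi : test phi -> Prm (toL2 mu (derive1 phi)) = toL2 mu phi.
Proof.
move=> tphi; apply: toL2_eq; [exact: prm_Lfun|exact: test_Lfun|].
by apply: eq_itv_ae => x /andP[x0 xl]; rewrite prm_derive1// !ltW.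
Qed.

Lemma prm_weak_derivative v : is_weak_derivative (Prm v) v.
Proof.
apply/weak_derivativeP => phi tphi.
have := prm_ibp l0 v (toL2 mu (derive1 phi)).
rewrite Prm_derive1// prm_derive1// ?lexx ?ltW//.
rewrite (test_out (x := l) tphi) ?ltxx ?andbF// mulr0 => /esym/eqP.
by rewrite addrC addr_eq0 => /eqP.
Qed.

Lemma ip_oneK : ip one one = l.
Proof.
by rewrite -(form_norm_sqr (ip_inner mu))// nrm_one// sqr_sqrtr// ltW.
Qed.

Lemma toL2Z a phi : test phi -> toL2 mu (fun x => a * phi x) = a *: toL2 mu phi.
Proof.
move=> tphi; have L := test_Lfun l0 tphi; have L1 := Lfun_lin (-1) L L.
have L0 : toL2 mu (fun x => -1 * phi x + phi x) = 0.
  by rewrite toL2_lin// scaleN1r addNr.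
rewrite -[RHS]addr0 -L0 -toL2_lin//; congr toL2; apply/funext => x.
by rewrite mulN1r addNr addr0.
Qed.

(** With a test function [chi] of integral 1, every test function psi differs from a multiple of
    [chi] by one of zero mean, that is, by the derivative of a test function, on which w vanishes.
    So w acts on psi as the constant ip w chi. *)
Lemma du_bois_reymond w :
  (forall phi, test phi -> ip w (toL2 mu (derive1 phi)) = 0) ->
  exists k, w = k *: one.
Proof.
move=> w0.
have [chi [tchi chi1]] : exists chi, test chi /\ ip (toL2 mu chi) one = 1.
  have [phi [tphi phi1]] : exists phi, test phi /\ ip (toL2 mu phi) one != 0.
    (* If all test functions had zero mean, the constant 1 would be orthogonal to all of them and
       vanish, although its squared norm is l. *)
    apply: contrapT => none; have : one = 0.
      apply: (test_ortho l0) => phi tphi; apply: contrapT => /eqP phi1; apply: none.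
      by exists phi; rewrite ip_sym.
    by move=> E; have := ip_oneK; rewrite E ip0l => /eqP; rewrite lt_eqF.
  have t0 : test (fun x => (ip (toL2 mu phi) one)^-1 * phi x).
    have := test_lin ((ip (toL2 mu phi) one)^-1 - 1) tphi tphi.
    by congr test; apply/funext => x; rewrite mulrBl mul1r subrK.
  by exists (fun x => (ip (toL2 mu phi) one)^-1 * phi x); rewrite toL2Z// ipZl mulVf.
exists (ip w (toL2 mu chi)).
apply/eqP; rewrite -subr_eq0; apply/eqP; apply: (test_ortho l0) => psi tpsi.
pose c := ip (toL2 mu psi) one.
pose xi x := - c * chi x + psi x.
have txi : test xi by exact: test_lin.
have xi1 : ip (toL2 mu xi) one = 0.
  by rewrite toL2_lin ?test_Lfun// ip_linl chi1 mulr1 addNr.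
have := w0 _ (test_prim_test l0 txi xi1).
have -> : derive1 (test_prim xi) = xi.
  apply/funext => x; rewrite derive1E.
  by have [_ ->] := test_prim_derive txi x.
rewrite toL2_lin ?test_Lfun// ip_linr ipDl ipNl ipZl /c (ip_sym (toL2 mu psi)).
by rewrite mulNr addrC [ip one _ * _]mulrC.
Qed.

Lemma weak_derivative_repr u v : is_weak_derivative u v ->
  exists k, u = k *: one + Prm v.
Proof.
move=> /weak_derivativeP uv; have /weak_derivativeP pv := prm_weak_derivative v.
have [k uk] : exists k, u - Prm v = k *: one.
  apply: du_bois_reymond => phi tphi.
  by rewrite ipDl ipNl uv// pv// opprK addNr.
by exists k; rewrite -uk subrK.
Qed.

Lemma ae_neq x : {ae mu, forall y, y != x}.
Proof.
exists ([set x] : set RT); split=> [||y /=]; first exact: measurable_set1.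
  apply: (@subset_measure0 _ _ _ leb _ ([set x] : set RT)) => //.
  - exact: measurableI.
  - exact: lebesgue_measure_set1.
by move=> /negP; rewrite negbK => /eqP.
Qed.

Lemma prm_diff v x y : 0 <= x -> x <= y ->
  prm v y - prm v x = ip v (toL2 mu \1_(`]x, y[%classic : set RT)).
Proof.
move=> x0 xy; rewrite /prm -ipNr -ipDr prm_indic_diff//; congr ip.
have mD : measurable (`]0, y[%classic `\` `]0, x[%classic : set RT).
  exact: measurableD.
apply: toL2_eq; [exact: indic_Lfun..|].
apply: (ae_imp2 _ (ae_neq x) (mu_itv_in l)) => z zx /andP[z0 zl] _.
rewrite !indicE in_setD !mem_setE !in_itv /= z0 /=.
by rewrite -leNgt andbC; congr (_ && _)%:R; rewrite lt_neqAle eq_sym zx.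
Qed.

Lemma mu_itvoo x y : 0 <= x -> x <= y -> y <= l ->
  fine (mu (`]x, y[%classic : set RT)) = y - x.
Proof.
move=> x0 xy yl; rewrite -[mu _]/(leb (`]x, y[%classic `&` `]0, l[%classic : set R)).
rewrite setIidl; last first.
  move=> z /=; rewrite !in_itv /= => /andP[xz zy].
  by rewrite (le_lt_trans x0 xz) (lt_le_trans zy yl).
rewrite lebesgue_measure_itv /= lte_fin; case: ltP => //= yx; lra.
Qed.

Lemma ip_suml (I : finType) (F : I -> L2 mu) w :
  ip (\sum_i F i) w = \sum_i ip (F i) w.
Proof. exact: (big_morph (fun u => ip u w) (fun u v => ipDl u v w) (ip0l w)). Qed.

Lemma ip_sumr (I : finType) (F : I -> L2 mu) w :
  ip w (\sum_i F i) = \sum_i ip w (F i).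
Proof. by rewrite ip_sym ip_suml; apply: eq_bigr => i _; rewrite ip_sym. Qed.

(* Cauchy-Schwarz against the sum of the indicators of the intervals. *)
Lemma prm_abs_continuous k v : abs_continuous l (fun x => k + prm v x).
Proof.
move=> e e0; pose c := nrm v + 1.
have c0 : 0 < c by have := form_norm_ge0 (@ip _ _ _ mu) v; rewrite /c; lra.
exists ((e / c) ^+ 2); first by rewrite exprn_gt0// divr_gt0.
move=> n a b abl tab ab_lt.
pose J i := toL2 mu \1_(`]a i, b i[%classic : set RT).
have prmJ i : prm v (b i) - prm v (a i) = ip v (J i).
  by have [ai ab bl] := abl i; exact: prm_diff.
pose s i : R := Num.sg (ip v (J i)).
have -> : \sum_i `|k + prm v (b i) - (k + prm v (a i))| = ip v (\sum_i s i *: J i).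
  rewrite ip_sumr; apply: eq_bigr => i _.
  by rewrite opprD addrACA subrr add0r prmJ ipZr -normrEsg.
have II i j : ip (J i) (J j) = if i == j then b i - a i else 0.
  have [ai ab bl] := abl i; case: eqVneq => [<-|ij].
    by rewrite ip_indic// mu_itvoo.
  rewrite /J ipE' ?indic_Lfun// /Rintegral integral0_eq// => x _.
  rewrite !indicE; have [/set_mem xi|_] := boolP (x \in `]a i, b i[%classic); last first.
    by rewrite mul0r.
  have [/set_mem xj|_] := boolP (x \in `]a j, b j[%classic); last by rewrite mulr0.
  have ijE : i = j by apply: (tab i j I I); exists x.
  by rewrite ijE eqxx in ij.
(* Disjoint intervals have orthogonal indicators and the signs have square at most 1, so the squared
   norm is at most the total length. *)
have SS : ip (\sum_i s i *: J i) (\sum_i s i *: J i) <= \sum_i (b i - a i).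
  rewrite ip_suml; apply: ler_sum => i _.
  rewrite ip_sumr (bigD1 i)//= big1 ?addr0; last first.
    by move=> j ji; rewrite ipZl ipZr II eq_sym (negbTE ji) !mulr0.
  rewrite ipZl ipZr II eqxx mulrA -expr2 ler_piMl//.
    by have [] := abl i => _; rewrite subr_ge0.
  rewrite /s; have [->|z] := eqVneq (ip v (J i)) 0; first by rewrite sgr0 expr0n.
  by rewrite sqr_sg z.
have S_lt : nrm (\sum_i s i *: J i) < e / c.
  by apply: ip_eps; [rewrite divr_gt0|exact: le_lt_trans ab_lt].
apply: le_lt_trans (form_CS (ip_inner mu) _ _) _ => //.
apply: (@le_lt_trans _ _ (c * nrm (\sum_i s i *: J i))).
  by rewrite ler_wpM2r ?form_norm_ge0// /c; lra.
by rewrite mulrC -ltr_pdivlMr.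
Qed.

Lemma abs_continuous_dist (f : R -> R) : abs_continuous l f -> forall e, 0 < e ->
  exists2 d, 0 < d & forall x y, 0 <= x <= l -> 0 <= y <= l -> `|x - y| < d ->
    `|f x - f y| < e.
Proof.
move=> acf e e0; have [d d0 dP] := acf e e0; exists d => //.
have le_case x y : 0 <= x -> x <= y -> y <= l -> y - x < d -> `|f y - f x| < e.
  move=> x0 xy yl xyd; have := dP 1%N (fun=> x) (fun=> y).
  rewrite !big_ord1; apply=> // i j _ _ _.
  by rewrite [i]ord1 [j]ord1.
move=> x y /andP[x0 xl] /andP[y0 yl]; have [xy|/ltW yx] := leP x y.
  by rewrite distrC ger0_norm ?subr_ge0// distrC; exact: le_case.
by rewrite ger0_norm ?subr_ge0//; exact: le_case.
Qed.

Lemma ae_exists (Q : R -> Prop) x y : 0 <= x -> x < y -> y <= l ->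
  {ae mu, forall z, Q z} -> exists2 z, x < z < y & Q z.
Proof.
move=> x0 xy yl [N [mN N0 QN]]; apply: contrapT => none.
have : (mu (`]x, y[%classic : set RT) <= mu N)%E.
  apply: le_measure; rewrite ?inE// => z /=; rewrite in_itv /= => zxy.
  by apply: QN => /= Qz; apply: none; exists z.
move=> mu_le; have fin : mu (`]x, y[%classic : set RT) \is a fin_num.
  rewrite ge0_fin_numE//; apply: le_lt_trans (_ : mu setT < +oo)%E.
    by apply: le_measure; rewrite ?inE.
  by rewrite mu_itvT// ltry.
have := fine_le fin (_ : mu N \is a fin_num) mu_le; rewrite N0 => /(_ isT).
rewrite (mu_itvoo x0 (ltW xy) yl) (_ : fine 0%E = 0 :> R)// => ?; lra.
Qed.

Lemma abs_continuous_eq (f g : R -> R) : abs_continuous l f -> abs_continuous l g ->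
  (f : RT -> R) = g %[ae mu] -> forall x, 0 <= x <= l -> f x = g x.
Proof.
move=> acf acg fg x xl; apply/eqP; rewrite -subr_eq0 -normr_eq0 eq_le normr_ge0 andbT.
apply/ler_addgt0Pr => e e0; rewrite add0r.
have e20 : 0 < e / 2 by lra.
have [d1 d10 d1P] := abs_continuous_dist acf e20.
have [d2 d20 d2P] := abs_continuous_dist acg e20.
pose d := Num.min d1 d2.
have d0 : 0 < d by rewrite lt_min d10.
have [d_d1 d_d2] : d <= d1 /\ d <= d2 by rewrite !ge_min !lexx orbT.
(* A nearby point of equality is sought to the right of x in the left half of [0, l] and to the left
   of x otherwise, so that the interval searched stays in [0, l] even when x is an endpoint. *)
have [z [zl zx fgz]] : exists z, [/\ 0 <= z <= l, `|x - z| < d & f z = g z].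
  have /andP[x0 x_le] := xl; move: l0 => l1.
  have [xl2|xl2] := leP x (l / 2).
    pose y := x + Num.min d (l / 2).
    have m1 : Num.min d (l / 2) <= d by rewrite ge_min lexx.
    have m2 : Num.min d (l / 2) <= l / 2 by rewrite ge_min lexx orbT.
    have m0 : 0 < Num.min d (l / 2) by rewrite lt_min d0; lra.
    have [|||z /andP[xz zy] fgz] := @ae_exists _ x y _ _ _ fg.
    - by [].
    - by rewrite /y; lra.
    - by rewrite /y; lra.
    rewrite /y in zy; exists z; split; [lra| |exact: fgz I].
    by rewrite distrC gtr0_norm; lra.
  pose y := x - Num.min d (l / 2).
  have m1 : Num.min d (l / 2) <= d by rewrite ge_min lexx.
  have m2 : Num.min d (l / 2) <= l / 2 by rewrite ge_min lexx orbT.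
  have m0 : 0 < Num.min d (l / 2) by rewrite lt_min d0; lra.
  have [|||z /andP[yz zx] fgz] := @ae_exists _ y x _ _ _ fg.
  - by rewrite /y; lra.
  - by rewrite /y; lra.
  - by [].
  rewrite /y in yz; exists z; split; [lra| |exact: fgz I].
  by rewrite gtr0_norm; lra.
have := d1P _ _ xl zl (lt_le_trans zx d_d1).
have := d2P _ _ zl xl; rewrite distrC => /(_ (lt_le_trans zx d_d2)).
rewrite fgz => h1 h2; have := ler_normD (f x - g z) (g z - g x).
by rewrite subrKA; lra.
Qed.

Lemma repr_AC_rep u v k : u = k *: one + Prm v -> is_AC_rep u (fun x => k + prm v x).
Proof.
move=> ->; split; first exact: prm_abs_continuous.
have L1 := cst1_Lfun l0; have Lp := prm_Lfun l0 v.
rewrite /one /Prm -toL2_lin//; apply: ae_eq_sym.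
apply: ae_imp (toL2E (Lfun_lin k L1 Lp)) => x + Dx => ->//=.
by rewrite mulr1.
Qed.

Lemma weakly_derivable_AC u : weakly_derivable u -> Defs.AC u.
Proof.
move=> /wDP /weak_derivative_repr[k uk].
by exists (fun x => k + prm (wD u) x); exact: repr_AC_rep.
Qed.

Lemma AC_repE u (w : R -> R) : is_AC_rep u w -> forall x, 0 <= x <= l -> AC_rep u x = w x.
Proof.
move=> uw; have [ac1 e1] : is_AC_rep u (AC_rep u).
  by apply: (@xgetPex _ (cst 0) [set w | is_AC_rep u w]); exists w.
case: uw => [ac2 e2]; apply: abs_continuous_eq => //.
exact: (ae_eq_trans e1 (ae_eq_sym e2)).
Qed.

Let l00 : 0 <= (0 : R) <= l. Proof. by rewrite lexx ltW. Qed.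

Let ll : 0 <= l <= l. Proof. by rewrite lexx ltW. Qed.

Lemma AC_rep_prm u x : weakly_derivable u -> 0 <= x <= l ->
  AC_rep u x = AC_rep u 0 + prm (wD u) x.
Proof.
move=> /wDP /weak_derivative_repr[k uk] xl.
have r := AC_repE (repr_AC_rep uk).
by rewrite (r _ xl) (r _ l00) (prm_out l0 _ (lexx 0)) addr0.
Qed.

Lemma weakly_derivable_repr u : weakly_derivable u ->
  u = AC_rep u 0 *: one + Prm (wD u).
Proof.
move=> /wDP /weak_derivative_repr[k uk].
have -> : AC_rep u 0 = k; last by [].
by rewrite (AC_repE (repr_AC_rep uk) l00) (prm_out l0 _ (lexx 0)) addr0.
Qed.

Lemma AC_rep_lin a u v x : weakly_derivable u -> weakly_derivable v ->
  0 <= x <= l -> AC_rep (a *: u + v) x = a * AC_rep u x + AC_rep v x.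
Proof.
move=> uP vP xl.
have [k uk] := weak_derivative_repr (wDP uP).
have [j vj] := weak_derivative_repr (wDP vP).
have uvE : a *: u + v = (a * k + j) *: one + Prm (a *: wD u + wD v).
  rewrite Prm_lin// [in LHS]uk [in LHS]vj scalerDr scalerA addrACA.
  by rewrite -scalerDl.
rewrite (AC_repE (repr_AC_rep uvE))// (AC_repE (repr_AC_rep uk))//.
rewrite (AC_repE (repr_AC_rep vj))// prm_lin mulrDr.
by rewrite addrACA.
Qed.

Lemma weak_ibp u v : weakly_derivable u -> weakly_derivable v ->
  ip (wD u) v + ip u (wD v) = AC_rep u l * AC_rep v l - AC_rep u 0 * AC_rep v 0.
Proof.
move=> uP vP.
rewrite (AC_rep_prm uP ll) (AC_rep_prm vP ll).
rewrite [X in ip (wD u) X](weakly_derivable_repr vP).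
rewrite [X in ip X (wD v)](weakly_derivable_repr uP).
move: (wD u) (wD v) (AC_rep u 0) (AC_rep v 0) => u' v' a b.
rewrite ip_linl ip_linr -!prm_l// (ip_sym one) -prm_l//.
rewrite addrACA -(prm_ibp l0).
by move: (prm u' l) (prm v' l) => x y; ring.
Qed.

Lemma boundary_le u : weakly_derivable u -> AC_rep u 0 = 0 ->
  AC_rep u l ^+ 2 <= l * ip (wD u) (wD u).
Proof.
move=> uP u0; rewrite (AC_rep_prm uP ll) u0 add0r.
by apply: (prm_sqr_le l0); exact: ltW.
Qed.

End WeakDerivative.

(** * Wirtinger's inequality with the sharp constant *)

Section Wirtinger.
Context {R : realType}.
Variable l : R.
Hypothesis l0 : 0 < l.
Local Notation mu := (mu_itv l).
Local Notation leb := (@lebesgue_measure R).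
Local Notation RT := (measurableTypeR R).
Local Notation test := (test_function l).
Local Notation Lfun2 := (Lfun mu 2%:E).
Local Notation nrm := (form_norm (@ip _ _ _ mu)).
Implicit Types (phi psi : R -> R) (u v w : L2 mu) (x y k : R).

Lemma ip_segment (f : R -> R) : continuous f -> (f : RT -> R) \in Lfun2 ->
  ip (toL2 mu f) (toL2 mu f) = \int[leb]_(x in `[0, l]) (f x * f x).
Proof.
move=> cf Lf; have mf := Lfun2_measurable Lf.
have cff : {within `[0, l], continuous (fun x => f x * f x)}.
  by apply: continuous_subspaceT => x; apply: cvgM; exact: cf.
have iab : leb.-integrable `[0, l] (EFin \o (fun x => f x * f x)).
  by apply: continuous_compact_integrable => //; exact: segment_compact.
rewrite ipE'// Rint_itv; last exact: measurable_funM.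
rewrite Rintegral_itv_bndo_bndc; last first.
  by apply: integrableS iab => //; exact: subset_itv_oo_cc.
rewrite Rintegral_itv_obnd_cbnd//.
by apply: integrableS iab => //; exact: subset_itv_oc_cc.
Qed.

(* [(phi - k tan (k (l - x)) psi)^2 >= 0], the cross term being, up to
   [k^2 psi^2], the derivative of [k tan (k (l - x)) psi^2]. *)
Lemma wirtinger_test phi k : test phi -> 0 < k -> k * l < pi / 2 ->
  k ^+ 2 * ip (Prm (toL2 mu phi)) (Prm (toL2 mu phi)) <=
  ip (toL2 mu phi) (toL2 mu phi).
Proof.
move=> tphi k0 kl; rewrite Prm_test//.
pose psi := test_prim phi; pose z x := k * (l - x).
pose G x := k * tan (z x) * (psi x * psi x).
pose g x := - k ^+ 2 * (cos (z x))^-2 * (psi x * psi x) +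
  2 * (k * tan (z x)) * (psi x * phi x).
have dpsi x : is_derive x 1 psi (phi x) by exact: (test_prim_derive tphi).
have cpsi : continuous psi.
  move=> x; apply/differentiable_continuous/derivable1_diffP.
  by have [] := dpsi x.
have cphi := test_continuous tphi.
have cosz x : 0 <= x <= l -> 0 < cos (z x).
  move=> /andP[x0 xl]; apply: cos_gt0_pihalf; rewrite /z.
  have z0 : 0 <= k * (l - x) by rewrite mulr_ge0 ?(ltW k0) ?subr_ge0.
  have zl : k * (l - x) <= k * l by rewrite ler_pM2l//; lra.
  have := pi_gt0 R; lra.
have dz x : is_derive x 1 z (- k).
  have d1 : is_derive x 1 (fun x => l - x) (0 - 1).
    exact: (is_deriveB (is_derive_cst l x 1) (is_derive_id x 1)).
  rewrite (_ : z = k \*: (fun x => l - x))//.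
  apply: (is_derive_eq (is_deriveZ k d1)).
  by rewrite sub0r /GRing.scale /= mulrN1.
have dtan x : 0 <= x <= l -> is_derive x 1 (fun x => tan (z x)) ((cos (z x))^-2 * - k).
  move=> xl; have c0 : cos (z x) != 0 by rewrite gt_eqF ?cosz.
  exact: (@is_derive1_comp _ tan z x _ _ (is_derive_tan c0) (dz x)).
have dG x : 0 <= x <= l -> is_derive x 1 G (g x).
  move=> xl; have dkt := is_deriveZ k (dtan x xl).
  have d2 := is_deriveM (dpsi x) (dpsi x).
  rewrite (_ : G = (k \*: (fun x => tan (z x))) * (psi * psi))//.
  apply: (is_derive_eq (is_deriveM dkt d2)).
  rewrite /g -[(psi * psi) x]/(psi x * psi x).
  rewrite -[(k \*: _) x]/(k * tan (z x)) -[k *: (_ * _)]/(k * _).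
  rewrite -[(k * _ ) *: _]/((k * _) * _) -[(psi x * psi x) *: _]/((psi x * psi x) * _).
  rewrite -[psi x *: _]/(psi x * phi x).
  move: ((cos (z x)) ^- 2) (tan (z x)) (psi x) (phi x) => a b c d; ring.
have cz x : {for x, continuous z}.
  by apply/differentiable_continuous/derivable1_diffP; have [] := dz x.
have cg x : 0 <= x <= l -> {for x, continuous g}.
  move=> xl; have c0 : cos (z x) != 0 by rewrite gt_eqF ?cosz.
  have ccos : cos (z y) @[y --> x] --> cos (z x).
    by apply: (continuous_comp (cz x)); exact: continuous_cos.
  have ctan : {for x, continuous (fun y => tan (z y))}.
    by apply/differentiable_continuous/derivable1_diffP; have [] := dtan x xl.
  apply: cvgD.
    apply: cvgM; last by apply: cvgM; exact: cpsi.
    apply: cvgM; first exact: cvg_cst.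
    apply: cvgV; first by rewrite expf_neq0.
    by rewrite !expr2; apply: cvgM.
  apply: cvgM; last by apply: cvgM; [exact: cpsi|exact: cphi].
  by apply: cvgM; [exact: cvg_cst|apply: cvgM => //; exact: cvg_cst].
have cgW : {within `[0, l], continuous g}.
  apply: continuous_in_subspaceT => x /set_mem; rewrite /= in_itv /=; exact: cg.
have cG x : 0 <= x <= l -> {for x, continuous G}.
  by move=> xl; apply/differentiable_continuous/derivable1_diffP; have [] := dG x xl.
(* The boundary values of [G] vanish: the tangent at x = l, and psi at x = 0. *)
have int_g : \int[leb]_(x in `[0, l]) g x = 0.
  rewrite /Rintegral (continuous_FTC2 l0 cgW (F := G)).
  - rewrite /G /z subrr mulr0 tan0 mulr0 mul0r /= sub0r.
    suff -> : psi 0 = 0 by rewrite !mulr0 oppr0.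
    by rewrite /psi (test_primE l0 tphi) ?lexx ?(ltW l0)// (prm_out l0 _ (lexx 0)).
  - split.
    + move=> x; rewrite in_itv /= => /andP[x0 xl].
      by have [] := dG x ltac:(by rewrite !ltW).
    + by apply: cvg_at_right_filter; apply: cG; rewrite lexx ltW.
    + by apply: cvg_at_left_filter; apply: cG; rewrite lexx ltW.
  - move=> x; rewrite in_itv /= => /andP[x0 xl]; rewrite derive1E.
    by have [_ ->] := dG x ltac:(by rewrite !ltW).
have Lpsi : (psi : RT -> R) \in Lfun2.
  refine (Lfun_ae _ _ (prm_Lfun l0 (toL2 mu phi))).
    exact: continuous_measurable_fun.
  by apply: eq_itv_ae => x /andP[x0 xl]; rewrite -(test_primE l0 tphi)// !ltW.
have Lphi := test_Lfun l0 tphi.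
rewrite !ip_segment//.
have int_of (f : R -> R) : {within `[0, l], continuous f} ->
    leb.-integrable `[0, l] (EFin \o f).
  by move=> cf; apply: continuous_compact_integrable => //; exact: segment_compact.
have cpp : {within `[0, l], continuous (fun x => psi x * psi x)}.
  by apply: continuous_subspaceT => x; apply: cvgM; exact: cpsi.
have cff : {within `[0, l], continuous (fun x => phi x * phi x)}.
  by apply: continuous_subspaceT => x; apply: cvgM; exact: cphi.
have ckpp : {within `[0, l], continuous (fun x => k ^+ 2 * (psi x * psi x))}.
  apply: continuous_subspaceT => x; apply: cvgM; first exact: cvg_cst.
  by apply: cvgM; exact: cpsi.
rewrite -RintegralZl ?int_of//.
have -> : \int[leb]_(x in `[0, l]) (k ^+ 2 * (psi x * psi x)) =
    \int[leb]_(x in `[0, l]) (k ^+ 2 * (psi x * psi x) + g x).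
  by rewrite RintegralD ?int_of// int_g addr0.
apply: le_Rintegral => //.
- rewrite (_ : EFin \o _ = fun x => ((k ^+ 2 * (psi x * psi x))%:E + (g x)%:E)%E)//.
  by apply: integrableD => //; exact: int_of.
- exact: int_of.
move=> x; rewrite /= in_itv /= => xl.
have := cosz x xl; rewrite /g /tan; have := cos2Dsin2 (z x).
move: (cos (z x)) (sin (z x)) (psi x) (phi x) => c s p f cs c0.
(* Since 1 - 1 / cos^2 = - tan^2, the left integrand is phi^2 minus this square. *)
have : 0 <= (f - k * (s / c) * p) ^+ 2 by exact: sqr_ge0.
suff -> : (f - k * (s / c) * p) ^+ 2 = f * f - (k ^+ 2 * (p * p) +
   (- k ^+ 2 * (c ^+ 2)^-1 * (p * p) + 2 * (k * (s / c)) * (p * f))).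
  by rewrite subr_ge0.
have cN0 : c != 0 by rewrite gt_eqF.
have -> : k ^+ 2 * (p * p) = (c ^+ 2 + s ^+ 2) * (k ^+ 2 * (p * p)) by rewrite cs mul1r.
have -> : - k ^+ 2 * (c ^+ 2)^-1 * (p * p) =
   - (c ^+ 2 + s ^+ 2) * k ^+ 2 * (c ^+ 2)^-1 * (p * p) by rewrite cs mulN1r.
have s2 : s ^+ 2 = 1 - c ^+ 2 by rewrite -cs; ring.
have : (k * (s / c) * p) ^+ 2 = k ^+ 2 * (c ^+ 2)^-1 * p ^+ 2 * (1 - c ^+ 2).
  by rewrite -s2; field.
rewrite cs !mul1r sqrrB => ->.
by field.
Qed.

(** For k < K = pi / (2 l) the tangent has no pole on [0, l]. The value K itself is reached as a
    limit of such k for each test function, and general v then follow by density. *)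
Lemma wirtinger_prm v : ip (Prm v) (Prm v) <= 4 * l ^+ 2 / pi ^+ 2 * ip v v.
Proof.
have pi0 := pi_gt0 R.
have [K [K0 KlE KE]] : exists K : R,
    [/\ 0 < K, K * l = pi / 2 & K^-1 ^+ 2 = 4 * l ^+ 2 / pi ^+ 2].
  exists (pi / (2 * l)); move: (pi : R) l0 pi0 => p l1 p0.
  have lN0 : l != 0 by rewrite gt_eqF.
  have pN0 : p != 0 by rewrite gt_eqF.
  by split; [rewrite divr_gt0// mulr_gt0|field|field; rewrite pN0].
have testP phi : test phi -> K ^+ 2 * ip (Prm (toL2 mu phi)) (Prm (toL2 mu phi)) <=
    ip (toL2 mu phi) (toL2 mu phi).
  move=> tphi; set A := ip (Prm _) _; set B := ip _ _.
  have A0 : 0 <= A by exact: ip_ge0.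
  apply/ler_addgt0Pr => e e0; pose C := K ^+ 2 * A.
  have C0 : 0 <= C by rewrite mulr_ge0// sqr_ge0.
  (* Replacing K by (1 - d) K loses at most 2 d C, and this d makes the loss at most e. *)
  pose d := e / (2 * (C + 1) + e).
  have d0 : 0 < d by rewrite divr_gt0//; lra.
  have d1 : d < 1 by rewrite ltr_pdivrMr; lra.
  have := @wirtinger_test phi ((1 - d) * K) tphi.
  have kl : (1 - d) * K * l < pi / 2.
    rewrite -mulrA KlE; have : 0 < d * (pi / 2) by rewrite mulr_gt0//; lra.
    by move: (pi : R) pi0 => p p0; lra.
  have k0 : 0 < (1 - d) * K by rewrite mulr_gt0//; lra.
  move=> /(_ k0 kl); rewrite -/A -/B exprMn -mulrA -/C.
  have dE : d * (2 * (C + 1) + e) = e by rewrite /d divfK// gt_eqF//; lra.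
  have dC : 2 * (d * C) <= e.
    by have : 0 <= d * (2 + e); [rewrite mulr_ge0//; lra|lra].
  have d2C : 0 <= d ^+ 2 * C by rewrite mulr_ge0// sqr_ge0.
  rewrite (_ : (1 - d) ^+ 2 * C = C - 2 * (d * C) + d ^+ 2 * C); last by ring.
  by lra.
have K'0 : 0 < K^-1 by rewrite invr_gt0.
have nrmP phi : test phi -> nrm (Prm (toL2 mu phi)) <= K^-1 * nrm (toL2 mu phi).
  move=> tphi; rewrite ler_pdivlMl//.
  have n1 := form_norm_ge0 (@ip _ _ _ mu) (Prm (toL2 mu phi)).
  have n2 := form_norm_ge0 (@ip _ _ _ mu) (toL2 mu phi).
  have K1 := mulr_ge0 (ltW K0) n1.
  suff : (K * nrm (Prm (toL2 mu phi))) ^+ 2 <= nrm (toL2 mu phi) ^+ 2.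
    by move: (K * _) (nrm (toL2 mu phi)) K1 n2 => x y x0 y0; rewrite ler_pXn2r// nnegrE.
  by rewrite exprMn !(form_norm_sqr (ip_inner mu))//; exact: testP.
have combine (a b d f n q e : R) : a <= l * d -> b <= q * f ->
    q * (f - n) <= q * d -> d * (l + q) < e -> a + b <= q * n + e.
  by clear => *; lra.
have nrm_le : nrm (Prm v) <= K^-1 * nrm v.
  apply/ler_addgt0Pr => e e0; have c0 : 0 < l + K^-1 by move: l0 => ?; lra.
  have [f tf vf] := test_dense l0 v (divr_gt0 e0 c0).
  have PE : Prm v = Prm (v - toL2 mu f) + Prm (toL2 mu f).
    by rewrite -[Prm (v - _)]scale1r -Prm_lin// scale1r subrK.
  rewrite PE; apply: le_trans (form_normD (ip_inner mu) _ _) _ => //.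
  have h1 := nrm_Prm l0 (v - toL2 mu f); have h2 := nrmP _ tf.
  have := form_norm_dist (ip_inner mu) (x := v) (y := toL2 mu f) I I.
  rewrite ler_norml => /andP[dist _].
  have h3 : K^-1 * (nrm (toL2 mu f) - nrm v) <= K^-1 * nrm (v - toL2 mu f).
    by rewrite ler_pM2l// -opprB lerNl.
  move: vf; rewrite ltr_pdivlMr// => h4.
  exact: combine h1 h2 h3 h4.
rewrite -!(form_norm_sqr (ip_inner mu))//.
rewrite -KE -exprMn; have n1 := form_norm_ge0 (@ip _ _ _ mu) (Prm v).
have n2 := mulr_ge0 (ltW K'0) (form_norm_ge0 (@ip _ _ _ mu) v).
by move: (nrm (Prm v)) (K^-1 * nrm v) n1 n2 nrm_le => x y x0 y0; rewrite ler_pXn2r// nnegrE.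
Qed.

Lemma wirtinger u : weakly_derivable u -> AC_rep u 0 = 0 ->
  ip u u <= 4 * l ^+ 2 / pi ^+ 2 * ip (wD u) (wD u).
Proof.
move=> uP u0; rewrite [X in ip X X](weakly_derivable_repr l0 uP) u0 scale0r add0r.
exact: wirtinger_prm.
Qed.

End Wirtinger.

(** * Matrices of size two: smallest eigenvalue and linear systems *)

Section TwoByTwo.
Context {R : realType}.
Implicit Types (a b c d x y t : R).

Lemma bilinE a b c d x y x' y' : bilin (mx2 a b c d) (col2 x y) (col2 x' y') =
  a * (x * x') + b * (x * y') + c * (y * x') + d * (y * y').
Proof.
rewrite /bilin !mxE !big_ord_recl !big_ord0 !mxE !big_ord_recl !big_ord0 !mxE /=.
by ring.
Qed.

Lemma symmetric_eigenvalueP a b d t :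
  reflect (exists x y, [/\ a * x + b * y = t * x, b * x + d * y = t * y &
      (x != 0) || (y != 0)]) (eigenvalue (mx2 a b b d) t).
Proof.
have mulE (v : 'rV[R]_2) : v *m mx2 a b b d = t *: v <->
    a * v 0 0 + b * v 0 1 = t * v 0 0 /\ b * v 0 0 + d * v 0 1 = t * v 0 1.
  split=> [/rowP E|[E0 E1]].
    have := E 0; have := E 1; rewrite !mxE !big_ord_recl !big_ord0 !mxE /=.
    rewrite !addr0 (_ : lift ord0 ord0 = 1); last exact/val_inj.
    by rewrite ![v 0 _ * _]mulrC => -> ->.
  apply/rowP => j; rewrite !mxE !big_ord_recl !big_ord0 !mxE /=.
  rewrite !addr0 (_ : lift ord0 ord0 = 1); last exact/val_inj.
  rewrite ![v 0 _ * _]mulrC; case: j => -[|[|//]] /= lt_j.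
    by rewrite (_ : Ordinal _ = 0) ?E0//; exact/val_inj.
  by rewrite (_ : Ordinal _ = 1) ?E1//; exact/val_inj.
apply: (iffP eigenvalueP) => [[v /mulE[E0 E1] v0]|[x [y [Ex Ey xy0]]]].
  exists (v 0 0), (v 0 1); split=> //; apply: contraR v0.
  rewrite negb_or !negbK => /andP[/eqP v0 /eqP v1]; apply/eqP/rowP => j; rewrite mxE.
  by case: j => -[|[|//]] /= lt_j; [rewrite -v0|rewrite -v1]; congr (v _ _); exact/val_inj.
exists (\row_(j < 2) [:: x; y]`_j).
  by apply/mulE; rewrite !mxE.
apply: contraL xy0 => /eqP/rowP E; have := E 0; have := E 1; rewrite !mxE /= => -> ->.
by rewrite eqxx.
Qed.

(** These inequalities say that the matrix minus r times the identity is positive semidefinite,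
    through its diagonal and its determinant. The smaller root m of the characteristic polynomial
    satisfies them; it is an eigenvalue and a lower bound of all eigenvalues, so r <= m, and
    lowering m preserves them. *)
Lemma lambda_min_psd a b d : let r := lambda_min (mx2 a b b d) in
  [/\ r <= a, r <= d & b ^+ 2 <= (a - r) * (d - r)].
Proof.
move=> r; pose s := Num.sqrt ((a - d) ^+ 2 + 4 * b ^+ 2).
have D0 : 0 <= (a - d) ^+ 2 + 4 * b ^+ 2 by rewrite addr_ge0 ?sqr_ge0// mulr_ge0 ?sqr_ge0.
have s0 : 0 <= s by exact: sqrtr_ge0.
have s2 : s ^+ 2 = (a - d) ^+ 2 + 4 * b ^+ 2 by rewrite sqr_sqrtr.
pose m := (a + d - s) / 2.
have sad : `|a - d| <= s.
  by rewrite -sqrtr_sqr ler_wsqrtr// lerDl mulr_ge0 ?sqr_ge0.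
have [ma md] : m <= a /\ m <= d.
  by move: sad; rewrite ler_norml /m => /andP[? ?]; split; lra.
have mE : (a - m) * (d - m) = b ^+ 2.
  have -> : (a - m) * (d - m) = (s ^+ 2 - (a - d) ^+ 2) / 4 by rewrite /m; field.
  by rewrite s2; field.
have eig_m : eigenvalue (mx2 a b b d) m.
  apply/symmetric_eigenvalueP; have [b0|b0] := eqVneq b 0.
    move: mE; rewrite b0 expr0n /= => /eqP; rewrite mulf_eq0 !subr_eq0.
    case/orP => /eqP E; [exists 1, 0|exists 0, 1]; split; rewrite ?oner_eq0 ?orbT// ?b0 ?E; ring.
  exists b, (m - a); split; [ring| |by rewrite b0].
  by rewrite -expr2 -mE; ring.
have lb_m t : eigenvalue (mx2 a b b d) t -> m <= t.
  move=> /symmetric_eigenvalueP[x [y [Ex Ey xy0]]].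
  (* The characteristic polynomial vanishes at t: the other coordinate is eliminated from the two
     equations, then the nonzero one is cancelled. *)
  have : (a - t) * (d - t) - b ^+ 2 = 0.
    case/orP: xy0 => [x0|y0].
      apply: (mulIf x0); rewrite mul0r.
      transitivity ((a * x + b * y - t * x) * (d - t) - b * (b * x + d * y - t * y)); first ring.
      by rewrite Ex Ey !subrr mul0r mulr0 subrr.
    apply: (mulIf y0); rewrite mul0r.
    transitivity ((b * x + d * y - t * y) * (a - t) - b * (a * x + b * y - t * x)); first ring.
    by rewrite Ex Ey !subrr mul0r mulr0 subrr.
  have -> : (a - t) * (d - t) - b ^+ 2 = (t - m) * (t - (a + d - m)).
    by rewrite -mE; ring.
  move/eqP; rewrite mulf_eq0 !subr_eq0 => /orP[/eqP -> //|/eqP ->].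
  by rewrite /m; lra.
have rm : r <= m by apply: ge_inf => //; exists m => t; exact: lb_m.
split; [exact: le_trans rm ma|exact: le_trans rm md|].
by rewrite -mE; apply: ler_pM; rewrite ?subr_ge0// lerB.
Qed.

Lemma mx2E a b c d : [/\ mx2 a b c d 0 0 = a, mx2 a b c d 0 1 = b,
  mx2 a b c d 1 0 = c & mx2 a b c d 1 1 = d].
Proof. by rewrite !mxE. Qed.

Lemma unit_mx2 a b c d : a * d - b * c != 0 -> mx2 a b c d \in unitmx.
Proof.
move=> D0; pose B := mx2 (d / (a * d - b * c)) (- b / (a * d - b * c))
  (- c / (a * d - b * c)) (a / (a * d - b * c)).
suff /mulmx1_unit[] : mx2 a b c d *m B = 1%:M by [].
apply/matrixP => i j; rewrite !mxE !big_ord_recl !big_ord0 !mxE /=.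
case: i => -[|[|//]] /= lt_i; case: j => -[|[|//]] /= lt_j; field; exact: D0.
Qed.

Lemma mx2_act_inv (V : lmodType R) a b c d (u v : V) : mx2 a b c d \in unitmx ->
  let w := mx2_act (invmx (mx2 a b c d)) u v in
  a *: w.1 + b *: w.2 = u /\ c *: w.1 + d *: w.2 = v.
Proof.
move=> A_unit; have /matrixP AB := mulmxV A_unit.
move: (invmx _) AB => B AB; rewrite /mx2_act /=.
have [A00 A01 A10 A11] := mx2E a b c d.
have E i j : mx2 a b c d i 0 * B 0 j + mx2 a b c d i 1 * B 1 j = (i == j)%:R.
  have := AB i j; rewrite mxE [RHS]mxE => <-; rewrite !big_ord_recl big_ord0 addr0.
  by congr (_ * _ + _ i _ * B _ j); exact/val_inj.
have := E 0 0; have := E 0 1; have := E 1 0; have := E 1 1.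
rewrite A00 A01 A10 A11 /= => E11 E10 E01 E00.
by split; rewrite !scalerDr !scalerA addrACA -!scalerDl ?E00 ?E01 ?E10 ?E11
  ?scale1r ?scale0r ?addr0 ?add0r.
Qed.

Lemma mul_inv_col2 a b c d x y : mx2 a b c d \in unitmx ->
  let w := invmx (mx2 a b c d) *m col2 x y in
  a * w 0 0 + b * w 1 0 = x /\ c * w 0 0 + d * w 1 0 = y.
Proof.
move=> A_unit; have : mx2 a b c d *m (invmx (mx2 a b c d) *m col2 x y) = col2 x y.
  by rewrite mulmxA mulmxV// mul1mx.
move: (invmx _ *m _) => w /matrixP E; have := E 0 0; have := E 1 0.
rewrite !mxE !big_ord_recl !big_ord0 !mxE /= !addr0.
rewrite (_ : lift ord0 ord0 = 1); last exact/val_inj.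
by [].
Qed.

End TwoByTwo.

(** * The two forms as combinations of L^2 products *)

Section IntegralSums.
Context {R : realType}.
Variable l : R.
Local Notation L2l := (L2 (mu_itv l)).

(** A list of weighted pairs settles the integrability of all the summands at once, so that the
    forms expand into inner products in one step. *)
Lemma Rintegral_ip (s : seq (R * L2l * L2l)) :
  \int[mu_itv l]_y (\sum_(t <- s) t.1.1 * (t.1.2 y * t.2 y)) =
  \sum_(t <- s) t.1.1 * ip t.1.2 t.2.
Proof.
suff [//] : (mu_itv l).-integrable setT
    (EFin \o (fun y => \sum_(t <- s) t.1.1 * (t.1.2 y * t.2 y))) /\
  \int[mu_itv l]_y (\sum_(t <- s) t.1.1 * (t.1.2 y * t.2 y)) =
  \sum_(t <- s) t.1.1 * ip t.1.2 t.2.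
elim: s => [|[[a u] v] s [IHi IH]].
  rewrite big_nil; split.
    rewrite (_ : EFin \o _ = cst 0%E); first exact: integrable0.
    by apply/funext => y; rewrite /= big_nil.
  by rewrite /Rintegral integral0_eq// => y _; rewrite big_nil.
have iuv := Lfun_mul_integrable (L2_Lfun u) (L2_Lfun v).
have iauv : (mu_itv l).-integrable setT (EFin \o (fun y => a * (u y * v y))).
  by have := integrableZl measurableT a iuv; apply: eq_integrable => // y _.
have E : (fun y => \sum_(t <- (a, u, v) :: s) t.1.1 * (t.1.2 y * t.2 y)) =
    (fun y => a * (u y * v y) + \sum_(t <- s) t.1.1 * (t.1.2 y * t.2 y)).
  by apply/funext => y; rewrite big_cons.
split.
  by rewrite E; have := integrableD measurableT iauv IHi; apply: eq_integrable.
by rewrite E RintegralD// RintegralZl// IH big_cons.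
Qed.

End IntegralSums.

(* Keeps the unifier from unfolding integrals and choices. *)
Opaque ip wD AC_rep.

Section ModelForms.
Context {R : realType}.
Variable P : parameters R.

Local Notation l := (len P).
Local Notation rho := (rho P).
Local Notation Iw := (Iw P).
Local Notation ms := (ms P).
Local Notation xc := (xc P).
Local Notation c_w := (c_w P).
Local Notation c_p := (c_p P).
Local Notation eps1 := (eps1 P).
Local Notation eps2 := (eps2 P).
Local Notation Iws := (Iws P).
Local Notation Jss := (Jss P).
Local Notation L2l := (L2 (mu_itv l)).

Hypothesis l0 : 0 < l.

Lemma inner1E (f1 g1 h1 z1 f2 g2 h2 z2 : L2l) (zw1 zp1 zw2 zp2 : R) :
  @inner1 R P (f1, g1, h1, z1, zw1, zp1) (f2, g2, h2, z2, zw2, zp2) =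
  rho * c_w ^+ 2 * ip (wD (wD f1)) (wD (wD f2)) + Iw * c_p ^+ 2 * ip (wD h1) (wD h2) +
  (rho * ip g1 g2 + rho * xc * ip g1 z2 + rho * xc * ip z1 g2 + Iws * ip z1 z2) +
  (ms * (zw1 * zw2) + ms * xc * (zw1 * zp2) + ms * xc * (zp1 * zw2) +
   Jss * (zp1 * zp2)).
Proof.
rewrite /inner1 bilinE; congr (_ + _ + _).
  pose s := [:: (rho * c_w ^+ 2, wD (wD f1), wD (wD f2)); (Iw * c_p ^+ 2, wD h1, wD h2)].
  transitivity (\int[mu_itv l]_y (\sum_(t <- s) t.1.1 * (t.1.2 y * t.2 y))).
    by apply: eq_Rintegral => y _; rewrite big_cons big_seq1 /= !mulrA.
  rewrite (Rintegral_ip s).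
  by rewrite /s big_cons big_seq1.
pose s := [:: (rho, g1, g2); (rho * xc, g1, z2); (rho * xc, z1, g2); (Iws, z1, z2)].
transitivity (\int[mu_itv l]_y (\sum_(t <- s) t.1.1 * (t.1.2 y * t.2 y))).
  by apply: eq_Rintegral => y _; rewrite bilinE 3!big_cons big_seq1 /= !addrA.
rewrite (Rintegral_ip s).
by rewrite /s 3!big_cons big_seq1 /= !addrA.
Qed.

Lemma PsiE (f1 g1 h1 z1 f2 g2 h2 z2 : L2l) (zw1 zp1 zw2 zp2 : R) :
  @Psi R P (f1, g1, h1, z1, zw1, zp1) (f2, g2, h2, z2, zw2, zp2) =
  (rho * eps1 * ip g1 f2 + rho * xc * eps2 * ip g1 h2 +
   rho * xc * eps1 * ip z1 f2 + Iws * eps2 * ip z1 h2) +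
  (rho * eps1 * ip g2 f1 + rho * xc * eps2 * ip g2 h1 +
   rho * xc * eps1 * ip z2 f1 + Iws * eps2 * ip z2 h1) +
  (ms * eps1 * (zw1 * AC_rep f2 l) + ms * xc * eps2 * (zw1 * AC_rep h2 l) +
   ms * xc * eps1 * (zp1 * AC_rep f2 l) + Jss * eps2 * (zp1 * AC_rep h2 l)) +
  (ms * eps1 * (zw2 * AC_rep f1 l) + ms * xc * eps2 * (zw2 * AC_rep h1 l) +
   ms * xc * eps1 * (zp2 * AC_rep f1 l) + Jss * eps2 * (zp2 * AC_rep h1 l)).
Proof.
rewrite /Psi !bilinE.
pose s := [:: (rho * eps1, g1, f2); (rho * xc * eps2, g1, h2);
  (rho * xc * eps1, z1, f2); (Iws * eps2, z1, h2);
  (rho * eps1, g2, f1); (rho * xc * eps2, g2, h1);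
  (rho * xc * eps1, z2, f1); (Iws * eps2, z2, h1)].
have -> : \int[mu_itv l]_y
    (bilin (M P) (col2 (g1 y) (z1 y)) (col2 (eps1 * f2 y) (eps2 * h2 y))
     + bilin (M P) (col2 (g2 y) (z2 y)) (col2 (eps1 * f1 y) (eps2 * h1 y))) =
    \int[mu_itv l]_y (\sum_(t <- s) t.1.1 * (t.1.2 y * t.2 y)).
  apply: eq_Rintegral => y _; rewrite !bilinE 7!big_cons big_seq1 /=.
  move: (f1 y) (g1 y) (h1 y) (z1 y) (f2 y) (g2 y) (h2 y) (z2 y) Iws.
  move: eps1 eps2 rho xc => e1 e2 r x a b c d a' b' c' d' i.
  by ring.
rewrite (Rintegral_ip s).
rewrite /s 7!big_cons big_seq1 /=.
move: (ip _ _) (ip _ _) (ip _ _) (ip _ _) (ip _ _) (ip _ _) (ip _ _) (ip _ _).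
move: (AC_rep f1 l) (AC_rep h1 l) (AC_rep f2 l) (AC_rep h2 l) eps1 eps2 rho xc ms Iws Jss.
by move=> *; ring.
Qed.

Definition H2L (f : L2l) := [/\ weakly_derivable f, weakly_derivable (wD f),
  AC_rep f 0 = 0 & AC_rep (wD f) 0 = 0].
Definition H1L (h : L2l) := weakly_derivable h /\ AC_rep h 0 = 0.

Lemma sobolev2P (f : L2l) : sobolevL 2 f <-> H2L f.
Proof.
split=> [[[f1 [f2 _]] f0]|[f1 f2 f0 f'0]].
  by split=> //; [exact: (f0 0%N)|exact: (f0 1%N)].
split; last by case=> [_|[_|k]]; [exact: f0|exact: f'0|rewrite !ltnS ltn0 => /notF[]].
by split; [exact: f1|split; [exact: f2|]].
Qed.

Lemma sobolev1P (h : L2l) : sobolevL 1 h <-> H1L h.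
Proof.
split=> [[[h1 _] h0]|[h1 h0]]; first by split=> //; exact: (h0 0%N).
split; last by case=> [_|k]; [exact: h0|rewrite ltnS ltn0 => /notF[]].
by split; [exact: h1|].
Qed.

Let l00 : 0 <= (0 : R) <= l. Proof. by rewrite lexx ltW. Qed.

Let ll : 0 <= l <= l. Proof. by rewrite lexx ltW. Qed.

Lemma H2L_lin a (f f' : L2l) : H2L f -> H2L f' -> H2L (a *: f + f').
Proof.
move=> [f1 f2 f0 df0] [f1' f2' f0' df0']; split.
- exact: weakly_derivable_lin.
- by rewrite wD_lin//; exact: weakly_derivable_lin.
- by rewrite AC_rep_lin// f0 f0' mulr0 addr0.
- by rewrite wD_lin// AC_rep_lin// df0 df0' mulr0 addr0.
Qed.

Lemma H1L_lin a (f f' : L2l) : H1L f -> H1L f' -> H1L (a *: f + f').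
Proof.
move=> [f1 f0] [f1' f0']; split; first exact: weakly_derivable_lin.
by rewrite AC_rep_lin// f0 f0' mulr0 addr0.
Qed.

Lemma H2L0 : H2L 0.
Proof.
have d0 : is_weak_derivative (0 : L2l) 0.
  by apply/weak_derivativeP => // phi _; rewrite !ip0l oppr0.
have D0 : wD (0 : L2l) = 0 by exact: wDE.
have w0 : weakly_derivable (0 : L2l) by exists 0.
have A0 : AC_rep (0 : L2l) 0 = 0.
  have := AC_rep_lin l0 (-1) w0 w0 l00; rewrite scaleN1r addNr mulN1r addNr.
  by [].
by split; rewrite ?D0.
Qed.

Lemma HspaceP (f g h z : L2l) (zw zp : R) :
  Hspace P (f, g, h, z, zw, zp) <-> H2L f /\ H1L h.
Proof. by rewrite /Hspace /= sobolev2P sobolev1P. Qed.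

Lemma state_linE a (f g h z f' g' h' z' : L2l) (zw zp zw' zp' : R) :
  a *: ((f, g, h, z, zw, zp) : state P) + (f', g', h', z', zw', zp') =
  (a *: f + f', a *: g + g', a *: h + h', a *: z + z', a * zw + zw', a * zp + zp').
Proof. exact: erefl. Qed.

Lemma Hspace_lin a (X Y : state P) : Hspace P X -> Hspace P Y -> Hspace P (a *: X + Y).
Proof.
case: X => [[[[[f g] h] z] zw] zp]; case: Y => [[[[[f' g'] h'] z'] zw'] zp'].
move=> /HspaceP[fP hP] /HspaceP[f'P h'P]; rewrite state_linE; apply/HspaceP.
by split; [exact: H2L_lin|exact: H1L_lin].
Qed.

Lemma Hspace0 : Hspace P 0.
Proof. by apply/HspaceP; have [w0 _ A0 _] := H2L0; split; first exact: H2L0. Qed.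

Lemma inner1_lin a (X Y Z : state P) : Hspace P X -> Hspace P Y -> Hspace P Z ->
  inner1 (a *: X + Y) Z = a * inner1 X Z + inner1 Y Z.
Proof.
(* The polynomial identity is stated over fresh reals, so that [ring] never meets an integral. *)
have alg (A B r rx I m mx J p p' q q' g g' u u' v v' z z' zw zw' zp zp' w2 p2 : R) :
  A * (a * p + p') + B * (a * q + q') + (r * (a * g + g') + rx * (a * u + u') +
    rx * (a * v + v') + I * (a * z + z')) + (m * ((a * zw + zw') * w2) +
    mx * ((a * zw + zw') * p2) + mx * ((a * zp + zp') * w2) + J * ((a * zp + zp') * p2)) =
  a * (A * p + B * q + (r * g + rx * u + rx * v + I * z) +
      (m * (zw * w2) + mx * (zw * p2) + mx * (zp * w2) + J * (zp * p2))) +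
  (A * p' + B * q' + (r * g' + rx * u' + rx * v' + I * z') +
      (m * (zw' * w2) + mx * (zw' * p2) + mx * (zp' * w2) + J * (zp' * p2))).
  by ring.
case: X => [[[[[f g] h] z] zw] zp]; case: Y => [[[[[f' g'] h'] z'] zw'] zp'].
case: Z => [[[[[f2 g2] h2] z2] zw2] zp2].
move=> /HspaceP[[f1 f1' _ _] [h1 _]] /HspaceP[[d1 d1' _ _] [e1 _]] _.
rewrite state_linE.
rewrite !inner1E !wD_lin// !ip_linl.
exact: alg.
Qed.

Lemma Psi_lin a (X Y Z : state P) : Hspace P X -> Hspace P Y -> Hspace P Z ->
  Psi (a *: X + Y) Z = a * Psi X Z + Psi Y Z.
Proof.
have alg (c1 c2 c3 c4 d1 d2 d3 d4 gf gf' gh gh' zf zf' zh zh' fg fg' hg hg' fz fz'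
    hz hz' zw zw' zp zp' F F' H H' F2 H2 w2 p2 : R) :
  c1 * (a * gf + gf') + c2 * (a * gh + gh') + c3 * (a * zf + zf') + c4 * (a * zh + zh') +
  (c1 * (a * fg + fg') + c2 * (a * hg + hg') + c3 * (a * fz + fz') + c4 * (a * hz + hz')) +
  (d1 * ((a * zw + zw') * F2) + d2 * ((a * zw + zw') * H2) +
   d3 * ((a * zp + zp') * F2) + d4 * ((a * zp + zp') * H2)) +
  (d1 * (w2 * (a * F + F')) + d2 * (w2 * (a * H + H')) +
   d3 * (p2 * (a * F + F')) + d4 * (p2 * (a * H + H'))) =
  a * (c1 * gf + c2 * gh + c3 * zf + c4 * zh +
    (c1 * fg + c2 * hg + c3 * fz + c4 * hz) +
    (d1 * (zw * F2) + d2 * (zw * H2) + d3 * (zp * F2) + d4 * (zp * H2)) +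
    (d1 * (w2 * F) + d2 * (w2 * H) + d3 * (p2 * F) + d4 * (p2 * H))) +
  (c1 * gf' + c2 * gh' + c3 * zf' + c4 * zh' +
    (c1 * fg' + c2 * hg' + c3 * fz' + c4 * hz') +
    (d1 * (zw' * F2) + d2 * (zw' * H2) + d3 * (zp' * F2) + d4 * (zp' * H2)) +
    (d1 * (w2 * F') + d2 * (w2 * H') + d3 * (p2 * F') + d4 * (p2 * H'))).
  by ring.
case: X => [[[[[f g] h] z] zw] zp]; case: Y => [[[[[f' g'] h'] z'] zw'] zp'].
case: Z => [[[[[f2 g2] h2] z2] zw2] zp2].
move=> /HspaceP[[f1 _ _ _] [h1 _]] /HspaceP[[d1 _ _ _] [e1 _]] _.
rewrite state_linE.
rewrite !PsiE !AC_rep_lin// !ip_linl !ip_linr.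
exact: alg.
Qed.

Lemma inner1_sym (X Y : state P) : inner1 X Y = inner1 Y X.
Proof.
have alg (A B r rx I m mx J p p' q q' g g' u u' v v' z z' x y x' y' : R) :
  p = p' -> q = q' -> g = g' -> u = v' -> v = u' -> z = z' ->
  A * p + B * q + (r * g + rx * u + rx * v + I * z) +
    (m * (x * x') + mx * (x * y') + mx * (y * x') + J * (y * y')) =
  A * p' + B * q' + (r * g' + rx * u' + rx * v' + I * z') +
    (m * (x' * x) + mx * (x' * y) + mx * (y' * x) + J * (y' * y)).
  by move=> -> -> -> -> -> ->; ring.
case: X => [[[[[f g] h] z] zw] zp]; case: Y => [[[[[f' g'] h'] z'] zw'] zp'].
by rewrite !inner1E; apply: alg; exact: ip_sym.
Qed.

Lemma Psi_sym (X Y : state P) : Psi X Y = Psi Y X.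
Proof.
case: X => [[[[[f g] h] z] zw] zp]; case: Y => [[[[[f' g'] h'] z'] zw'] zp'].
have alg (q r s t : R) : q + r + s + t = r + q + t + s by ring.
by rewrite !PsiE; exact: alg.
Qed.

End ModelForms.

(** * Equivalence of the two norms *)

Section Coercivity.
Context {R : realType}.

(** Clearing the denominator absorbs the convention a / 0 = +oo, since for b = 0 the product is 0 <
    a. *)
Lemma ediv_lt (e a b : R) : 0 <= b -> 0 < a -> (e%:E < ediv a b)%E -> e * b < a.
Proof.
move=> b0 a0; rewrite /ediv; case: eqVneq => [->|bN0]; first by rewrite mulr0.
by rewrite lte_fin ltr_pdivlMr// lt_neqAle eq_sym bN0.
Qed.

(** Used to read off from the thresholds that the smallest eigenvalues are positive: a positive eps
    lies below a quotient having them as a factor of the numerator. *)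
Lemma ediv_gt0 (e a b : R) : 0 < e -> 0 < b -> (e%:E < ediv a b)%E -> 0 < a.
Proof.
move=> e0 b0; rewrite /ediv gt_eqF// lte_fin ltr_pdivlMr//.
by apply: lt_trans; rewrite mulr_gt0.
Qed.

Lemma psd_scalar (a b d x y : R) : 0 <= a -> 0 <= d -> b ^+ 2 <= a * d ->
  0 <= a * (x * x) + 2 * b * (x * y) + d * (y * y).
Proof.
move=> a0 d0 bad; have [aE|aN0] := eqVneq a 0.
  move: bad; rewrite aE mul0r => b2; have -> : b = 0.
    by apply/eqP; rewrite -sqrf_eq0 eq_le b2 sqr_ge0.
  by rewrite mul0r mulr0 mul0r !add0r mulr_ge0// -expr2 sqr_ge0.
have {aN0 a0}a0 : 0 < a by rewrite lt_neqAle eq_sym aN0.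
rewrite -(pmulr_rge0 _ a0).
have -> : a * (a * (x * x) + 2 * b * (x * y) + d * (y * y)) =
  (a * x + b * y) ^+ 2 + (a * d - b ^+ 2) * (y ^+ 2) by ring.
by rewrite addr_ge0 ?sqr_ge0// mulr_ge0 ?sqr_ge0// subr_ge0.
Qed.

Lemma lower_combination (k1 k2 k3 k4 k5 k6 : R) :
  0 < k1 -> 0 < k2 -> 0 < k3 -> 0 < k4 -> 0 < k5 -> 0 < k6 ->
  exists2 c, 0 < c & forall s1 s2 s3 s4 s5 s6, 0 <= s1 -> 0 <= s2 -> 0 <= s3 ->
    0 <= s4 -> 0 <= s5 -> 0 <= s6 ->
    c * (s1 + s2 + s3 + s4 + s5 + s6) <=
    k1 * s1 + k2 * s2 + k3 * s3 + k4 * s4 + k5 * s5 + k6 * s6.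
Proof.
move=> h1 h2 h3 h4 h5 h6.
pose c := Num.min k1 (Num.min k2 (Num.min k3 (Num.min k4 (Num.min k5 k6)))).
have [c1 c2 c3] : [/\ c <= k1, c <= k2 & c <= k3] by rewrite !ge_min !lexx !orbT.
have [c4 c5 c6] : [/\ c <= k4, c <= k5 & c <= k6] by rewrite !ge_min !lexx !orbT.
have c0 : 0 < c by rewrite !lt_min h1 h2 h3 h4 h5 h6.
exists c => // s1 s2 s3 s4 s5 s6 p1 p2 p3 p4 p5 p6.
by rewrite !mulrDr !lerD// ler_wpM2r.
Qed.

Lemma upper_combination (k1 k2 k3 k4 k5 k6 : R) :
  exists2 c, 0 < c & forall s1 s2 s3 s4 s5 s6, 0 <= s1 -> 0 <= s2 -> 0 <= s3 ->
    0 <= s4 -> 0 <= s5 -> 0 <= s6 ->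
    k1 * s1 + k2 * s2 + k3 * s3 + k4 * s4 + k5 * s5 + k6 * s6 <=
    c * (s1 + s2 + s3 + s4 + s5 + s6).
Proof.
pose c := 1 + `|k1| + `|k2| + `|k3| + `|k4| + `|k5| + `|k6|.
have n1 := ler_norm k1; have n2 := ler_norm k2; have n3 := ler_norm k3.
have n4 := ler_norm k4; have n5 := ler_norm k5; have n6 := ler_norm k6.
have p1 := normr_ge0 k1; have p2 := normr_ge0 k2; have p3 := normr_ge0 k3.
have p4 := normr_ge0 k4; have p5 := normr_ge0 k5; have p6 := normr_ge0 k6.
have [c1 c2 c3] : [/\ k1 <= c, k2 <= c & k3 <= c] by rewrite /c; split; lra.
have [c4 c5 c6] : [/\ k4 <= c, k5 <= c & k6 <= c] by rewrite /c; split; lra.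
exists c => [|s1 s2 s3 s4 s5 s6 q1 q2 q3 q4 q5 q6]; first by rewrite /c; lra.
by rewrite !mulrDr !lerD// ler_wpM2r.
Qed.

(** The first entry of [Km1] written with Wirtinger's constant 4 L^2 / p^2. Here s stands for the
    square root of r, so that r * s is the power 3/2. *)
Lemma weight_bending (e L x r s c m p : R) : 0 < p ->
  e * (4 * L ^+ 3 * (1 + x) * (4 * L * (r * s) * c + p ^+ 2 * m)) < p ^+ 4 * r * c ^+ 2 ->
  e * (1 + x) * (r * (4 * L ^+ 2 / p ^+ 2) ^+ 2 * (s * c) + m * L * (4 * L ^+ 2 / p ^+ 2))
  < r * c ^+ 2.
Proof.
move=> p0 h; have -> : e * (1 + x) * (r * (4 * L ^+ 2 / p ^+ 2) ^+ 2 * (s * c) +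
    m * L * (4 * L ^+ 2 / p ^+ 2)) =
  e * (4 * L ^+ 3 * (1 + x) * (4 * L * (r * s) * c + p ^+ 2 * m)) / p ^+ 4.
  by field; rewrite gt_eqF.
by rewrite ltr_pdivrMr ?exprn_gt0// (_ : r * c ^+ 2 * p ^+ 4 = p ^+ 4 * r * c ^+ 2)//; ring.
Qed.

Lemma weight_twisting (e L i rx si c J mx I p : R) : 0 < p ->
  e * (4 * L ^+ 2 * (i + rx) * si * c + p ^+ 2 * L * (J + mx)) < p ^+ 2 * I * c ^+ 2 ->
  e * ((rx + i) * (4 * L ^+ 2 / p ^+ 2) * (si * c) + (mx + J) * L) < I * c ^+ 2.
Proof.
move=> p0 h; have -> : e * ((rx + i) * (4 * L ^+ 2 / p ^+ 2) * (si * c) + (mx + J) * L) =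
  e * (4 * L ^+ 2 * (i + rx) * si * c + p ^+ 2 * L * (J + mx)) / p ^+ 2.
  by field; rewrite gt_eqF.
by rewrite ltr_pdivrMr ?exprn_gt0// (_ : I * c ^+ 2 * p ^+ 2 = p ^+ 2 * I * c ^+ 2)//; ring.
Qed.

Lemma weight_half (e k q m : R) : 0 < q -> e * (2 * k) < q * m -> e * k * q^-1 < m / 2.
Proof. by move=> q0 h; rewrite ltr_pdivrMr//; lra. Qed.

Lemma norm_sum8 (x1 x2 x3 x4 x5 x6 x7 x8 y1 y2 y3 y4 y5 y6 y7 y8 : R) :
  `|2 * x1| <= y1 -> `|2 * x2| <= y2 -> `|2 * x3| <= y3 -> `|2 * x4| <= y4 ->
  `|2 * x5| <= y5 -> `|2 * x6| <= y6 -> `|2 * x7| <= y7 -> `|2 * x8| <= y8 ->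
  `|(x1 + x2 + x3 + x4) + (x1 + x2 + x3 + x4) + (x5 + x6 + x7 + x8) + (x5 + x6 + x7 + x8)|
  <= y1 + y2 + y3 + y4 + y5 + y6 + y7 + y8.
Proof.
rewrite !ler_norml => /andP[? ?] /andP[? ?] /andP[? ?] /andP[? ?].
by move=> /andP[? ?] /andP[? ?] /andP[? ?] /andP[? ?]; apply/andP; split; lra.
Qed.

Lemma quadratic_ge (A B p q r rx i g u u' z lam m mx J mu x y : R) : u' = u ->
  0 <= (r - lam) * g + 2 * rx * u + (i - lam) * z ->
  0 <= (m - mu) * (x * x) + 2 * mx * (x * y) + (J - mu) * (y * y) ->
  A * p + B * q + lam * g + lam * z + mu * x ^+ 2 + mu * y ^+ 2 <=
  A * p + B * q + (r * g + rx * u + rx * u' + i * z) +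
  (m * (x * x) + mx * (x * y) + mx * (y * x) + J * (y * y)).
Proof. by move=> -> *; lra. Qed.

Lemma quadratic_le (A B p q r rx arx i g u u' z m mx amx J x y : R) : u' = u ->
  `|2 * (rx * u)| <= arx * (1 * g + 1^-1 * z) ->
  `|2 * (mx * (x * y))| <= amx * (1 * x ^+ 2 + 1^-1 * y ^+ 2) ->
  A * p + B * q + (r * g + rx * u + rx * u' + i * z) +
  (m * (x * x) + mx * (x * y) + mx * (y * x) + J * (y * y)) <=
  A * p + B * q + (r + arx) * g + (i + arx) * z + (m + amx) * x ^+ 2 + (J + amx) * y ^+ 2.
Proof.
move=> ->; rewrite invr1 !mul1r => /ler_normlP[_ h1] /ler_normlP[_ h2].
by lra.
Qed.

Lemma bounds_combine (i1 psi c1 c2 C1 C2 a1 a2 l1 l2 b1 b2 b3 b4 b5 b6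
    m1 m2 m3 m4 s1 s2 s3 s4 s5 s6 : R) :
  a1 * s1 + a2 * s2 + l1 * s3 + l1 * s4 + l2 * s5 + l2 * s6 <= i1 ->
  i1 <= a1 * s1 + a2 * s2 + m1 * s3 + m2 * s4 + m3 * s5 + m4 * s6 ->
  `|psi| <= b1 * s1 + b2 * s2 + b3 * s3 + b4 * s4 + b5 * s5 + b6 * s6 ->
  c1 * (s1 + s2 + s3 + s4 + s5 + s6) <=
    a1 * s1 + a2 * s2 + l1 * s3 + l1 * s4 + l2 * s5 + l2 * s6 ->
  c2 * (s1 + s2 + s3 + s4 + s5 + s6) <= (a1 - b1) * s1 + (a2 - b2) * s2 +
    (l1 - b3) * s3 + (l1 - b4) * s4 + (l2 - b5) * s5 + (l2 - b6) * s6 ->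
  a1 * s1 + a2 * s2 + m1 * s3 + m2 * s4 + m3 * s5 + m4 * s6 <=
    C1 * (s1 + s2 + s3 + s4 + s5 + s6) ->
  b1 * s1 + b2 * s2 + b3 * s3 + b4 * s4 + b5 * s5 + b6 * s6 <=
    C2 * (s1 + s2 + s3 + s4 + s5 + s6) ->
  0 <= s1 + s2 + s3 + s4 + s5 + s6 -> 0 <= C1 -> 0 <= C2 ->
  [/\ Num.min c1 c2 * (s1 + s2 + s3 + s4 + s5 + s6) <= i1,
      i1 <= (C1 + C2) * (s1 + s2 + s3 + s4 + s5 + s6),
      Num.min c1 c2 * (s1 + s2 + s3 + s4 + s5 + s6) <= i1 + psi &
      i1 + psi <= (C1 + C2) * (s1 + s2 + s3 + s4 + s5 + s6)].
Proof.
move=> h1 h2 /ler_normlP[h3 h3'] h4 h5 h6 h7 s0 C10 C20.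
have m_c1 : Num.min c1 c2 * (s1 + s2 + s3 + s4 + s5 + s6) <=
    c1 * (s1 + s2 + s3 + s4 + s5 + s6) by rewrite ler_wpM2r// ge_min lexx.
have m_c2 : Num.min c1 c2 * (s1 + s2 + s3 + s4 + s5 + s6) <=
    c2 * (s1 + s2 + s3 + s4 + s5 + s6) by rewrite ler_wpM2r// ge_min lexx orbT.
have C2s := mulr_ge0 C20 s0; rewrite mulrDl.
move: (Num.min c1 c2 * _) m_c1 m_c2 => m m_c1 m_c2.
by split; lra.
Qed.

Lemma lt_half (x y m : R) : 2 * x < m -> 2 * y < m -> x + y < m.
Proof. by move=> *; lra. Qed.

Lemma lt_halves (x y m : R) : x < m / 2 -> y < m / 2 -> x + y < m.
Proof. by move=> *; lra. Qed.

Variable l : R.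
Local Notation L2l := (L2 (mu_itv l)).
Implicit Types (u v : L2l).

Lemma psd_form (a b d : R) u v : 0 <= a -> 0 <= d -> b ^+ 2 <= a * d ->
  0 <= a * ip u u + 2 * b * ip u v + d * ip v v.
Proof.
move=> a0 d0 bad; have [aE|aN0] := eqVneq a 0.
  move: bad; rewrite aE mul0r => b2; have -> : b = 0.
    by apply/eqP; rewrite -sqrf_eq0 eq_le b2 sqr_ge0.
  by rewrite mul0r mulr0 mul0r !add0r mulr_ge0// ip_ge0.
have {aN0 a0}a0 : 0 < a by rewrite lt_neqAle eq_sym aN0.
have alg (x y z : R) : a * (a * x + 2 * b * y + d * z) =
    (a ^+ 2 * x + 2 * a * (b * y) + b * (b * z)) + (a * d - b ^+ 2) * z by ring.
rewrite -(pmulr_rge0 _ a0) alg addr_ge0//; last by rewrite mulr_ge0 ?ip_ge0 ?subr_ge0.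
have := ip_ge0 (a *: u + b *: v); rewrite (form_sqr (ip_inner _))//.
by rewrite ipZr ipZl ipZr.
Qed.

Lemma cross_scalar (c x y a q : R) : 0 < a -> y ^+ 2 <= q ->
  `|2 * (c * (x * y))| <= `|c| * (a * x ^+ 2 + a^-1 * q).
Proof.
move=> a0 yq; rewrite (_ : 2 * _ = c * (2 * (x * y))); last by ring.
rewrite normrM ler_wpM2l//.
apply: (@le_trans _ _ (a * x ^+ 2 + a^-1 * y ^+ 2)); last first.
  by rewrite lerD2l ler_pM2l// invr_gt0.
have sq (s : R) : 0 <= a * x ^+ 2 + s * (2 * (x * y)) + s ^+ 2 * a^-1 * y ^+ 2.
  have -> : a * x ^+ 2 + s * (2 * (x * y)) + s ^+ 2 * a^-1 * y ^+ 2 =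
    a^-1 * (a * x + s * y) ^+ 2 by field; rewrite gt_eqF.
  by rewrite mulr_ge0 ?sqr_ge0// invr_ge0 ltW.
have := sq 1; have := sq (-1); rewrite ler_norml sqrrN expr1n !mul1r mulN1r => h1 h2.
by apply/andP; split; lra.
Qed.

Lemma cross_form (c a q : R) u v : 0 < a -> ip v v <= q ->
  `|2 * (c * ip u v)| <= `|c| * (a * ip u u + a^-1 * q).
Proof.
move=> a0 vq; have alg (x : R) : 2 * (c * x) = c * (2 * x) by ring.
rewrite alg normrM ler_wpM2l// normrM gtr0_norm//.
apply: le_trans (ip_young _ _ a0) _.
by rewrite lerD2l ler_pM2l// invr_gt0.
Qed.

End Coercivity.

Section NormEquivalence.
Context {R : realType}.
Variable P : parameters R.

Local Notation l := (len P).
Local Notation rho := (rho P).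
Local Notation Iw := (Iw P).
Local Notation ms := (ms P).
Local Notation xc := (xc P).
Local Notation c_w := (c_w P).
Local Notation c_p := (c_p P).
Local Notation eps1 := (eps1 P).
Local Notation eps2 := (eps2 P).
Local Notation Iws := (Iws P).
Local Notation Jss := (Jss P).
Local Notation L2l := (L2 (mu_itv l)).

Hypothesis hP : standing_assumptions P.
Hypothesis eps1_lt : (eps1%:E < Km1 P)%E.
Hypothesis eps2_lt : (eps2%:E < Km2 P)%E.

(** Wirtinger's constant. All coefficients of (S) are rewritten in terms of it. *)
Definition W : R := 4 * l ^+ 2 / pi ^+ 2.

Lemma W_gt0 : 0 < W.
Proof.
case: hP => -[l0 _ _ _ _] _ _ _ _; have p0 := pi_gt0 R.
by rewrite /W divr_gt0 ?mulr_gt0 ?exprn_gt0.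
Qed.

Lemma Iws_gt0 : 0 < Iws.
Proof.
by case: hP => -[l0 r0 I0 _ _] _ _ _ _; rewrite ltr_pwDl// mulr_ge0 ?sqr_ge0 ?ltW.
Qed.

Lemma Jss_gt0 : 0 < Jss.
Proof.
by case: hP => -[l0 r0 I0 m0 J0] _ _ _ _; rewrite ltr_pwDl// mulr_ge0 ?sqr_ge0 ?ltW.
Qed.

Lemma H2L_bounds (f : L2l) : H2L f -> [/\ ip f f <= W ^+ 2 * ip (wD (wD f)) (wD (wD f)),
  AC_rep f l ^+ 2 <= l * W * ip (wD (wD f)) (wD (wD f)) &
  ip (wD f) (wD f) <= W * ip (wD (wD f)) (wD (wD f))].
Proof.
move=> [f1 f2 f0 df0]; case: hP => -[l0 _ _ _ _] _ _ _ _.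
have w1 : ip f f <= W * ip (wD f) (wD f) by exact: wirtinger.
have w2 : ip (wD f) (wD f) <= W * ip (wD (wD f)) (wD (wD f)) by exact: wirtinger.
have bd := boundary_le l0 f1 f0.
have alg (x y z c : R) : x <= W * y -> y <= W * z -> c <= l * y ->
    [/\ x <= W ^+ 2 * z, c <= l * W * z & y <= W * z].
  move=> xy yz cy; have Wyz := ler_wpM2l (ltW W_gt0) yz.
  have lyz := ler_wpM2l (ltW l0) yz.
  split; [|rewrite -mulrA|by []]; last exact: le_trans lyz.
  by rewrite expr2 -mulrA; exact: le_trans Wyz.
exact: (alg _ _ _ _ w1 w2 bd).
Qed.

Lemma H1L_bounds (h : L2l) : H1L h -> ip h h <= W * ip (wD h) (wD h) /\
  AC_rep h l ^+ 2 <= l * ip (wD h) (wD h).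
Proof.
move=> [h1 h0]; case: hP => -[l0 _ _ _ _] _ _ _ _.
by split; [exact: wirtinger|exact: boundary_le].
Qed.

(** Young weights for the products with f and h. As rho * a = sqrt rho / c_w, the condition eps1 *
    rho * a < lam / 2 is the second entry of [Km1]; the weight b gives the entries of [Km2] with
    sqrt Iw * c_p in the same way. *)
Let a : R := (Num.sqrt rho * c_w)^-1.
Let b : R := (Num.sqrt Iw * c_p)^-1.
Let lam : R := lambda_min (M P).
Let lams : R := lambda_min (Ms P).

(** Coefficients with which Young's inequality bounds |Psi X X| by the squares of f'', h', g, z and
    the two tip velocities, in this order. *)
Let A_p := eps1 * (1 + `|xc|) * (rho * W ^+ 2 * a^-1 + ms * l * W).
Let A_h := eps2 * ((rho * `|xc| + Iws) * W * b^-1 + (ms * `|xc| + Jss) * l).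
Let A_g := eps1 * rho * a + eps2 * rho * `|xc| * b.
Let A_z := eps1 * rho * `|xc| * a + eps2 * Iws * b.
Let A_w := eps1 * ms + eps2 * ms * `|xc|.
Let A_q := eps1 * ms * `|xc| + eps2 * Jss.

(** Each weight of [Psi] stays below the matching coefficient of the lower bound of [inner1]. Those
    of f'' and h' involve a single eps; the four others mix eps1 and eps2, and the factor 2 in the
    denominators of the thresholds leaves half of the eigenvalue to each. *)
Lemma weights_lt : [/\ [/\ A_p < rho * c_w ^+ 2, A_h < Iw * c_p ^+ 2 & A_g < lam],
  A_z < lam, A_w < lams, A_q < lams & 0 < lam].
Proof.
have I0 := Iws_gt0; have J0 := Jss_gt0.
case: hP => -[l0 r0 Iw0 m0 _] [cw0 cp0 _ _] [_ _ e1 e2] _ _.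
have p0 := pi_gt0 R; have x0 := normr_ge0 xc.
have sr0 : 0 < Num.sqrt rho by rewrite sqrtr_gt0.
have si0 : 0 < Num.sqrt Iw by rewrite sqrtr_gt0.
have srE : Num.sqrt rho ^+ 2 = rho by rewrite sqr_sqrtr// ltW.
have siE : Num.sqrt Iw ^+ 2 = Iw by rewrite sqr_sqrtr// ltW.
have r32 : rho `^ (3 / 2) = rho * Num.sqrt rho.
  rewrite (_ : 3 / 2 = 1 + 2^-1); last by field.
  by rewrite powRD ?gt_eqF ?implybT// powRr1 ?ltW// powR12_sqrt ?ltW.
move: eps1_lt; rewrite /Km1 !big_cons big_nil !lt_min => /and5P[q1 q2 q3 q4 /andP[q5 _]].
move: eps2_lt; rewrite /Km2 !big_cons big_nil !lt_min => /and5P[t1 t2 t3 t4 /andP[t5 _]].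
have lam0 : 0 < lam.
  have : 0 < c_w * lam by apply: (ediv_gt0 e1 _ q2); rewrite mulr_gt0.
  by rewrite pmulr_rgt0.
have lams0 : 0 < lams by apply: (ediv_gt0 e1 _ q4); rewrite mulr_gt0.
rewrite -/lam -/lams in q2 q3 q4 q5 t2 t3 t4 t5.
have pos (x y : R) : 0 <= x -> 0 <= y -> 0 <= x * y by exact: mulr_ge0.
have x1 : 0 < 1 + `|xc| by rewrite ltr_pwDl.
have [r_ge m_ge l_ge J_ge] := And4 (ltW r0) (ltW m0) (ltW l0) (ltW J0).
have [i_ge I_ge c_ge d_ge] := And4 (ltW I0) (ltW Iw0) (ltW cw0) (ltW cp0).
have [sr_ge si_ge p_ge x1_ge] := And4 (ltW sr0) (ltW si0) (ltW p0) (ltW x1).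
have Q1 : eps1 * (4 * l ^+ 3 * (1 + `|xc|) * (4 * l * (rho * Num.sqrt rho) * c_w +
    pi ^+ 2 * ms)) < pi ^+ 4 * rho * c_w ^+ 2.
  by rewrite -r32; apply: (ediv_lt _ _ q1);
    rewrite ?r32 ?(p_ge, p0, i_ge, J_ge, mulr_ge0, addr_ge0, exprn_ge0, mulr_gt0, exprn_gt0).
have Q2 : eps1 * (2 * Num.sqrt rho) < c_w * lam.
  by apply: (ediv_lt _ _ q2); rewrite ?(r_ge, i_ge, sr_ge, x0, lam0, si0, cw0, cp0, mulr_ge0, mulr_gt0).
have Q3 : eps1 * (2 * Num.sqrt rho * `|xc|) < c_w * lam.
  by apply: (ediv_lt _ _ q3); rewrite ?(r_ge, i_ge, sr_ge, x0, lam0, si0, cw0, cp0, mulr_ge0, mulr_gt0).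
have Q4 : eps1 * (2 * ms) < lams by apply: (ediv_lt _ _ q4); rewrite ?(m_ge, J_ge, x0, mulr_ge0).
have Q5 : eps1 * (2 * ms * `|xc|) < lams by apply: (ediv_lt _ _ q5); rewrite ?(m_ge, J_ge, x0, mulr_ge0).
have T1 : eps2 * (4 * l ^+ 2 * (Iws + rho * `|xc|) * Num.sqrt Iw * c_p
        + pi ^+ 2 * l * (Jss + ms * `|xc|)) < pi ^+ 2 * Iw * c_p ^+ 2.
  by apply: (ediv_lt _ _ t1);
    rewrite ?(p_ge, p0, i_ge, J_ge, mulr_ge0, addr_ge0, exprn_ge0, mulr_gt0, exprn_gt0).
have T2 : eps2 * (2 * rho * `|xc|) < Num.sqrt Iw * c_p * lam.
  by apply: (ediv_lt _ _ t2); rewrite ?(r_ge, i_ge, sr_ge, x0, lam0, si0, cw0, cp0, mulr_ge0, mulr_gt0).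
have T3 : eps2 * (2 * Iws) < Num.sqrt Iw * c_p * lam.
  by apply: (ediv_lt _ _ t3); rewrite ?(r_ge, i_ge, sr_ge, x0, lam0, si0, cw0, cp0, mulr_ge0, mulr_gt0).
have T4 : eps2 * (2 * ms * `|xc|) < lams by apply: (ediv_lt _ _ t4); rewrite ?(m_ge, J_ge, x0, mulr_ge0).
have T5 : eps2 * (2 * Jss) < lams by apply: (ediv_lt _ _ t5); rewrite ?(m_ge, J_ge, x0, mulr_ge0).
have scale (e k : R) : e * (2 * Num.sqrt rho * k) < c_w * lam ->
    e * rho * k * (Num.sqrt rho * c_w)^-1 < lam / 2.
  move=> h; apply: weight_half; first exact: mulr_gt0.
  have {}h : Num.sqrt rho * (e * (2 * Num.sqrt rho * k)) < Num.sqrt rho * (c_w * lam).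
    by rewrite ltr_pM2l.
  rewrite -[in e * rho]srE.
  have alg (s c L : R) : s * (e * (2 * s * k)) < s * (c * L) ->
    e * s ^+ 2 * (2 * k) < s * c * L by rewrite (_ : e * s ^+ 2 * _ = s * (e * (2 * s * k))) ?mulrA//; ring.
  exact: alg.
split; [split| | | |].
- rewrite /A_p /a invrK; exact: weight_bending Q1.
- rewrite /A_h /b invrK; exact: weight_twisting T1.
- apply: lt_halves.
    by have := scale eps1 1; rewrite !mulr1; apply.
  rewrite /b; apply: weight_half; first exact: mulr_gt0.
  by rewrite (_ : eps2 * rho * _ = eps2 * (2 * rho * `|xc|))//; ring.
- apply: lt_halves; first exact: scale.
  by rewrite /b; apply: weight_half => //; exact: mulr_gt0.
- apply: lt_half; [by rewrite mulrCA|].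
  by rewrite (_ : 2 * _ = eps2 * (2 * ms * `|xc|))//; ring.
- apply: lt_half; last by rewrite mulrCA.
  by rewrite (_ : 2 * _ = eps1 * (2 * ms * `|xc|))//; ring.
- exact: lam0.
Qed.

Definition state_size (X : state P) : R :=
  let: (f, g, h, z, zw, zp) := X in
  ip (wD (wD f)) (wD (wD f)) + ip (wD h) (wD h) + ip g g + ip z z + zw ^+ 2 + zp ^+ 2.

(** Eight products, each split by Young's inequality with weight a or b, and weight 1 for those at
    the tip; the displacements are then bounded by f'' and h' through Wirtinger's and the trace
    inequalities. *)
Lemma Psi_le (f g h z : L2l) (zw zp : R) : H2L f -> H1L h ->
  `|@Psi R P (f, g, h, z, zw, zp) (f, g, h, z, zw, zp)| <=
  A_p * ip (wD (wD f)) (wD (wD f)) + A_h * ip (wD h) (wD h) + A_g * ip g g +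
  A_z * ip z z + A_w * zw ^+ 2 + A_q * zp ^+ 2.
Proof.
move=> /H2L_bounds[ff fl _] /H1L_bounds[hh hl].
have I0 := Iws_gt0; have J0 := Jss_gt0.
case: hP => -[l0 r0 Iw0 m0 _] [cw0 cp0 _ _] [_ _ e1 e2] _ _.
have a0 : 0 < a by rewrite invr_gt0 mulr_gt0 ?sqrtr_gt0.
have b0 : 0 < b by rewrite invr_gt0 mulr_gt0 ?sqrtr_gt0.
have n1 : `|rho * eps1| = rho * eps1 by rewrite gtr0_norm ?mulr_gt0.
have n2 : `|rho * xc * eps2| = rho * `|xc| * eps2.
  by rewrite !normrM (gtr0_norm r0) (gtr0_norm e2).
have n3 : `|rho * xc * eps1| = rho * `|xc| * eps1.
  by rewrite !normrM (gtr0_norm r0) (gtr0_norm e1).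
have n4 : `|Iws * eps2| = Iws * eps2 by rewrite gtr0_norm ?mulr_gt0.
have n5 : `|ms * eps1| = ms * eps1 by rewrite gtr0_norm ?mulr_gt0.
have n6 : `|ms * xc * eps2| = ms * `|xc| * eps2.
  by rewrite !normrM (gtr0_norm m0) (gtr0_norm e2).
have n7 : `|ms * xc * eps1| = ms * `|xc| * eps1.
  by rewrite !normrM (gtr0_norm m0) (gtr0_norm e1).
have n8 : `|Jss * eps2| = Jss * eps2 by rewrite gtr0_norm ?mulr_gt0.
have t1 := cross_form (rho * eps1) g a0 ff.
have t2 := cross_form (rho * xc * eps2) g b0 hh.
have t3 := cross_form (rho * xc * eps1) z a0 ff.
have t4 := cross_form (Iws * eps2) z b0 hh.
have t5 := cross_scalar (ms * eps1) zw (@ltr01 R) fl.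
have t6 := cross_scalar (ms * xc * eps2) zw (@ltr01 R) hl.
have t7 := cross_scalar (ms * xc * eps1) zp (@ltr01 R) fl.
have t8 := cross_scalar (Jss * eps2) zp (@ltr01 R) hl.
rewrite n1 in t1; rewrite n2 in t2; rewrite n3 in t3; rewrite n4 in t4.
rewrite n5 in t5; rewrite n6 in t6; rewrite n7 in t7; rewrite n8 in t8.
rewrite PsiE; apply: le_trans (norm_sum8 t1 t2 t3 t4 t5 t6 t7 t8) _.
rewrite /A_p /A_h /A_g /A_z /A_w /A_q le_eqVlt; apply/orP; left; apply/eqP.
have alg2 (r e x q W' ia p g' u e' ib h' z' i m J L w v : R) :
  r * e * (u * g' + ia * (W' ^+ 2 * p)) + r * x * e' * (v * g' + ib * (W' * h')) +
  r * x * e * (u * z' + ia * (W' ^+ 2 * p)) + i * e' * (v * z' + ib * (W' * h')) +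
  m * e * (1 * w + 1^-1 * (L * W' * p)) + m * x * e' * (1 * w + 1^-1 * (L * h')) +
  m * x * e * (1 * q + 1^-1 * (L * W' * p)) + J * e' * (1 * q + 1^-1 * (L * h')) =
  e * (1 + x) * (r * W' ^+ 2 * ia + m * L * W') * p +
  e' * ((r * x + i) * W' * ib + (m * x + J) * L) * h' + (e * r * u + e' * r * x * v) * g' +
  (e * r * x * u + e' * i * v) * z' + (e * m + e' * m * x) * w + (e * m * x + e' * J) * q.
  by rewrite invr1; ring.
exact: alg2.
Qed.

Lemma inner1_ge (f g h z : L2l) (zw zp : R) :
  rho * c_w ^+ 2 * ip (wD (wD f)) (wD (wD f)) + Iw * c_p ^+ 2 * ip (wD h) (wD h) +
  lam * ip g g + lam * ip z z + lams * zw ^+ 2 + lams * zp ^+ 2 <=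
  @inner1 R P (f, g, h, z, zw, zp) (f, g, h, z, zw, zp).
Proof.
have [r1 r2 r3] := lambda_min_psd rho (rho * xc) Iws.
have [s1 s2 s3] := lambda_min_psd ms (ms * xc) Jss.
rewrite inner1E; apply: quadratic_ge; first exact: ip_sym.
  by apply: psd_form; rewrite ?subr_ge0.
by apply: psd_scalar; rewrite ?subr_ge0.
Qed.

Lemma inner1_le (f g h z : L2l) (zw zp : R) :
  @inner1 R P (f, g, h, z, zw, zp) (f, g, h, z, zw, zp) <=
  rho * c_w ^+ 2 * ip (wD (wD f)) (wD (wD f)) + Iw * c_p ^+ 2 * ip (wD h) (wD h) +
  (rho + `|rho * xc|) * ip g g + (Iws + `|rho * xc|) * ip z z +
  (ms + `|ms * xc|) * zw ^+ 2 + (Jss + `|ms * xc|) * zp ^+ 2.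
Proof.
rewrite inner1E; apply: quadratic_le; first exact: ip_sym.
  exact: cross_form (lexx _).
exact: cross_scalar (lexx _).
Qed.

Lemma norm_equiv : exists c C : R, [/\ 0 < c, 0 < C & forall X, Hspace P X ->
  [/\ c * state_size X <= inner1 X X, inner1 X X <= C * state_size X,
      c * state_size X <= inner2 X X & inner2 X X <= C * state_size X]].
Proof.
have [[kp kh kg] kz kw kq lam0] := weights_lt.
have lams0 : 0 < lams.
  apply: le_lt_trans kw; case: hP => -[l0 r0 Iw0 m0 _] _ [_ _ e1 e2] _ _.
  by rewrite /A_w !(addr_ge0, mulr_ge0) ?normr_ge0 ?(ltW e1) ?(ltW e2) ?(ltW m0).
have [cp_gt0 ch_gt0] : 0 < rho * c_w ^+ 2 /\ 0 < Iw * c_p ^+ 2.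
  case: hP => -[l0 r0 Iw0 m0 _] [cw0 cp0 _ _] _ _ _.
  by split; rewrite mulr_gt0 ?exprn_gt0.
have [c1 c1_gt0 c1P] := lower_combination cp_gt0 ch_gt0 lam0 lam0 lams0 lams0.
have sub_gt0 (x y : R) : x < y -> 0 < y - x by rewrite subr_gt0.
have [c2 c2_gt0 c2P] := lower_combination (sub_gt0 _ _ kp) (sub_gt0 _ _ kh)
  (sub_gt0 _ _ kg) (sub_gt0 _ _ kz) (sub_gt0 _ _ kw) (sub_gt0 _ _ kq).
have [C1 C1_gt0 C1P] := upper_combination (rho * c_w ^+ 2) (Iw * c_p ^+ 2)
  (rho + `|rho * xc|) (Iws + `|rho * xc|) (ms + `|ms * xc|) (Jss + `|ms * xc|).
have [C2 C2_gt0 C2P] := upper_combination A_p A_h A_g A_z A_w A_q.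
exists (Num.min c1 c2), (C1 + C2).
split; [by rewrite lt_min c1_gt0|exact: addr_gt0|].
move=> [[[[[f g] h] z] zw] zp] /HspaceP[fP hhP].
have Psi_b := Psi_le g z zw zp fP hhP.
have ge1 := inner1_ge f g h z zw zp; have le1 := inner1_le f g h z zw zp.
have p1 := ip_ge0 (wD (wD f)); have p2 := ip_ge0 (wD h); have p3 := ip_ge0 g.
have p4 := ip_ge0 z; have p5 := sqr_ge0 zw; have p6 := sqr_ge0 zp.
have {}c1P := c1P _ _ _ _ _ _ p1 p2 p3 p4 p5 p6.
have {}c2P := c2P _ _ _ _ _ _ p1 p2 p3 p4 p5 p6.
have {}C1P := C1P _ _ _ _ _ _ p1 p2 p3 p4 p5 p6.
have {}C2P := C2P _ _ _ _ _ _ p1 p2 p3 p4 p5 p6.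
have s0 : 0 <= ip (wD (wD f)) (wD (wD f)) + ip (wD h) (wD h) + ip g g + ip z z +
    zw ^+ 2 + zp ^+ 2 by rewrite !addr_ge0.
rewrite /inner2 -[state_size _]/(ip (wD (wD f)) (wD (wD f)) + ip (wD h) (wD h) +
  ip g g + ip z z + zw ^+ 2 + zp ^+ 2).
exact: (bounds_combine ge1 le1 Psi_b c1P c2P C1P C2P s0 (ltW C1_gt0) (ltW C2_gt0)).
Qed.

End NormEquivalence.

(** * Dissipation *)

Section DissipationInequality.
Context {R : realType}.

Lemma young_ge0 (l c a q : R) (u v : L2 (mu_itv l)) : 0 <= c -> 0 < a -> ip v v <= q ->
  c * ip u v <= c / 2 * (a * ip u u + a^-1 * q) /\
  - (c * ip u v) <= c / 2 * (a * ip u u + a^-1 * q).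
Proof.
move=> c0 a0 vq; have := cross_form c u a0 vq; rewrite (ger0_norm c0).
move=> /ler_normlP[h1 h2].
have alg (x y : R) : - (2 * x) <= c * y -> 2 * x <= c * y ->
    x <= c / 2 * y /\ - x <= c / 2 * y by move=> *; split; lra.
exact: alg h1 h2.
Qed.

(** The dissipation estimate as an inequality between reals. [A] and [D] are the stiffnesses rho
    c_w^2 and Iw c_p^2; [pp], [qq], [hh], [zz] the squared norms of f'', g'', h', z'; [gg], [z2],
    [h2] those of g, z, h; [gl], [zl] the tip velocities; [K1], [K2] the feedback terms; the other
    letter pairs are mixed products. The right-hand side collects, square by square, the numbers
    lambda1 to lambda6. *)
Lemma dissipation_sum (eps1 eps2 A D eta_w eta_p aw bw gw ap bp gp rho x ax I m J
    W l r1 r2 r3 r4 r5 r6 r7 r8 K1 K2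
    pp pq qq hh hz zz gg gz z2 h2 hg zh hf zf gf gl zl : R) :
  0 < A -> 0 < D -> 0 < r1 -> 0 < r2 -> 0 < r3 -> 0 < r4 -> 0 < r5 -> 0 < r6 ->
  0 < r7 -> 0 < r8 -> 0 <= K1 -> 0 <= K2 ->
  0 <= eps1 -> 0 <= eps2 -> 0 <= rho -> 0 <= ax -> 0 <= m -> 0 <= I -> 0 <= J -> 0 <= ap ->
  - (eps1 * A * eta_w * pq) <= eps1 * A * eta_w / 2 * (r1 * qq + r1^-1 * pp) ->
  - (eps2 * D * eta_p * hz) <= eps2 * D * eta_p / 2 * (r2 * zz + r2^-1 * hh) ->
  (aw + eps2 * gp) * hg <= (aw + eps2 * gp) / 2 * (r6^-1 * gg + r6 * (W * hh)) ->
  (bw + gp) * gz <= (bw + gp) / 2 * (r7 * z2 + r7^-1 * gg) ->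
  (ap + eps2 * bp) * zh <= (ap + eps2 * bp) / 2 * (r8 * z2 + r8^-1 * (W * hh)) ->
  eps1 * aw * hf <= eps1 * aw / 2 * (r4 * (W * hh) + r4^-1 * (W ^+ 2 * pp)) ->
  eps1 * bw * zf <= eps1 * bw / 2 * (r5 * z2 + r5^-1 * (W ^+ 2 * pp)) ->
  eps1 * gw * gf <= eps1 * gw / 2 * (r3 * gg + r3^-1 * (W ^+ 2 * pp)) ->
  rho * x * (eps1 + eps2) * gz <= rho * ax * (eps1 + eps2) / 2 * (W ^+ 2 * qq + W * zz) ->
  m * x * (eps1 + eps2) * (gl * zl) <=
    m * ax * (eps1 + eps2) / 2 * (l * W * qq + l * zz) ->
  gg <= W ^+ 2 * qq -> z2 <= W * zz -> h2 <= W * hh ->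
  gl ^+ 2 <= l * W * qq -> zl ^+ 2 <= l * zz ->
  - A * eta_w * qq - D * eta_p * zz - eps1 * A * (pp + eta_w * pq) -
  eps2 * D * (hh + eta_p * hz) - K1 - K2 +
  (aw * hg + bw * gz + gw * gg + eps1 * (aw * hf + bw * zf + gw * gf) +
   ap * zh + bp * z2 + gp * gz + eps2 * (ap * h2 + bp * zh + gp * hg)) +
  (rho * eps1 * gg + rho * x * (eps1 + eps2) * gz + I * eps2 * z2) +
  (m * eps1 * gl ^+ 2 + m * x * (eps1 + eps2) * (gl * zl) + J * eps2 * zl ^+ 2) <=
  - (eps1 * (1 - eta_w / (2 * r1) - W ^+ 2 / (2 * A) * (aw / r4 + bw / r5 + gw / r3))) *
    A * pp
  - (A * eta_w - eps2 * ax * (rho * W ^+ 2 + l * W * m) / 2 -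
     eps1 * (rho * (2 + ax) * W ^+ 2 / 2 + A * eta_w * r1 / 2 +
             (2 + ax) * m * l * W / 2)) * qq
  + (gw + (aw + eps2 * gp) / (2 * r6) + eps1 * gw * r3 / 2 + (bw + gp) / (2 * r7)) * gg
  - (eps2 * (1 - eta_p / (2 * r2)) - W / D * ((aw + eps2 * gp) * r6 / 2 +
     (ap + eps2 * bp) / (2 * r8) + eps1 * aw * r4 / 2 + eps2 * ap)) * D * hh
  - (D * eta_p - eps1 * ax * (rho * W + l * m) / 2 -
     eps2 * ((2 * I + ax * rho) * W / 2 + D * eta_p * r2 / 2 +
             l * (2 * J + ax * m) / 2)) * zz
  + (bp + (bw + gp) * r7 / 2 + (ap + eps2 * bp) * r8 / 2 + eps1 * bw * r5 / 2) * z2.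
Proof.
move=> A0 D0 r10 r20 r30 r40 r50 r60 r70 r80 K10 K20 e10 e20 rho0 ax0 m0 I0 J0 ap0.
move=> Y1 Y2 Y3 Y4 Y5 Y6 Y7 Y8 Y9 Y10 ggW z2W h2W glW zlW.
have Z1 := ler_wpM2l (mulr_ge0 rho0 e10) ggW.
have Z2 := ler_wpM2l (mulr_ge0 I0 e20) z2W.
have Z3 := ler_wpM2l (mulr_ge0 e20 ap0) h2W.
have Z4 := ler_wpM2l (mulr_ge0 m0 e10) glW.
have Z5 := ler_wpM2l (mulr_ge0 J0 e20) zlW.
(* The fifteen bounds are added over fresh reals, apart from the nonlinear coefficients. *)
have sum (t1 t2 t3 t4 t5 t6 t7 t8 t9 t10 t11 t12 t13 t14 t15 u1 u2 u3 u4 u5 u6 u7 u8 u9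
    u10 u11 u12 u13 u14 u15 c k1 k2 : R) : t1 <= u1 -> t2 <= u2 -> t3 <= u3 -> t4 <= u4 ->
    t5 <= u5 -> t6 <= u6 -> t7 <= u7 -> t8 <= u8 -> t9 <= u9 -> t10 <= u10 ->
    t11 <= u11 -> t12 <= u12 -> t13 <= u13 -> t14 <= u14 -> t15 <= u15 ->
    0 <= k1 -> 0 <= k2 ->
    c - k1 - k2 + (t1 + t2 + t3 + t4 + t5 + t6 + t7 + t8 + t9 + t10 + t11 + t12 + t13 +
    t14 + t15) <= c + (u1 + u2 + u3 + u4 + u5 + u6 + u7 + u8 + u9 + u10 + u11 + u12 +
    u13 + u14 + u15).
  by clear; move=> *; lra.
have := sum _ _ _ _ _ _ _ _ _ _ _ _ _ _ _ _ _ _ _ _ _ _ _ _ _ _ _ _ _ _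
  (- A * eta_w * qq - D * eta_p * zz - eps1 * A * pp - eps2 * D * hh + gw * gg + bp * z2)
  _ _ Y1 Y2 Y3 Y4 Y5 Y6 Y7 Y8 Y9 Y10 Z1 Z2 Z3 Z4 Z5 K10 K20.
(* The sum of the bounds and the claim have the same two sides up to the field laws. *)
clear sum; set L := (X in X <= _ -> _); set U := (X in _ <= X -> _).
set L' := (X in _ -> X <= _); set U' := (X in _ -> _ <= X).
have -> : L' = L by rewrite /L /L'; ring.
suff -> : U' = U by [].
rewrite /U /U'; field.
by rewrite !gt_eqF.
Qed.

End DissipationInequality.

(** [Gg] to [Zh] are products of the accelerations with g, z, f, h; [Bl] and [tl] are the shear and
    the torque at the tip. The elastic powers cancel against those of the form, and the boundary
    terms of the integrations by parts against the tip equations. The feedback acts on gl + e1 fl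
    and zl + e2 hl, the very combinations tested by the form, so it leaves two negative squares. *)
Lemma generator_form_sum (R : realType) (A D r x i m J e1 e2 ew ep c1 c2 aw bw gw ap bp gp
    qp pq qq pp zh' hz' hh' zz' Gg Gz Zg Zz Gf Zf Gh Zh s0 s1 gl zl fl hl Bl tl
    bg bf tz th gg gz zg zz gf hf zf gh hg zh hz0 hh0 : R) :
  r * Gg + r * x * Zg = - (A * bg) + (aw * hg + bw * zg + gw * gg) ->
  r * Gf + r * x * Zf = - (A * bf) + (aw * hf + bw * zf + gw * gf) ->
  r * x * Gz + i * Zz = D * tz + (ap * hz0 + bp * zz + gp * gz) ->
  r * x * Gh + i * Zh = D * th + (ap * hh0 + bp * zh + gp * gh) ->
  bg = Bl * gl + (pq + ew * qq) -> bf = Bl * fl + (pp + ew * qp) ->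
  tz = tl * zl - (hz' + ep * zz') -> th = tl * hl - (hh' + ep * zh') ->
  m * s0 + m * x * s1 = A * Bl - c1 * (gl + e1 * fl) ->
  m * x * s0 + J * s1 = - (D * tl) - c2 * (zl + e2 * hl) ->
  pq = qp -> hz' = zh' -> hg = gh -> hz0 = zh -> gz = zg ->
  A * qp + D * zh' + (r * Gg + r * x * Gz + r * x * Zg + i * Zz) +
  (m * (s0 * gl) + m * x * (s0 * zl) + m * x * (s1 * gl) + J * (s1 * zl)) +
  (r * e1 * Gf + r * x * e2 * Gh + r * x * e1 * Zf + i * e2 * Zh +
   (r * e1 * gg + r * x * e2 * gz + r * x * e1 * zg + i * e2 * zz) +
   (m * e1 * (s0 * fl) + m * x * e2 * (s0 * hl) + m * x * e1 * (s1 * fl) +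
    J * e2 * (s1 * hl)) +
   (m * e1 * (gl * gl) + m * x * e2 * (gl * zl) + m * x * e1 * (zl * gl) +
    J * e2 * (zl * zl))) =
  - A * ew * qq - D * ep * zz' - e1 * A * (pp + ew * qp) - e2 * D * (hh' + ep * zh') -
  c1 * (gl + e1 * fl) ^+ 2 - c2 * (zl + e2 * hl) ^+ 2 +
  (aw * gh + bw * zg + gw * gg + e1 * (aw * hf + bw * zf + gw * gf) + ap * zh + bp * zz +
   gp * zg + e2 * (ap * hh0 + bp * zh + gp * gh)) +
  (r * e1 * gg + r * x * (e1 + e2) * zg + i * e2 * zz) +
  (m * e1 * gl ^+ 2 + m * x * (e1 + e2) * (gl * zl) + J * e2 * zl ^+ 2).
Proof.
move=> Ug Uf Vz Vh Ebg Ebf Etz Eth E0 E1 Epq Ehz Ehg Ehz0 Egz.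
(* Regrouped so that the left-hand side of every equation of motion appears as a subterm. *)
transitivity (A * qp + D * zh' + (r * Gg + r * x * Zg) + (r * x * Gz + i * Zz) +
  (m * s0 + m * x * s1) * (gl + e1 * fl) + (m * x * s0 + J * s1) * (zl + e2 * hl) +
  e1 * (r * Gf + r * x * Zf) + e2 * (r * x * Gh + i * Zh) +
  (r * e1 * gg + r * x * e2 * gz + r * x * e1 * zg + i * e2 * zz) +
  (m * e1 * (gl * gl) + m * x * e2 * (gl * zl) + m * x * e1 * (zl * gl) +
   J * e2 * (zl * zl))); first by ring.
rewrite Ug Uf Vz Vh E0 E1 Ebg Ebf Etz Eth Epq Ehz Ehg Ehz0 Egz.
by ring.
Qed.

Section Dissipation.
Context {R : realType}.
Variable P : parameters R.

Local Notation l := (len P).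
Local Notation rho := (rho P).
Local Notation Iw := (Iw P).
Local Notation ms := (ms P).
Local Notation xc := (xc P).
Local Notation c_w := (c_w P).
Local Notation c_p := (c_p P).
Local Notation eta_w := (eta_w P).
Local Notation eta_p := (eta_p P).
Local Notation k1 := (k1 P).
Local Notation k2 := (k2 P).
Local Notation eps1 := (eps1 P).
Local Notation eps2 := (eps2 P).
Local Notation aw := (alpha_w P).
Local Notation bw := (beta_w P).
Local Notation gw := (gamma_w P).
Local Notation ap := (alpha_p P).
Local Notation bp := (beta_p P).
Local Notation gp := (gamma_p P).
Local Notation Iws := (Iws P).
Local Notation Jss := (Jss P).
Local Notation L2l := (L2 (mu_itv l)).

Hypothesis hP : standing_assumptions P.

Lemma M_unit : M P \in unitmx.
Proof.
case: hP => -[l0 r0 I0 _ _] _ _ _ _; apply: unit_mx2.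
have -> : rho * Iws - rho * xc * (rho * xc) = rho * Iw by rewrite /Defs.Iws; ring.
by rewrite gt_eqF// mulr_gt0.
Qed.

Lemma Ms_unit : Ms P \in unitmx.
Proof.
case: hP => -[l0 _ _ m0 J0] _ _ _ _; apply: unit_mx2.
have -> : ms * Jss - ms * xc * (ms * xc) = ms * Js P by rewrite /Defs.Jss; ring.
by rewrite gt_eqF// mulr_gt0.
Qed.

(** The equations multiplied by [M] and [Ms]: the forms weigh the velocities by these same matrices,
    so that the inverses disappear from the computation. *)
Lemma opAE (f g h z : L2l) (zw zp : R) : exists (G Z : L2l) (s0 s1 : R),
  [/\ opA P (f, g, h, z, zw, zp) = (g, G, z, Z, s0, s1),
    rho *: G + (rho * xc) *: Z = - ((rho * c_w ^+ 2) *: wD (wD (bend f g))) +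
      (aw *: h + bw *: z + gw *: g),
    (rho * xc) *: G + Iws *: Z = (Iw * c_p ^+ 2) *: wD (twist h z) +
      (ap *: h + bp *: z + gp *: g),
    ms * s0 + ms * xc * s1 = rho * c_w ^+ 2 * AC_rep (wD (bend f g)) l
     - k1 * (AC_rep g l + eps1 * AC_rep f l) &
    ms * xc * s0 + Jss * s1 = - (Iw * c_p ^+ 2 * AC_rep (twist h z) l)
     - k2 * (AC_rep z l + eps2 * AC_rep h l)].
Proof.
set u := (rho * c_w ^+ 2) *: wD (wD (bend f g)).
pose v := (- (Iw * c_p ^+ 2)) *: wD (twist h z).
set F := aw *: h + bw *: z + gw *: g; set N := ap *: h + bp *: z + gp *: g.
set p := rho * c_w ^+ 2 * _ - _; set q := - (Iw * c_p ^+ 2 * _) - _.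
pose gz := mx2_act (- invmx (M P)) u v; pose FM := mx2_act (invmx (M P)) F N.
pose zeta := invmx (Ms P) *m col2 p q.
exists (gz.1 + FM.1), (gz.2 + FM.2), (zeta 0 0), (zeta 1 0).
have [uE vE] := mx2_act_inv u v M_unit.
have [FE NE] := mx2_act_inv F N M_unit.
have [pE qE] := mul_inv_col2 p q Ms_unit.
have neg1 : gz.1 = - (mx2_act (invmx (M P)) u v).1.
  by rewrite /gz /mx2_act /= !mxE !scaleNr -opprD.
have neg2 : gz.2 = - (mx2_act (invmx (M P)) u v).2.
  by rewrite /gz /mx2_act /= !mxE !scaleNr -opprD.
have lin (c e : R) (x y x' y' : L2l) :
    c *: (x + y) + e *: (x' + y') = (c *: x + e *: x') + (c *: y + e *: y').
  by rewrite !scalerDr addrACA.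
split.
- transitivity ((g + 0, gz.1 + FM.1, z + 0, gz.2 + FM.2, zeta 0 0 + 0, zeta 1 0 + 0) : state P).
    exact: erefl.
  by rewrite !addr0.
- by rewrite lin neg1 neg2 !scalerN -opprD uE FE.
- rewrite lin neg1 neg2 !scalerN -opprD vE NE.
  by congr (_ + _); rewrite /v scaleNr opprK.
- exact: pE.
- exact: qE.
Qed.

(** Two integrations by parts. At 0 both boundary terms vanish because w is clamped; at l the second
    one vanishes because the bending moment B does. *)
Lemma bend_ibp (B w : L2l) : sobolev 2 B -> AC_rep B l = 0 -> H2L w ->
  ip (wD (wD B)) w = AC_rep (wD B) l * AC_rep w l + ip B (wD (wD w)).
Proof.
have alg (x y t s : R) : x + y = s -> y + t = 0 -> x = s + t by move=> *; lra.
move=> [B1 [B2 _]] Bl [w1 w2 w0 dw0]; case: hP => -[l0 _ _ _ _] _ _ _ _.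
have i1 := weak_ibp l0 B2 w1; have i2 := weak_ibp l0 B1 w2.
rewrite w0 mulr0 subr0 in i1; rewrite Bl dw0 mul0r mulr0 subr0 in i2.
exact: alg i1 i2.
Qed.

Lemma twist_ibp (t w : L2l) : sobolev 1 t -> H1L w ->
  ip (wD t) w = AC_rep t l * AC_rep w l - ip t (wD w).
Proof.
move=> [t1 _] [w1 w0]; case: hP => -[l0 _ _ _ _] _ _ _ _.
have i1 := weak_ibp l0 t1 w1; rewrite w0 mulr0 subr0 in i1.
have alg (x y s : R) : x + y = s -> x = s - y by move=> *; lra.
exact: alg i1.
Qed.

Lemma inner2_opA (f g h z : L2l) (zw zp : R) : domA P (f, g, h, z, zw, zp) ->
  [/\ H2L f, H2L g, H1L h, H1L z & [/\ zw = AC_rep g l, zp = AC_rep z l &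
  inner2 (opA P (f, g, h, z, zw, zp)) (f, g, h, z, zw, zp) =
  - (rho * c_w ^+ 2) * eta_w * ip (wD (wD g)) (wD (wD g)) -
  (Iw * c_p ^+ 2) * eta_p * ip (wD z) (wD z) -
  eps1 * (rho * c_w ^+ 2) * (ip (wD (wD f)) (wD (wD f)) +
    eta_w * ip (wD (wD g)) (wD (wD f))) -
  eps2 * (Iw * c_p ^+ 2) * (ip (wD h) (wD h) + eta_p * ip (wD z) (wD h)) -
  k1 * (AC_rep g l + eps1 * AC_rep f l) ^+ 2 -
  k2 * (AC_rep z l + eps2 * AC_rep h l) ^+ 2 +
  (aw * ip g h + bw * ip z g + gw * ip g g + eps1 * (aw * ip h f + bw * ip z f +
    gw * ip g f) + ap * ip z h + bp * ip z z + gp * ip z g +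
    eps2 * (ap * ip h h + bp * ip z h + gp * ip g h)) +
  (rho * eps1 * ip g g + rho * xc * (eps1 + eps2) * ip z g + Iws * eps2 * ip z z) +
  (ms * eps1 * AC_rep g l ^+ 2 +
   ms * xc * (eps1 + eps2) * (AC_rep g l * AC_rep z l) +
   Jss * eps2 * AC_rep z l ^+ 2)]].
Proof.
move=> [/HspaceP[fH hH] [[/sobolev2P gH /sobolev1P zH BH tH Bl] [[zwE zpE] _]]].
split=> //; split=> //.
have [G [Z [s0 [s1 [-> UE VE s0E s1E]]]]] := opAE f g h z zw zp.
have ipU w : rho * ip G w + rho * xc * ip Z w =
    - (rho * c_w ^+ 2 * ip (wD (wD (bend f g))) w) +
    (aw * ip h w + bw * ip z w + gw * ip g w).
  have := congr1 (fun u => ip u w) UE.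
  by rewrite !ipDl ipNl !ipZl.
have ipV w : rho * xc * ip G w + Iws * ip Z w =
    Iw * c_p ^+ 2 * ip (wD (twist h z)) w +
    (ap * ip h w + bp * ip z w + gp * ip g w).
  have := congr1 (fun u => ip u w) VE.
  by rewrite !ipDl !ipZl.
have ip_bend w : ip (bend f g) w = ip (wD (wD f)) w + eta_w * ip (wD (wD g)) w.
  by apply: etrans (ipDl _ _ _) _; congr (_ + _); exact: ipZl.
have ip_twist w : ip (twist h z) w = ip (wD h) w + eta_p * ip (wD z) w.
  by apply: etrans (ipDl _ _ _) _; congr (_ + _); exact: ipZl.
have bE w : H2L w -> ip (wD (wD (bend f g))) w =
    AC_rep (wD (bend f g)) l * AC_rep w l +
    (ip (wD (wD f)) (wD (wD w)) + eta_w * ip (wD (wD g)) (wD (wD w))).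
  by move=> wH; apply: etrans (bend_ibp BH Bl wH) _; congr (_ + _); exact: ip_bend.
have tE w : H1L w -> ip (wD (twist h z)) w =
    AC_rep (twist h z) l * AC_rep w l - (ip (wD h) (wD w) + eta_p * ip (wD z) (wD w)).
  by move=> wH; apply: etrans (twist_ibp tH wH) _; congr (_ - _); exact: ip_twist.
rewrite /inner2 inner1E PsiE zwE zpE.
exact: (generator_form_sum (ipU g) (ipU f) (ipV z) (ipV h) (bE _ gH) (bE _ fH)
  (tE _ zH) (tE _ hH) s0E s1E (ip_sym _ _) (ip_sym _ _) (ip_sym _ _) (ip_sym _ _)
  (ip_sym _ _)).
Qed.

End Dissipation.

Section DissipativeOperator.
Context {R : realType}.

(** This identity and the next three bring the coefficients of (S) to the shape produced by
    [dissipation_sum], with 4 L^2 / p^2 in place of the powers of p and L. *)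
Lemma lambda1_W (p L r c : R) : p != 0 -> r != 0 -> c != 0 ->
  8 * L ^+ 4 / (p ^+ 4 * r * c ^+ 2) = (4 * L ^+ 2 / p ^+ 2) ^+ 2 / (2 * (r * c ^+ 2)).
Proof. by move=> p0 r0 c0; field; rewrite p0 r0 c0. Qed.

Lemma lambda4_W (p L r c : R) : p != 0 -> r != 0 -> c != 0 ->
  4 * L ^+ 2 / (p ^+ 2 * r * c ^+ 2) = (4 * L ^+ 2 / p ^+ 2) / (r * c ^+ 2).
Proof. by move=> p0 r0 c0; field; rewrite p0 r0 c0. Qed.

Lemma lambda3_W (p L r c eta e1 e2 ax m s : R) : p != 0 -> r != 0 ->
  r * (eta * c ^+ 2 - e2 * (2 * L ^+ 3 * ax / p ^+ 2) * (4 * L / p ^+ 2 + m / r) -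
    e1 * (8 * L ^+ 4 * (2 + ax) / p ^+ 4 + eta * c ^+ 2 * s / 2 +
      2 * L ^+ 3 * (2 + ax) * m / (p ^+ 2 * r))) =
  r * c ^+ 2 * eta -
  e2 * ax * (r * (4 * L ^+ 2 / p ^+ 2) ^+ 2 + L * (4 * L ^+ 2 / p ^+ 2) * m) / 2 -
  e1 * (r * (2 + ax) * (4 * L ^+ 2 / p ^+ 2) ^+ 2 / 2 + r * c ^+ 2 * eta * s / 2 +
    (2 + ax) * m * L * (4 * L ^+ 2 / p ^+ 2) / 2).
Proof. by move=> p0 r0; field; rewrite p0 r0. Qed.

Lemma lambda6_W (p L r I c eta e1 e2 ax m i J s : R) : p != 0 -> I != 0 ->
  I * (eta * c ^+ 2 - e1 * (L * ax / I) * (2 * L * r / p ^+ 2 + m / 2) -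
    e2 * (2 * L ^+ 2 * ((2 * i + ax * r) / (p ^+ 2 * I)) + eta * c ^+ 2 * s / 2 +
      L * (2 * J + ax * m) / (2 * I))) =
  I * c ^+ 2 * eta - e1 * ax * (r * (4 * L ^+ 2 / p ^+ 2) + L * m) / 2 -
  e2 * ((2 * i + ax * r) * (4 * L ^+ 2 / p ^+ 2) / 2 + I * c ^+ 2 * eta * s / 2 +
    L * (2 * J + ax * m) / 2).
Proof. by move=> p0 I0; field; rewrite p0 I0. Qed.

Lemma lambda2_ge0 (a b g e1 e2 k r s t : R) : 0 <= a -> 0 <= b -> 0 <= g -> 0 <= e1 ->
  0 <= e2 -> 0 <= k -> 0 <= r -> 0 <= s -> 0 <= t ->
  0 <= g + (a + e2 * k) / (2 * s) + e1 * g * r / 2 + (b + k) / (2 * t).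
Proof.
by move=> *; rewrite !addr_ge0// divr_ge0 ?mulr_ge0 ?addr_ge0// mulr_ge0.
Qed.

Lemma lambda5_ge0 (a b b' g e1 e2 r s t : R) : 0 <= a -> 0 <= b -> 0 <= b' -> 0 <= g ->
  0 <= e1 -> 0 <= e2 -> 0 <= r -> 0 <= s -> 0 <= t ->
  0 <= b + (b' + g) * s / 2 + (a + e2 * b) * t / 2 + e1 * b' * r / 2.
Proof.
by move=> *; rewrite !addr_ge0// divr_ge0 ?mulr_ge0 ?addr_ge0// mulr_ge0.
Qed.

(** The hypothesis is multiplied by (4 L^2 / p^2)^2 = 16 L^4 / p^4; the analogue for [mu6] uses the
    first power. *)
Lemma mu3_W (p L x y : R) : 0 < p -> 0 < L -> 0 < p ^+ 4 * x / (16 * L ^+ 4) - y ->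
  0 < x - (4 * L ^+ 2 / p ^+ 2) ^+ 2 * y.
Proof.
move=> p0 L0 h; have LN0 : L != 0 by rewrite gt_eqF.
have pN0 : p != 0 by rewrite gt_eqF.
have -> : x - (4 * L ^+ 2 / p ^+ 2) ^+ 2 * y =
  (4 * L ^+ 2 / p ^+ 2) ^+ 2 * (p ^+ 4 * x / (16 * L ^+ 4) - y).
  by field; rewrite pN0 LN0.
have W0 : 0 < 4 * L ^+ 2 / p ^+ 2 by rewrite divr_gt0 ?mulr_gt0 ?exprn_gt0.
by rewrite mulr_gt0 ?exprn_gt0.
Qed.

Lemma mu6_W (p L x y : R) : 0 < p -> 0 < L -> 0 < p ^+ 2 * x / (4 * L ^+ 2) - y ->
  0 < x - 4 * L ^+ 2 / p ^+ 2 * y.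
Proof.
move=> p0 L0 h; have LN0 : L != 0 by rewrite gt_eqF.
have pN0 : p != 0 by rewrite gt_eqF.
have -> : x - 4 * L ^+ 2 / p ^+ 2 * y =
  4 * L ^+ 2 / p ^+ 2 * (p ^+ 2 * x / (4 * L ^+ 2) - y).
  by field; rewrite pN0 LN0.
have W0 : 0 < 4 * L ^+ 2 / p ^+ 2 by rewrite divr_gt0 ?mulr_gt0 ?exprn_gt0.
by rewrite mulr_gt0.
Qed.

(** The growth terms in g and z are absorbed by g'' and z'. What remains of these two must control
    four squares of the state, namely g, z and the tip velocities, so each rate is halved and used
    twice. *)
Lemma dissipation_combine (E I2 S C Cs c A D l1 l2 l3 l4 l5 l6 W W2
    pp qq hh zz gg z2 : R) :
  0 < c -> 0 < C -> 0 < Cs -> 0 <= l2 -> 0 <= l5 -> gg <= W2 * qq -> z2 <= W * zz ->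
  E <= - l1 * A * pp - l3 * qq + l2 * gg - l4 * D * hh - l6 * zz + l5 * z2 ->
  c * (pp + hh + qq + zz + qq + zz) <= l1 * A * pp + l4 * D * hh +
    (l3 - W2 * l2) / 2 * qq + (l6 - W * l5) / 2 * zz + (l3 - W2 * l2) / 2 * qq +
    (l6 - W * l5) / 2 * zz ->
  I2 <= C * S -> S <= Cs * (pp + hh + qq + zz + qq + zz) ->
  E <= - (c / (C * Cs)) * I2.
Proof.
move=> c0 C0 Cs0 l20 l50 ggW z2W Ele lower I2S SCs.
have h1 := ler_wpM2l l20 ggW; have h2 := ler_wpM2l l50 z2W.
have CCs0 : 0 < C * Cs by rewrite mulr_gt0.
have I2le : I2 <= C * Cs * (pp + hh + qq + zz + qq + zz).
  by apply: le_trans I2S _; rewrite -mulrA ler_pM2l.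
have w0 : 0 <= c / (C * Cs) by rewrite divr_ge0// ltW.
have := ler_wpM2l w0 I2le.
rewrite mulrA divfK ?gt_eqF// => h3.
rewrite mulNr; move: (c / (C * Cs) * I2) h3 => w h3. 
by move: lower Ele h1 h2 h3; clear; move=> *; lra.
Qed.

End DissipativeOperator.

Section Dissipative.
Context {R : realType}.
Variable P : parameters R.

Local Notation l := (len P).
Local Notation rho := (rho P).
Local Notation Iw := (Iw P).
Local Notation ms := (ms P).
Local Notation xc := (xc P).
Local Notation c_w := (c_w P).
Local Notation c_p := (c_p P).
Local Notation Iws := (Iws P).
Local Notation Jss := (Jss P).
Local Notation L2l := (L2 (mu_itv l)).

Hypothesis hP : standing_assumptions P.
Hypothesis hS : structural_assumption P.

Lemma eps_lt : ((eps1 P)%:E < Km1 P)%E /\ ((eps2 P)%:E < Km2 P)%E.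
Proof.
case: hS => _ + _ + _; rewrite !lt_min => /andP[_ ?] /andP[_ ?].
by split.
Qed.

Let eps1_lt : ((eps1 P)%:E < Km1 P)%E. Proof. by have [] := eps_lt. Qed.
Let eps2_lt : ((eps2 P)%:E < Km2 P)%E. Proof. by have [] := eps_lt. Qed.

Local Notation eps1 := (eps1 P).
Local Notation eps2 := (eps2 P).
Local Notation k1 := (k1 P).
Local Notation k2 := (k2 P).

Lemma le_half_sum (c a x y z t : R) : 0 <= c -> 0 <= a -> x <= y ->
  t <= c / 2 * (a * x + z) -> t <= c / 2 * (a * y + z).
Proof.
move=> c0 a0 xy h; apply: le_trans h _; rewrite ler_wpM2l ?divr_ge0// lerD2r.
exact: ler_wpM2l.
Qed.

Lemma le_half_norm (t d x y z : R) : 0 <= d -> x <= y ->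
  `|2 * t| <= d * (1 * x + 1^-1 * z) -> t <= d / 2 * (y + z).
Proof.
move=> d0 xy /ler_normlP[_]; rewrite invr1 !mul1r.
have := ler_wpM2l d0 xy; lra.
Qed.

Section Multipliers.
Variables r1 r2 r3 r4 r5 r6 r7 r8 : R.
Hypotheses (r10 : 0 < r1) (r20 : 0 < r2) (r30 : 0 < r3) (r40 : 0 < r4).
Hypotheses (r50 : 0 < r5) (r60 : 0 < r6) (r70 : 0 < r7) (r80 : 0 < r8).

Lemma inner2_opA_le (f g h z : L2l) (zw zp : R) : domA P (f, g, h, z, zw, zp) ->
  inner2 (opA P (f, g, h, z, zw, zp)) (f, g, h, z, zw, zp) <=
  - lambda1 P r1 r3 r4 r5 * (rho * c_w ^+ 2) * ip (wD (wD f)) (wD (wD f))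
  - lambda3 P r1 * ip (wD (wD g)) (wD (wD g)) + lambda2 P r3 r6 r7 * ip g g
  - lambda4 P r2 r4 r6 r8 * (Iw * c_p ^+ 2) * ip (wD h) (wD h)
  - lambda6 P r2 * ip (wD z) (wD z) + lambda5 P r5 r7 r8 * ip z z.
Proof.
move=> DX; have [fH gH hH zH [zwE zpE E]] := inner2_opA hP DX.
have I0 := Iws_gt0 hP; have J0 := Jss_gt0 hP; have W0 := W_gt0 hP.
case: (hP) => -[l0 r0 Iw0 m0 _] [cw0 cp0 ew0 ep0] [k10 k20 e1 e2].
move=> [aw0 bw0 gw0] [ap0 bp0 gp0].
have [ff _ _] := H2L_bounds hP fH; have [gg gl _] := H2L_bounds hP gH.
have [hh _] := H1L_bounds hP hH; have [zz zl] := H1L_bounds hP zH.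
have pN0 : (pi : R) != 0 by rewrite gt_eqF// pi_gt0.
have [rN0 IN0 cwN0 cpN0] : [/\ rho != 0, Iw != 0, c_w != 0 & c_p != 0].
  by split; rewrite gt_eqF.
have A0 : 0 < rho * c_w ^+ 2 by rewrite mulr_gt0 ?exprn_gt0.
have D0 : 0 < Iw * c_p ^+ 2 by rewrite mulr_gt0 ?exprn_gt0.
have [e1_ge e2_ge r_ge m_ge] := And4 (ltW e1) (ltW e2) (ltW r0) (ltW m0).
have [I_ge J_ge k1_ge k2_ge] := And4 (ltW I0) (ltW J0) (ltW k10) (ltW k20).
have [r4_ge r5_ge r3_ge A_ge] := And4 (ltW r40) (ltW r50) (ltW r30) (ltW A0).
have [D_ge ew_ge ep_ge] := And3 (ltW D0) (ltW ew0) (ltW ep0).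
have x_ge := normr_ge0 xc.
have M0 (x y : R) : 0 <= x -> 0 <= y -> 0 <= x * y by exact: mulr_ge0.
have S0 (x y : R) : 0 <= x -> 0 <= y -> 0 <= x + y by exact: addr_ge0.
have Y1 := (young_ge0 (wD (wD g)) (M0 _ _ (M0 _ _ e1_ge A_ge) ew_ge) r10
  (lexx (ip (wD (wD f)) (wD (wD f))))).2.
have Y2 := (young_ge0 (wD z) (M0 _ _ (M0 _ _ e2_ge D_ge) ep_ge) r20
  (lexx (ip (wD h) (wD h)))).2.
(* The inverse weight, since r6 multiplies the square of h in [lambda4] and divides that of g in
   [lambda2]. *)
have r6V : 0 < r6^-1 by rewrite invr_gt0.
have Y3 := (young_ge0 g (S0 _ _ aw0 (M0 _ _ e2_ge gp0)) r6V hh).1.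
rewrite invrK in Y3.
have Y4 := (young_ge0 z (S0 _ _ bw0 gp0) r70 (lexx (ip g g))).1.
have Y5 := (young_ge0 z (S0 _ _ ap0 (M0 _ _ e2_ge bp0)) r80 hh).1.
have Y6 := le_half_sum (M0 _ _ e1_ge aw0) r4_ge hh
  (young_ge0 h (M0 _ _ e1_ge aw0) r40 ff).1.
have Y7 := (young_ge0 z (M0 _ _ e1_ge bw0) r50 ff).1.
have Y8 := (young_ge0 g (M0 _ _ e1_ge gw0) r30 ff).1.
have nE (m : R) : 0 <= m -> `|m * xc * (eps1 + eps2)| = m * `|xc| * (eps1 + eps2).
  by move=> m_0; rewrite !normrM (ger0_norm m_0) (ger0_norm (S0 _ _ e1_ge e2_ge)).
have d0 (m : R) : 0 <= m -> 0 <= m * `|xc| * (eps1 + eps2).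
  by move=> m_0; exact: (M0 _ _ (M0 _ _ m_0 x_ge) (S0 _ _ e1_ge e2_ge)).
have Y9 := cross_form (rho * xc * (eps1 + eps2)) z ltr01 gg.
rewrite nE// in Y9; have {}Y9 := le_half_norm (d0 _ r_ge) zz Y9.
rewrite [W P * _ + _]addrC in Y9.
have Y10 := cross_scalar (ms * xc * (eps1 + eps2)) (AC_rep g l) ltr01 zl.
rewrite nE// in Y10; have {}Y10 := le_half_norm (d0 _ m_ge) gl Y10.
have K1 := M0 _ _ k1_ge (sqr_ge0 (AC_rep g l + eps1 * AC_rep f l)).
have K2 := M0 _ _ k2_ge (sqr_ge0 (AC_rep z l + eps2 * AC_rep h l)).
rewrite E /lambda1 lambda1_W// /lambda3 lambda3_W// /lambda4 lambda4_W//.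
rewrite /lambda6 lambda6_W//.
exact: (dissipation_sum A0 D0 r10 r20 r30 r40 r50 r60 r70 r80 K1 K2 e1_ge e2_ge
  r_ge x_ge m_ge I_ge J_ge ap0 Y1 Y2 Y3 Y4 Y5 Y6 Y7 Y8 Y9 Y10 gg zz hh gl zl).
Qed.

End Multipliers.

Lemma size_sum (pp hh g2 z2 x y qq zz W L : R) : g2 <= W ^+ 2 * qq -> z2 <= W * zz ->
  x <= L * W * qq -> y <= L * zz ->
  pp + hh + g2 + z2 + x + y <=
  1 * pp + 1 * hh + W ^+ 2 * qq + W * zz + L * W * qq + L * zz.
Proof. by move=> *; lra. Qed.

Lemma dissipative : exists2 w, 0 < w &
  forall X, domA P X -> inner2 (opA P X) X <= - w * inner2 X X.
Proof.
have [c0 [C [c0_gt0 C_gt0 equiv]]] := norm_equiv hP eps1_lt eps2_lt.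
have W0 := W_gt0 hP.
case: (hP) => -[l0 r0 Iw0 m0 _] [cw0 cp0 ew0 ep0] [k10 k20 e1 e2].
move=> [aw0 bw0 gw0] [ap0 bp0 gp0].
case: (hS) => _ _ _ _ [r1 [r2 [r3 [r4 [r5 [r6 [r7 [r8
  [[r10 r20 r30 r40] [r50 r60 r70 r80] [L1 L3 L4 L6] mu3 mu6]]]]]]]]].
have A0 : 0 < rho * c_w ^+ 2 by rewrite mulr_gt0 ?exprn_gt0.
have D0 : 0 < Iw * c_p ^+ 2 by rewrite mulr_gt0 ?exprn_gt0.
have {}mu3 := mu3_W (pi_gt0 R) l0 mu3; have {}mu6 := mu6_W (pi_gt0 R) l0 mu6.
rewrite -/(W P) in mu3 mu6.
have a1 := mulr_gt0 L1 A0; have a4 := mulr_gt0 L4 D0.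
have half (x : R) : 0 < x -> 0 < x / 2 by move=> x0; rewrite divr_gt0.
have a3 := half _ mu3; have a6 := half _ mu6.
have [c c_gt0 cP] := lower_combination a1 a4 a3 a6 a3 a6.
have [Cs Cs_gt0 CsP] := upper_combination 1 1 (W P ^+ 2) (W P) (l * W P) l.
(* [c] measures the dissipation in the strains and strain rates, [Cs] bounds the size of the state
   by them, and [C] bounds the form by the size. *)
exists (c / (C * Cs)); first by rewrite divr_gt0// mulr_gt0.
move=> [[[[[f g] h] z] zw] zp] DX.
have HX : Hspace P (f, g, h, z, zw, zp) by case: DX.
have [_ _ _ I2S] := equiv _ HX.
have [fH gH hH zH [zwE zpE _]] := inner2_opA hP DX.
have E := inner2_opA_le r10 r20 r30 r40 r50 r60 r70 r80 DX.
have [gg gl _] := H2L_bounds hP gH; have [zz zl] := H1L_bounds hP zH.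
have p1 := ip_ge0 (wD (wD f)); have p2 := ip_ge0 (wD h).
have p3 := ip_ge0 (wD (wD g)); have p4 := ip_ge0 (wD z).
have {}cP := cP _ _ _ _ _ _ p1 p2 p3 p4 p3 p4.
have {}CsP := CsP _ _ _ _ _ _ p1 p2 p3 p4 p3 p4.
have [e1_ge e2_ge r3_ge r5_ge] := And4 (ltW e1) (ltW e2) (ltW r30) (ltW r50).
have [r6_ge r7_ge r8_ge] := And3 (ltW r60) (ltW r70) (ltW r80).
have l2_ge : 0 <= lambda2 P r3 r6 r7 by exact: lambda2_ge0.
have l5_ge : 0 <= lambda5 P r5 r7 r8 by exact: lambda5_ge0.
rewrite -zwE in gl; rewrite -zpE in zl.
have S := le_trans (size_sum (ip (wD (wD f)) (wD (wD f))) (ip (wD h) (wD h)) gg zz gl zl)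
  CsP.
exact: (dissipation_combine c_gt0 C_gt0 Cs_gt0 l2_ge l5_ge gg zz E cP I2S S).
Qed.

End Dissipative.

(** * Density of the domain *)

Section Approximation.
Context {R : realType}.
Variable l : R.
Hypothesis l0 : 0 < l.

Local Notation mu := (mu_itv l).
Local Notation test := (test_function l).
Local Notation nrm := (form_norm (@ip _ _ _ mu)).
Implicit Types (phi : R -> R) (u v : L2 mu).

Lemma AC_rep_Prm v x : 0 <= x <= l -> AC_rep (Prm v) x = prm v x.
Proof.
move=> x0l; have := @repr_AC_rep R l l0 (Prm v) v 0.
rewrite scale0r add0r => /(_ erefl) rep.
by rewrite (AC_repE l0 rep x0l) add0r.
Qed.

Lemma test_weak_derivative phi : test phi ->
  is_weak_derivative (toL2 mu phi) (toL2 mu (derive1 phi)).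
Proof. by move=> tphi; rewrite -(Prm_derive1 l0 tphi); exact: prm_weak_derivative. Qed.

Lemma test_wD phi : test phi -> wD (toL2 mu phi) = toL2 mu (derive1 phi).
Proof. by move=> tphi; apply: (wDE l0); exact: test_weak_derivative. Qed.

Lemma test_weakly_derivable phi : test phi -> weakly_derivable (toL2 mu phi).
Proof. by move=> tphi; exists (toL2 mu (derive1 phi)); exact: test_weak_derivative. Qed.

Lemma test_AC_rep phi : test phi -> AC_rep (toL2 mu phi) l = 0.
Proof.
move=> tphi; have ll : 0 <= l <= l by rewrite lexx ltW.
rewrite -(Prm_derive1 l0 tphi) AC_rep_Prm// (prm_derive1 l0 tphi ll).
by apply: (test_out tphi); rewrite ltxx andbF.
Qed.

Lemma wD_Prm v : wD (Prm v) = v.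
Proof. by apply: (wDE l0); exact: prm_weak_derivative. Qed.

Lemma Prm_weakly_derivable v : weakly_derivable (Prm v).
Proof. by exists v; exact: prm_weak_derivative. Qed.

(* The derivative of a test function may be added to [chi] without changing the
   value of its primitive at l, and these derivatives have dense primitives. *)
Lemma test_trace_dense u a e : 0 < e -> exists2 chi, test chi &
  nrm (u - Prm (toL2 mu chi)) < e /\ `|a - prm (toL2 mu chi) l| < e.
Proof.
move=> e0; have s0 : 0 <= Num.sqrt l by exact: sqrtr_ge0.
have s1 : 0 < 1 + Num.sqrt l by rewrite ltr_pwDl.
(* A perturbation of size d moves the trace of the primitive at l by at most d times sqrt l; the
   target must then absorb both kinds of error. *)
pose d := e / (1 + Num.sqrt l); have d0 : 0 < d by rewrite divr_gt0.
have dE : d * (1 + Num.sqrt l) = e by rewrite divfK// gt_eqF.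
(* The constant a / l has integral a over ]0, l[, which prescribes the trace up to a small error. *)
have [v tv vP] := test_dense l0 ((a / l) *: @one R l) d0.
have [phi tphi phiP] := test_dense l0 (u - Prm (toL2 mu v)) d0.
have tphi' := test_derive1 tphi.
exists (fun x => 1 * derive1 phi x + v x); first exact: test_lin.
have ll : 0 <= l <= l by rewrite lexx ltW.
rewrite (toL2_lin 1 (test_Lfun l0 tphi') (test_Lfun l0 tv)) Prm_lin// prm_lin.
rewrite (Prm_derive1 l0 tphi) (prm_derive1 l0 tphi ll) (test_out tphi); last first.
  by rewrite ltxx andbF.
rewrite mulr0 add0r scale1r opprD addrCA addrC; split.
  have ds := mulr_ge0 (ltW d0) s0.
  have {}phiP := phiP; apply: (lt_le_trans phiP); lra.
have lN0 : l != 0 by rewrite gt_eqF.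
have -> : a - prm (toL2 mu v) l = ip ((a / l) *: @one R l - toL2 mu v) (@one R l).
  rewrite ipDl ipNl ipZl (ip_oneK l0) (prm_l l0) divfK//.
apply: le_lt_trans (abs_form_CS _ _) _; rewrite (nrm_one l0).
have ds := ler_wpM2r s0 (ltW vP).
by apply: le_lt_trans ds _; lra.
Qed.

Lemma nrm_lt_sqr u d : nrm u < d -> ip u u <= d ^+ 2.
Proof.
move=> ud; have n0 : 0 <= nrm u by exact: form_norm_ge0.
rewrite -(form_norm_sqr (ip_inner _))// lerXn2r ?nnegrE//; last exact: ltW.
by apply: le_trans n0 _; exact: ltW.
Qed.

Lemma norm_lt_sqr (a d : R) : `|a| < d -> a ^+ 2 <= d ^+ 2.
Proof.
move=> ad; rewrite -real_normK ?num_real// lerXn2r ?nnegrE//; last exact: ltW.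
by apply: le_trans (normr_ge0 a) _; exact: ltW.
Qed.

End Approximation.

Section DomainDense.
Context {R : realType}.
Variable P : parameters R.

Local Notation l := (len P).
Local Notation mu := (mu_itv l).
Local Notation L2l := (L2 mu).
Local Notation test := (test_function l).
Local Notation nrm := (form_norm (@ip _ _ _ mu)).

Hypothesis hP : standing_assumptions P.
Hypotheses (eps1_lt : ((eps1 P)%:E < Km1 P)%E) (eps2_lt : ((eps2 P)%:E < Km2 P)%E).

Let l0 : 0 < l. Proof. by case: hP => -[]. Qed.

Lemma Prm_H1L (v : L2l) : @H1L R P (Prm v).
Proof.
split; first exact: Prm_weakly_derivable.
by rewrite (AC_rep_Prm l0) ?prm_out// lexx ltW.
Qed.

Lemma Prm_H2L (v : L2l) : @H2L R P (Prm (Prm v)).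
Proof.
have [h1 h0] := Prm_H1L v.
split; first exact: Prm_weakly_derivable.
- by rewrite (wD_Prm l0).
- by rewrite (AC_rep_Prm l0) ?prm_out// lexx ltW.
- by rewrite (wD_Prm l0).
Qed.

Lemma test_sobolev2 phi : test phi -> sobolev 2 (toL2 mu phi).
Proof.
move=> tphi; split; first exact: test_weakly_derivable.
by rewrite (test_wD l0 tphi); split=> //; apply: test_weakly_derivable => //; exact: test_derive1.
Qed.

(** The stresses of such a state are themselves test functions, psi + eta_w chi' and psi2 + eta_p
    chi2, so that their regularity and the vanishing moment at l come for free. The primitive of
    [chi] is clamped to second order because [chi] is the primitive of its own derivative. *)
Lemma Prm_domA psi chi psi2 chi2 : test psi -> test chi -> test psi2 -> test chi2 ->
  domA P (Prm (Prm (toL2 mu psi)), Prm (toL2 mu chi), Prm (toL2 mu psi2),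
    Prm (toL2 mu chi2), prm (toL2 mu chi) l, prm (toL2 mu chi2) l).
Proof.
move=> tpsi tchi tpsi2 tchi2; have tchi' := test_derive1 tchi.
have ll : 0 <= l <= l by rewrite lexx ltW.
have GE := Prm_derive1 l0 tchi.
have bE : bend (Prm (Prm (toL2 mu psi))) (Prm (toL2 mu chi)) =
    toL2 mu (fun x => eta_w P * derive1 chi x + psi x).
  rewrite (toL2_lin _ (test_Lfun l0 tchi') (test_Lfun l0 tpsi)) addrC.
  by rewrite /bend !(wD_Prm l0) (test_wD l0 tchi).
have tE : twist (Prm (toL2 mu psi2)) (Prm (toL2 mu chi2)) =
    toL2 mu (fun x => eta_p P * chi2 x + psi2 x).
  rewrite (toL2_lin _ (test_Lfun l0 tchi2) (test_Lfun l0 tpsi2)) addrC.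
  by rewrite /twist !(wD_Prm l0).
have tb := test_lin (eta_w P) tchi' tpsi; have tt := test_lin (eta_p P) tchi2 tpsi2.
have H2F : @H2L R P (Prm (Prm (toL2 mu psi))) := Prm_H2L _.
have H2G : @H2L R P (Prm (toL2 mu chi)) by rewrite -GE; exact: Prm_H2L.
have H1H : @H1L R P (Prm (toL2 mu psi2)) := Prm_H1L _.
have H1Z : @H1L R P (Prm (toL2 mu chi2)) := Prm_H1L _.
have ac v : weakly_derivable v -> Defs.AC v := weakly_derivable_AC l0 (u := v).
split; first exact/HspaceP.
split.
  split; [exact/sobolev2P|exact/sobolev1P| | |].
  - by rewrite bE; exact: test_sobolev2.
  - by rewrite tE; split; first exact: test_weakly_derivable.
  - by rewrite bE (test_AC_rep l0 tb).
split; first by rewrite !(AC_rep_Prm l0 _ ll).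
have [F1 F2 _ _] := H2F; have [G1 G2 _ _] := H2G; have [H1 _] := H1H.
have [Z1 _] := H1Z.
split; first by split; apply: ac.
split; [exact: ac|exact: ac| | |].
- by rewrite bE; apply: ac; exact: test_weakly_derivable.
- rewrite bE (test_wD l0 tb); apply: ac; apply: test_weakly_derivable => //.
  exact: test_derive1.
- by rewrite tE; apply: ac; exact: test_weakly_derivable.
Qed.

Lemma add6_le (a1 a2 a3 a4 a5 a6 b : R) : a1 <= b -> a2 <= b -> a3 <= b -> a4 <= b ->
  a5 <= b -> a6 <= b -> a1 + a2 + a3 + a4 + a5 + a6 <= b + b + b + b + b + b.
Proof. by move=> *; rewrite !lerD. Qed.

Lemma state_size_lin a (f g h z f' g' h' z' : L2l) (zw zp zw' zp' : R) :
  state_size (a *: ((f, g, h, z, zw, zp) : state P) + (f', g', h', z', zw', zp')) =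
  ip (wD (wD (a *: f + f'))) (wD (wD (a *: f + f'))) +
  ip (wD (a *: h + h')) (wD (a *: h + h')) +
  ip (a *: g + g') (a *: g + g') + ip (a *: z + z') (a *: z + z') +
  (a * zw + zw') ^+ 2 + (a * zp + zp') ^+ 2.
Proof. exact: erefl. Qed.

Lemma domA_dense X e : Hspace P X -> 0 < e ->
  exists2 Y, domA P Y & norm1 P (X - Y) < e.
Proof.
move=> HX e0; have [c [C [c0 C0 equiv]]] := norm_equiv hP eps1_lt eps2_lt.
(* Six squares of size d^2, weighted by C, give 6 C d^2 < (6 C + 1)^2 d^2 = e^2. *)
pose d := e / (6 * C + 1).
have C1 : 0 < 6 * C + 1 by lra.
have d0 : 0 < d by rewrite divr_gt0.
have dC : C * (d ^+ 2 + d ^+ 2 + d ^+ 2 + d ^+ 2 + d ^+ 2 + d ^+ 2) < e ^+ 2.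
  have -> : C * (d ^+ 2 + d ^+ 2 + d ^+ 2 + d ^+ 2 + d ^+ 2 + d ^+ 2) =
    6 * C * d ^+ 2 by ring.
  have -> : e ^+ 2 = (6 * C + 1) ^+ 2 * d ^+ 2.
    by rewrite -exprMn mulrC divfK ?gt_eqF.
  by rewrite ltr_pM2r ?exprn_gt0//; nra.
case: X HX => [[[[[f g] h] z] zw] zp] HX; have [fH hH] := (HspaceP _ _ _ _ _ _).1 HX.
have [psi tpsi psiP] := test_dense l0 (wD (wD f)) d0.
have [psi2 tpsi2 psi2P] := test_dense l0 (wD h) d0.
have [chi tchi [chiP chil]] := test_trace_dense l0 g zw d0.
have [chi2 tchi2 [chi2P chi2l]] := test_trace_dense l0 z zp d0.
pose Y : state P := (Prm (Prm (toL2 mu psi)), Prm (toL2 mu chi), Prm (toL2 mu psi2),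
    Prm (toL2 mu chi2), prm (toL2 mu chi) l, prm (toL2 mu chi2) l).
have DY : domA P Y by exact: Prm_domA.
exists Y => //; have HY : Hspace P Y by case: DY.
have HD := Hspace_lin l0 (-1) HY HX.
have [_ inner1_le _ _] := equiv _ HD.
have -> : ((f, g, h, z, zw, zp) : state P) - Y = -1 *: Y + (f, g, h, z, zw, zp).
  by rewrite scaleN1r addrC.
have [f1 f2 _ _] := fH; have [h1 _] := hH.
have [F1 F2 _ _] := Prm_H2L (toL2 mu psi); have [H1 _] := Prm_H1L (toL2 mu psi2).
have size_le : state_size (-1 *: Y + (f, g, h, z, zw, zp)) <=
    d ^+ 2 + d ^+ 2 + d ^+ 2 + d ^+ 2 + d ^+ 2 + d ^+ 2.
  have sw (u v : L2l) : nrm (u - v) < d -> ip (-1 *: v + u) (-1 *: v + u) <= d ^+ 2.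
    by move=> uv; rewrite scaleN1r [- v + u]addrC; exact: nrm_lt_sqr.
  have sn (a b : R) : `|a - b| < d -> (-1 * b + a) ^+ 2 <= d ^+ 2.
    by move=> ab; rewrite mulN1r addrC; exact: norm_lt_sqr.
  have fE : wD (wD (-1 *: Prm (Prm (toL2 mu psi)) + f)) = -1 *: toL2 mu psi + wD (wD f).
    by rewrite (wD_lin l0 (-1) F1 f1) (wD_lin l0 (-1) F2 f2) (wD_Prm l0) (wD_Prm l0).
  have hE : wD (-1 *: Prm (toL2 mu psi2) + h) = -1 *: toL2 mu psi2 + wD h.
    by rewrite (wD_lin l0 (-1) H1 h1) (wD_Prm l0).
  have T1 := sw _ _ psiP; rewrite -fE in T1.
  have T2 := sw _ _ psi2P; rewrite -hE in T2.
  rewrite /Y state_size_lin.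
  exact: (add6_le T1 T2 (sw _ _ chiP)
    (sw _ _ chi2P) (sn _ _ chil) (sn _ _ chi2l)).
have bound := le_lt_trans (le_trans inner1_le (ler_wpM2l (ltW C0) size_le)) dC.
rewrite /norm1 -[e]ger0_norm ?(ltW e0)// -sqrtr_sqr ltr_sqrt//.
by rewrite exprn_gt0.
Qed.

End DomainDense.

(** * Decay of the energy and exponential stability *)

Section FinalProof.
Context {R : realType}.
Variable P : parameters R.
Hypothesis hP : standing_assumptions P.

Let l0 : 0 < len P. Proof. by case: hP => -[]. Qed.

Lemma inner2_semi_inner : (forall X, Hspace P X -> 0 <= inner2 X X) ->
  semi_inner (Hspace P) (@inner2 R P).
Proof.
move=> ge0; split.
- exact: Hspace0.
- by move=> a X Y HX HY; exact: Hspace_lin.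
- move=> a X Y Z HX HY HZ; rewrite /inner2 inner1_lin// Psi_lin//.
  by rewrite mulrDr addrACA.
- by move=> X Y _ _; rewrite /inner2 inner1_sym Psi_sym.
- exact: ge0.
Qed.

End FinalProof.

Lemma sqrt_comparable (R : realType) (a b s x y : R) : 0 < a -> 0 < b -> a * s <= x ->
  y <= b * s -> Num.sqrt y <= Num.sqrt (b / a) * Num.sqrt x.
Proof.
move=> a0 b0 sx yb; have r0 : 0 <= b / a by rewrite divr_ge0 ?ltW.
rewrite -sqrtrM//; apply: ler_wsqrtr; apply: le_trans yb _.
have := ler_wpM2l r0 sx; rewrite mulrA divfK// gt_eqF//.
Qed.

(** The energy is compared with the augmented energy twice, at time 0 and at time t; each passage
    through the common size costs C / c, whence the constant (C / c)^2. *)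
Lemma energy_bounds (R : realType) (c C E i1 i2 j1 j2 s t : R) : 0 < c -> 0 < C -> 0 <= E ->
  c * s <= i1 -> i2 <= C * s -> j1 <= C * t -> c * t <= j2 -> j2 <= i2 * E ->
  2^-1 * j2 <= 2^-1 * i2 * E /\ 2^-1 * j1 <= C / c * (C / c) * (2^-1 * i1) * E.
Proof.
move=> c0 C0 E0 s1 i2s j1t tj2 dec; split; first by rewrite -mulrA ler_pM2l.
have r0 : 0 < C / c by rewrite divr_gt0.
have cE (x : R) : C / c * (c * x) = C * x by rewrite mulrA divfK// gt_eqF.
have j1j2 : j1 <= C / c * j2.
  by apply: le_trans j1t _; rewrite -cE ler_pM2l.
have i2i1 : i2 <= C / c * i1.
  by apply: le_trans i2s _; rewrite -cE ler_pM2l.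
have -> : C / c * (C / c) * (2^-1 * i1) * E = 2^-1 * (C / c * (C / c * i1 * E)) by ring.
rewrite ler_pM2l//; apply: le_trans j1j2 _; rewrite ler_pM2l//.
by apply: le_trans dec _; rewrite ler_wpM2r.
Qed.

Theorem corollary16 (R : realType) (P : parameters R)
    (hP : standing_assumptions P) (hS : structural_assumption P)
    (T : R -> state P -> state P)
    (hT : generates (Hspace P) (norm1 P) (domA P) (opA P) T) :
  (exists Lambda K_E : R, [/\ 0 < Lambda, 0 < K_E &
    forall X0, domA P X0 -> forall t : R, 0 <= t ->
      aug_energy (T t X0) <= aug_energy (T 0 X0) * expR (- Lambda * t) /\
      energy (T t X0) <= K_E * energy (T 0 X0) * expR (- Lambda * t)]) /\
  C0_semigroup (Hspace P) (norm1 P) T /\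
  exponentially_stable (Hspace P) (norm1 P) T.
Proof.
have [eps1_lt eps2_lt] := eps_lt hS.
have [c [C [c0 C0 equiv]]] := norm_equiv hP eps1_lt eps2_lt.
have [w w0 diss] := dissipative hP hS.
have size_ge0 (X : state P) : 0 <= state_size X.
  case: X => [[[[[f g] h] z] zw] zp].
  have sum0 (a1 a2 a3 a4 a5 a6 : R) : 0 <= a1 -> 0 <= a2 -> 0 <= a3 -> 0 <= a4 ->
    0 <= a5 -> 0 <= a6 -> 0 <= a1 + a2 + a3 + a4 + a5 + a6.
    by move=> *; rewrite !addr_ge0.
  exact: (sum0 _ _ _ _ _ _ (ip_ge0 _) (ip_ge0 _) (ip_ge0 _) (ip_ge0 _) (sqr_ge0 _)
    (sqr_ge0 _)).
have inner1_ge0 X : Hspace P X -> 0 <= inner1 X X.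
  by case/equiv => le1 _ _ _; apply: le_trans le1; exact: mulr_ge0 (ltW c0) (size_ge0 X).
have inner2_ge0 X : Hspace P X -> 0 <= inner2 X X.
  by case/equiv => _ _ le2 _; apply: le_trans le2; exact: mulr_ge0 (ltW c0) (size_ge0 X).
have B_inner := inner2_semi_inner hP inner2_ge0.
have N_ge0 X : 0 <= norm1 P X by exact: sqrtr_ge0.
(* Both forms lie between c and C times the same size, so either norm is at most [K] times the
   other. *)
pose K := Num.sqrt (C / c).
have K0 : 0 < K by rewrite sqrtr_gt0 divr_gt0.
have N_le X : Hspace P X -> K^-1 * norm1 P X <= form_norm (@inner2 R P) X.
  by case/equiv => _ le1 le2 _; rewrite ler_pdivrMl//; exact: sqrt_comparable le2 le1.
have N_ge X : Hspace P X -> form_norm (@inner2 R P) X <= K * norm1 P X.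
  by case/equiv => le1 _ _ le2; exact: sqrt_comparable le1 le2.
have K'0 : 0 < K^-1 by rewrite invr_gt0.
split; last first.
  split; first exact: hT.1.
  apply: (semigroup_exponentially_stable B_inner N_ge0 K'0 K0 N_le N_ge hT w0 diss).
  by move=> X e HX e0; exact: domA_dense.
have decay X t : domA P X -> 0 <= t ->
    inner2 (T t X) (T t X) <= inner2 X X * expR (- (2 * w) * t).
  move=> DX t0.
  exact: (semigroup_decay B_inner N_ge0 K'0 K0 N_le N_ge hT w0 diss DX t0).
(* The energies are squared norms and therefore decay at twice the rate [w] of the norm. *)
exists (2 * w), (C / c * (C / c)); split; [by rewrite mulr_gt0|by rewrite !mulr_gt0 ?invr_gt0|].
move=> X DX t t0; have HX : Hspace P X by have [] := domain_sub hT DX.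
have HT : Hspace P (T t X) by exact: (semigroup_stable hT.1 t0 HX).
rewrite (semigroup0 hT.1 HX) /aug_energy /energy /norm2 /norm1.
rewrite !sqr_sqrtr ?inner1_ge0 ?inner2_ge0//.
have dX := decay X t DX t0.
have [X1 X2 X3 X4] := equiv _ HX; have [T1 T2 T3 T4] := equiv _ HT.
exact: (energy_bounds c0 C0 (expR_ge0 _) X1 X4 T2 T3 dX).
Qed.
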